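(* Let $k\ge 2$ be an even integer, let $\chi$ be an odd primitive Dirichlet character modulo $q$, and let $a,x>0$. Then for every complex $\nu$ with $\Re(\nu)>0$, \begin{align*} \sum_{n=1}^\infty\bar{\sigma}_{k,\chi}(n)n^{\frac{\nu}{2}}K_\nu(a\sqrt{nx})=&\ \frac{2^{\nu+2k+1}}{a^{\nu+2k+2}} \Gamma(k+1)\Gamma(\nu+k+1)L(1+k,\chi)\, x^{-\frac{\nu}{2}-k-1}\\ &-\frac{(-1)^{\frac{k}{2}}i (aq)^\nu x^{\frac{\nu}{2}}}{2^{3\nu+k+2}\pi^{2\nu+k+1}} \Gamma(\nu+k+1)\tau(\chi) \sum_{n=1}^\infty\frac{\sigma_{k,\bar{\chi}}(n)}{\left( n+\frac{a^2qx}{16\pi^2} \right)^{\nu+k+1} } . \end{align*}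
   Context: For a Dirichlet character $\chi$ and $z\in\mathbb{C}$: $\sigma_{z,\chi}(n)=\sum_{d\mid n}d^z\chi(d)$ and $\bar{\sigma}_{z,\chi}(n)=\sum_{d\mid n}d^z\chi(n/d)$. $\tau(\chi)=\sum_{h=1}^q\chi(h)e^{2\pi i h/q}$ is the Gauss sum, $L(s,\chi)$ the Dirichlet $L$-function, and $K_\nu$ the modified Bessel function of the second kind. *)

(* Defs.v *)
From Stdlib Require Import Reals ZArith.
From Coquelicot Require Import Coquelicot.
Open Scope R_scope.

Definition Cexp (z : C) : C :=
  (exp (Re z) * cos (Im z), exp (Re z) * sin (Im z)).

Definition Rcpow (r : R) (s : C) : C := Cexp (s * RtoC (ln r))%C.

(** Value of a complex series (real and imaginary parts summed separately);
    coincides with the sum whenever the series converges. *)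
Definition CSeries (a : nat -> C) : C :=
  (Series (fun n => Re (a n)), Series (fun n => Im (a n))).

Definition Cis_series (a : nat -> C) (l : C) : Prop :=
  @is_series C_AbsRing C_NormedModule a l.

Definition CGamma (s : C) : C :=
  @RInt_gen C_R_CompleteNormedModule
    (fun t => (Rcpow t (s - 1)%C * RtoC (exp (- t)))%C)
    (at_right 0) (Rbar_locally p_infty).

Definition BesselK (nu : C) (x : R) : C :=
  @RInt_gen C_R_CompleteNormedModule
    (fun t => (RtoC (exp (- x * cosh t)) *
               ((Cexp (nu * RtoC t) + Cexp (- (nu * RtoC t))) / 2))%C)
    (at_right 0) (Rbar_locally p_infty).

Definition dirichlet_char (q : Z) (chi : Z -> C) : Prop :=
  (0 < q)%Z /\
  (forall m n : Z, chi (m * n)%Z = (chi m * chi n)%C) /\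
  (forall n : Z, chi (n + q)%Z = chi n) /\
  (forall n : Z, chi n <> 0%C <-> Z.gcd n q = 1%Z).

(** Primitive: no induced modulus d | q with d < q (Apostol's definition). *)
Definition primitive_char (q : Z) (chi : Z -> C) : Prop :=
  dirichlet_char q chi /\
  forall d : Z, (0 < d)%Z -> (d | q)%Z -> (d < q)%Z ->
    exists n : Z, Z.gcd n q = 1%Z /\ (n mod d = 1 mod d)%Z /\ chi n <> 1%C.

Definition odd_char (chi : Z -> C) : Prop := chi (-1)%Z = (-1)%C.

Definition divisor_sum (n : nat) (f : nat -> C) : C :=
  List.fold_right Cplus 0%C
    (List.map (fun d => if Nat.eqb (n mod d) 0 then f d else 0%C) (List.seq 1 n)).

Definition sigma_chi (k : nat) (chi : Z -> C) (n : nat) : C :=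
  divisor_sum n (fun d => (RtoC (INR d ^ k) * chi (Z.of_nat d))%C).

Definition sigmabar_chi (k : nat) (chi : Z -> C) (n : nat) : C :=
  divisor_sum n (fun d => (RtoC (INR d ^ k) * chi (Z.of_nat (n / d)))%C).

Definition gauss_sum (q : Z) (chi : Z -> C) : C :=
  List.fold_right Cplus 0%C
    (List.map (fun h : nat => (chi (Z.of_nat h) *
            Cexp (Ci * RtoC (2 * PI * INR h / IZR q)))%C)
         (List.seq 1 (Z.to_nat q))).

(** Dirichlet L-function L(s,chi) = sum_{n>=1} chi(n) n^(-s) (series
    convergent here since Re s > 1). *)
Definition Lfun (s : C) (chi : Z -> C) : C :=
  CSeries (fun n => (chi (Z.of_nat (S n)) * Rcpow (INR (S n)) (- s))%C).

Definition conj_char (chi : Z -> C) : Z -> C := fun n => Cconj (chi n).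

(* Main.v *)
Require Import Defs.
From Stdlib Require Import Reals ZArith Lra Lia List Permutation Classical FunctionalExtensionality.
From Coquelicot Require Import Coquelicot.
Open Scope R_scope.

(** Put [B = a^2 x / 4].  Since
    [2 B^(nu/2) n^(nu/2) K_nu (a sqrt (n x)) = int_0^oo t^(nu-1) exp (- t - n B / t) dt],
    the left-hand side is the integral of [t^(nu-1) exp (-t) F (B / t)] with
    [F y = sum_n sigmabar_{k,chi} n exp (- n y) = sum_m chi m sum_d d^k exp (- d m y)].
    Lipschitz's formula turns the sum over [d] into [k! sum_j (m y - 2 i pi j)^(-k-1)] over all
    integers [j].  The term [j = 0] gives [k! L (k+1, chi) / y^(k+1)].  In the others the sums
    over [m] and [j] are exchanged; as [chi] and [k+1] are odd, the sum over [m >= 1] of the pair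
    [j], [-j] is a sum over all integers [m], and a second application of Lipschitz's formula,
    twisted by [chi], together with the separability of the Gauss sum of a primitive character gives
    [F y = k! L (k+1, chi) / y^(k+1)
           + (- 2 i pi / (q y))^(k+1) tau sum_n sigma_{k,conj chi} n exp (- 4 pi^2 n / (q y))].
    Both series of [t^(nu-1) exp (-t) F (B / t)] are dominated termwise by [M_n g(t)] with
    [sum_n M_n] and [int g] finite, so they can be integrated term by term, and the integrals on
    the right are Gamma integrals.

    The twisted Lipschitz formula is the limit of a finite identity over roots of unity. *)

(** * Complex sums and series *)

(** The limit behind Lipschitz's formula is a limit of series under a common majorant. That majorant
    exists only if the finite identity is summed over a period centred at 0, where the distance from
    [exp (- w / M)] to 1 is at least a constant times [|w| / M]; this is why the finite sums run
    over the pairs [m], [-1 - m]. The exchange of the sums over [m] and [j] is absolute: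
    [|m y + 2 i pi j|^2 >= 4 pi y m j], and [k + 1 >= 3] turns this into a majorant [(m j)^(-3/2)].
    In the termwise integration the delicate region is [t] near 0, where the dual terms behave like
    [t^(nu+k) exp (- n t / c)] with [c = q B / (4 pi^2)]: half of [Re nu] is spent on summability in
    [n], the other half on integrability at 0. The dual series is moved to the side of the Bessel
    series before integrating, so that the sum function is one explicit Gamma integrand with a known
    integral. *)

Lemma im_le_Cmod (z : C) : Rabs (Im z) <= Cmod z.
Proof.
  eapply Rle_trans; [|apply (Rmax_Cmod z)]. apply Rmax_r.
Qed.

Fixpoint Csum (f : nat -> C) (n : nat) : C :=
  match n with O => 0%C | S m => (Csum f m + f m)%C end.

Lemma Csum_ext (f g : nat -> C) n :
  (forall i, (i < n)%nat -> f i = g i) -> Csum f n = Csum g n.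
Proof.
  induction n as [|n IH]; intros H; simpl; [reflexivity|].
  rewrite IH by (intros; apply H; lia). rewrite H by lia. reflexivity.
Qed.

Lemma Csum_plus (f g : nat -> C) n : Csum (fun i => f i + g i)%C n = (Csum f n + Csum g n)%C.
Proof. induction n as [|n IH]; simpl; [|rewrite IH]; ring. Qed.

Lemma Csum_scal (c : C) (f : nat -> C) n : Csum (fun i => c * f i)%C n = (c * Csum f n)%C.
Proof. induction n as [|n IH]; simpl; [|rewrite IH]; ring. Qed.

Lemma Csum_zero (f : nat -> C) n : (forall i, (i < n)%nat -> f i = 0%C) -> Csum f n = 0%C.
Proof.
  induction n as [|n IH]; intros H; simpl; [reflexivity|].
  rewrite IH by (intros; apply H; lia). rewrite H by lia. ring.
Qed.

Lemma Csum_add (f : nat -> C) m n : Csum f (m + n) = (Csum f m + Csum (fun i => f (m + i)%nat) n)%C.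
Proof.
  induction n as [|n IH]; simpl; [rewrite Nat.add_0_r; ring|].
  rewrite Nat.add_succ_r. simpl. rewrite IH. ring.
Qed.

Lemma Csum_S_l (f : nat -> C) n : Csum f (S n) = (f 0%nat + Csum (fun i => f (S i)) n)%C.
Proof. change (S n) with (1 + n)%nat. rewrite (Csum_add f 1 n). simpl. ring. Qed.

Lemma Csum_mul (f : nat -> C) m n :
  Csum f (m * n) = Csum (fun l => Csum (fun h => f (m * l + h)%nat) m) n.
Proof.
  induction n as [|n IH]; simpl; [rewrite Nat.mul_0_r; reflexivity|].
  rewrite Nat.mul_succ_r, Csum_add, IH. reflexivity.
Qed.

Lemma Csum_swap (f : nat -> nat -> C) m n :
  Csum (fun i => Csum (f i) n) m = Csum (fun j => Csum (fun i => f i j) m) n.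
Proof.
  induction m as [|m IH]; simpl.
  - symmetry. apply Csum_zero. reflexivity.
  - rewrite IH, <- Csum_plus. reflexivity.
Qed.

Lemma Csum_rev (f : nat -> C) n : Csum (fun i => f (n - 1 - i)%nat) n = Csum f n.
Proof.
  induction n as [|n IH]; [reflexivity|].
  rewrite Csum_S_l. simpl. rewrite <- IH.
  rewrite (Csum_ext (fun i => f (n - 0 - S i)%nat) (fun i => f (n - 1 - i)%nat))
    by (intros; f_equal; lia).
  replace (n - 0 - 0)%nat with n by lia. ring.
Qed.

Lemma Csum_single (f : nat -> C) n i :
  (i < n)%nat -> (forall j, (j < n)%nat -> j <> i -> f j = 0%C) -> Csum f n = f i.
Proof.
  intros Hi H. replace n with (i + S (n - i - 1))%nat by lia.
  rewrite Csum_add, Csum_S_l, Nat.add_0_r.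
  rewrite (Csum_zero f i) by (intros; apply H; lia).
  rewrite (Csum_zero (fun j => f (i + S j)%nat)) by (intros; apply H; lia). ring.
Qed.

Lemma Cmod_Csum_le (f : nat -> C) (M : nat -> R) n :
  (forall i, Cmod (f i) <= M i) -> Cmod (Csum f n) <= match n with O => 0 | S m => sum_n M m end.
Proof.
  intros H. destruct n as [|n]; [simpl; rewrite Cmod_0; lra|].
  induction n as [|n IH].
  - simpl. rewrite sum_O. rewrite Cplus_0_l. apply H.
  - change (Csum f (S (S n))) with (Csum f (S n) + f (S n))%C.
    rewrite sum_Sn. eapply Rle_trans; [apply Cmod_triangle|].
    apply Rplus_le_compat; auto.
Qed.

Lemma Re_plus (x y : C) : Re (x + y) = Re x + Re y.
Proof. reflexivity. Qed.
Lemma Im_plus (x y : C) : Im (x + y) = Im x + Im y.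
Proof. reflexivity. Qed.

Lemma sum_n_Csum (a : nat -> C) n :
  @sum_n C_AbelianMonoid a n = Csum a (S n).
Proof.
  induction n as [|n IH].
  - rewrite sum_O. simpl. symmetry. apply Cplus_0_l.
  - rewrite sum_Sn, IH. reflexivity.
Qed.

Lemma sum_n_Re (a : nat -> C) n : sum_n (fun i => Re (a i)) n = Re (Csum a (S n)).
Proof.
  induction n as [|n IH].
  - rewrite sum_O. simpl Csum. rewrite Cplus_0_l. reflexivity.
  - rewrite sum_Sn, IH. reflexivity.
Qed.

Lemma sum_n_Im (a : nat -> C) n : sum_n (fun i => Im (a i)) n = Im (Csum a (S n)).
Proof.
  induction n as [|n IH].
  - rewrite sum_O. simpl Csum. rewrite Cplus_0_l. reflexivity.
  - rewrite sum_Sn, IH. reflexivity.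
Qed.

(** Limits are taken in the real and imaginary parts, so that the theory of real sequences applies
    directly. *)
Definition clim (u : nat -> C) (l : C) : Prop :=
  is_lim_seq (fun n => Re (u n)) (Re l) /\ is_lim_seq (fun n => Im (u n)) (Im l).

Lemma filterlim_C_iff {T} (F : (T -> Prop) -> Prop) {FF : Filter F} (u : T -> C) (l : C) :
  filterlim u F (locally (T := C_UniformSpace) l) <->
  filterlim (fun n => Re (u n)) F (locally (Re l)) /\
  filterlim (fun n => Im (u n)) F (locally (Im l)).
Proof.
  rewrite (filterlim_locally (U := C_UniformSpace) u l), !filterlim_locally. split.
  - intros H. split; intros eps; (eapply filter_imp; [|exact (H eps)]); intros x [H1 H2]; assumption.
  - intros [H1 H2] eps.
    generalize (filter_and _ _ (H1 eps) (H2 eps)). apply filter_imp.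
    intros x [A B]. split; assumption.
Qed.

Lemma Cis_series_Re_Im (a : nat -> C) (l : C) :
  Cis_series a l <->
  is_series (fun n => Re (a n)) (Re l) /\ is_series (fun n => Im (a n)) (Im l).
Proof.
  unfold Cis_series, is_series.
  rewrite (filterlim_C_iff eventually (@sum_n C_AbelianMonoid a) l).
  split; intros [H1 H2]; split.
  - eapply filterlim_ext; [|exact H1]. intros n. cbv beta. rewrite sum_n_Re, sum_n_Csum. reflexivity.
  - eapply filterlim_ext; [|exact H2]. intros n. cbv beta. rewrite sum_n_Im, sum_n_Csum. reflexivity.
  - eapply filterlim_ext; [|exact H1]. intros n. cbv beta. rewrite sum_n_Re, sum_n_Csum. reflexivity.
  - eapply filterlim_ext; [|exact H2]. intros n. cbv beta. rewrite sum_n_Im, sum_n_Csum. reflexivity.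
Qed.

Lemma Cis_series_clim (a : nat -> C) (l : C) : Cis_series a l <-> clim (Csum a) l.
Proof.
  rewrite Cis_series_Re_Im. unfold clim.
  (* [sum_n a n] has [n + 1] terms and [Csum a n] has [n], hence the shift by one. *)
  rewrite (is_lim_seq_incr_1 (fun n => Re (Csum a n))), (is_lim_seq_incr_1 (fun n => Im (Csum a n))).
  split; intros [H1 H2]; split.
  - eapply is_lim_seq_ext; [|exact H1]. intros n. apply sum_n_Re.
  - eapply is_lim_seq_ext; [|exact H2]. intros n. apply sum_n_Im.
  - eapply filterlim_ext; [|exact H1]. intros n. symmetry. apply sum_n_Re.
  - eapply filterlim_ext; [|exact H2]. intros n. symmetry. apply sum_n_Im.
Qed.

Lemma clim_ext (u v : nat -> C) l : (forall n, u n = v n) -> clim u l -> clim v l.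
Proof.
  intros H [H1 H2]. split; eapply is_lim_seq_ext; [|exact H1| |exact H2];
  intros n; cbv beta; rewrite H; reflexivity.
Qed.

Lemma clim_unique (u : nat -> C) l1 l2 : clim u l1 -> clim u l2 -> l1 = l2.
Proof.
  intros [A B] [A' B'].
  apply is_lim_seq_unique in A; apply is_lim_seq_unique in A'.
  apply is_lim_seq_unique in B; apply is_lim_seq_unique in B'.
  rewrite A in A'; rewrite B in B'. injection A' as A'. injection B' as B'.
  destruct l1, l2; simpl in *; congruence.
Qed.

Lemma clim_const (c : C) : clim (fun _ => c) c.
Proof. split; apply is_lim_seq_const. Qed.

Lemma clim_plus (u v : nat -> C) (a b : C) : clim u a -> clim v b -> clim (fun n => u n + v n)%C (a + b)%C.
Proof.
  intros [A B] [A' B']. split; simpl; apply is_lim_seq_plus'; assumption.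
Qed.

Lemma clim_mult (u v : nat -> C) (a b : C) : clim u a -> clim v b -> clim (fun n => u n * v n)%C (a * b)%C.
Proof.
  intros [A B] [A' B']. split; simpl.
  - apply is_lim_seq_minus'; apply is_lim_seq_mult'; assumption.
  - apply is_lim_seq_plus'; apply is_lim_seq_mult'; assumption.
Qed.

Lemma clim_pow (u : nat -> C) (a : C) k : clim u a -> clim (fun n => u n ^ k)%C (a ^ k)%C.
Proof.
  intros H. induction k as [|k IH]; simpl; [apply clim_const|].
  apply clim_mult; assumption.
Qed.

Lemma clim_inv (u : nat -> C) (a : C) : a <> 0%C -> clim u a -> clim (fun n => / u n)%C (/ a)%C.
Proof.
  intros Ha [A B].
  assert (D : is_lim_seq (fun n => Re (u n) ^ 2 + Im (u n) ^ 2) (Re a ^ 2 + Im a ^ 2)).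
  { simpl. repeat first [apply is_lim_seq_plus' | apply is_lim_seq_mult' | apply is_lim_seq_const]; assumption. }
  assert (N : Re a ^ 2 + Im a ^ 2 <> 0).
  { rewrite <- Cmod2_alt. apply pow_nonzero. intros H. apply Ha, Cmod_eq_0, H. }
  split; unfold Cinv; simpl.
  - apply (is_lim_seq_div' (fun n => fst (u n)) (fun n => Re (u n) ^ 2 + Im (u n) ^ 2)); assumption.
  - apply (is_lim_seq_div' (fun n => - snd (u n)) (fun n => Re (u n) ^ 2 + Im (u n) ^ 2)); try assumption.
    apply (is_lim_seq_opp (fun n => Im (u n)) (Im a)). exact B.
Qed.

Lemma clim_subseq (u : nat -> C) (phi : nat -> nat) l :
  filterlim phi eventually eventually -> clim u l -> clim (fun n => u (phi n)) l.
Proof.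
  intros H [A B]. split.
  - apply (is_lim_seq_subseq (fun n => Re (u n)) (Re l) phi); assumption.
  - apply (is_lim_seq_subseq (fun n => Im (u n)) (Im l) phi); assumption.
Qed.

Lemma Cis_series_ext (a b : nat -> C) l :
  (forall n, a n = b n) -> Cis_series a l -> Cis_series b l.
Proof. apply (is_series_ext (K := C_AbsRing) (V := C_NormedModule)). Qed.

Lemma Cis_series_unique a l : Cis_series a l -> CSeries a = l.
Proof.
  rewrite Cis_series_Re_Im. intros [A B]. unfold CSeries.
  rewrite (is_series_unique _ _ A), (is_series_unique _ _ B). destruct l; reflexivity.
Qed.

Lemma Cis_series_plus (a b : nat -> C) (la lb : C) :
  Cis_series a la -> Cis_series b lb -> Cis_series (fun n => a n + b n)%C (la + lb)%C.
Proof. apply (is_series_plus (K := C_AbsRing) (V := C_NormedModule)). Qed.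

Lemma Cis_series_scal (c : C) (a : nat -> C) (l : C) : Cis_series a l -> Cis_series (fun n => c * a n)%C (c * l)%C.
Proof. apply (is_series_scal (K := C_AbsRing) (V := C_NormedModule)). Qed.

Lemma Cis_series_minus (a b : nat -> C) (la lb : C) :
  Cis_series a la -> Cis_series b lb -> Cis_series (fun n => a n - b n)%C (la - lb)%C.
Proof. apply (is_series_minus (K := C_AbsRing) (V := C_NormedModule)). Qed.

Lemma Cis_series_dom (b : nat -> C) (M : nat -> R) :
  (forall n, Cmod (b n) <= M n) -> ex_series M -> Cis_series b (CSeries b).
Proof.
  intros H HM. rewrite Cis_series_Re_Im. unfold CSeries; simpl. split.
  - apply Series_correct. eapply (@ex_series_le R_AbsRing R_CompleteNormedModule); [|exact HM].
    intros n. eapply Rle_trans; [apply re_le_Cmod|apply H].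
  - apply Series_correct. eapply (@ex_series_le R_AbsRing R_CompleteNormedModule); [|exact HM].
    intros n. eapply Rle_trans; [apply im_le_Cmod|apply H].
Qed.

Lemma Cis_series_shift (a : nat -> C) (l : C) :
  a 0%nat = 0%C -> Cis_series a l <-> Cis_series (fun n => a (S n)) l.
Proof.
  intros H. rewrite !Cis_series_clim. unfold clim.
  rewrite (is_lim_seq_incr_1 (fun n => Re (Csum a n))), (is_lim_seq_incr_1 (fun n => Im (Csum a n))).
  assert (E : forall n, Csum a (S n) = Csum (fun i => a (S i)) n).
  { intros n. rewrite Csum_S_l, H. ring. }
  split; intros [A B]; split; eapply is_lim_seq_ext; try exact A; try exact B;
  intros n; cbv beta; rewrite E; reflexivity.
Qed.

Lemma Cis_series_finite (a : nat -> C) N :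
  (forall n, (N <= n)%nat -> a n = 0%C) -> Cis_series a (Csum a N).
Proof.
  intros H. apply Cis_series_clim.
  assert (E : forall n, (N <= n)%nat -> Csum a n = Csum a N).
  { intros n Hn. replace n with (N + (n - N))%nat by lia.
    rewrite Csum_add, (Csum_zero (fun i => a (N + i)%nat)) by (intros; apply H; lia). ring. }
  split; eapply is_lim_seq_ext_loc; [|apply is_lim_seq_const| |apply is_lim_seq_const];
  exists N; intros n Hn; rewrite (E n Hn); reflexivity.
Qed.

Lemma Cis_series_Csum (u : nat -> nat -> C) (l : nat -> C) J :
  (forall j, (j < J)%nat -> Cis_series (fun m => u m j) (l j)) ->
  Cis_series (fun m => Csum (u m) J) (Csum l J).
Proof.
  induction J as [|J IH]; intros H; simpl.
  - apply (Cis_series_finite (fun _ => 0%C) 0). reflexivity.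
  - apply Cis_series_plus; [apply IH; intros; apply H; lia|apply H; lia].
Qed.

(** * Limits of series under a majorant *)

Lemma Series_nonneg (a : nat -> R) : (forall n, 0 <= a n) -> ex_series a -> 0 <= Series a.
Proof.
  intros H Hex.
  assert (S0 : forall n, 0 <= sum_n a n).
  { intros n. induction n as [|n IH]; [rewrite sum_O; apply H|].
    rewrite sum_Sn. apply Rplus_le_le_0_compat; auto. }
  apply (is_lim_seq_le (fun _ => 0) (sum_n a) 0 (Series a)); auto.
  - apply is_lim_seq_const.
  - apply Series_correct, Hex.
Qed.

Lemma Series_tail_small (M : nat -> R) :
  ex_series M -> is_lim_seq (fun N => Series (fun n => M (N + n)%nat)) 0.
Proof.
  intros H.
  apply is_lim_seq_incr_1.
  apply is_lim_seq_ext with (fun N => Series M - sum_n M N).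
  - intros N. rewrite (Series_incr_n M (S N)) by (lia || assumption).
    simpl pred. rewrite sum_n_Reals. ring.
  - replace (Finite 0) with (Finite (Series M - Series M)) by (f_equal; ring).
    apply is_lim_seq_minus'; [apply is_lim_seq_const|]. apply Series_correct, H.
Qed.

(** The tail of [M] beyond some [N] bounds all the tails at once by [eps / 2]; the [N + 1] remaining
    terms tend to 0 together. *)
Lemma tannery_zero (c : nat -> nat -> R) (M : nat -> R) :
  (forall L n, 0 <= c L n <= M n) -> ex_series M ->
  (forall n, is_lim_seq (fun L => c L n) 0) ->
  is_lim_seq (fun L => Series (c L)) 0.
Proof.
  intros Hc HM H0.
  assert (Hex : forall L, ex_series (c L)).
  { intros L. eapply (@ex_series_le R_AbsRing R_CompleteNormedModule); [|exact HM].
    intros n. change (norm (c L n)) with (Rabs (c L n)). destruct (Hc L n). rewrite Rabs_pos_eq; lra. }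
  apply is_lim_seq_spec. intros eps.
  assert (He : 0 < eps / 2) by (destruct eps; simpl; lra).
  assert (HT := Series_tail_small M HM). apply is_lim_seq_spec in HT.
  destruct (HT (mkposreal _ He)) as [N HN].
  specialize (HN (S N) ltac:(lia)). simpl in HN. rewrite Rminus_0_r in HN.
  assert (HF : is_lim_seq (fun L => sum_n (c L) N) 0).
  { clear HN. induction N as [|N IH].
    - eapply is_lim_seq_ext; [|apply (H0 0%nat)]. intros L. rewrite sum_O. reflexivity.
    - apply is_lim_seq_ext with (fun L => sum_n (c L) N + c L (S N)).
      { intros L. rewrite sum_Sn. reflexivity. }
      replace (Finite 0) with (Finite (0 + 0)) by (f_equal; ring).
      apply is_lim_seq_plus'; [exact IH|apply H0]. }
  apply is_lim_seq_spec in HF. destruct (HF (mkposreal _ He)) as [L0 HL0].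
  exists L0. intros L HL. specialize (HL0 L HL). simpl in HL0. rewrite Rminus_0_r in *.
  rewrite (Series_incr_n (c L) (S N)) by (lia || apply Hex).
  simpl pred. rewrite <- sum_n_Reals.
  assert (T : 0 <= Series (fun k => c L (S N + k)%nat) <= Series (fun k => M (S N + k)%nat)).
  { split.
    - apply Series_nonneg.
      + intros n; apply Hc.
      + apply (ex_series_incr_n (c L) (S N)), Hex.
    - apply Series_le; [intros n; apply Hc|]. apply (ex_series_incr_n M (S N)), HM. }
  apply Rabs_def2 in HN. apply Rabs_def2 in HL0. apply Rabs_def1; simpl in *; lra.
Qed.

(** Dominated convergence for series: [tannery_zero] applies to [|a L n - b n|], which stays below
    [2 * M n]. *)
Lemma tannery (a : nat -> nat -> R) (b : nat -> R) (M : nat -> R) :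
  (forall L n, Rabs (a L n) <= M n) -> ex_series M ->
  (forall n, is_lim_seq (fun L => a L n) (b n)) ->
  is_lim_seq (fun L => Series (a L)) (Series b).
Proof.
  intros Ha HM Hl.
  assert (Hb : forall n, Rabs (b n) <= M n).
  { intros n. apply (is_lim_seq_le (fun L => Rabs (a L n)) (fun _ => M n) (Rabs (b n)) (M n)).
    - intros L; apply Ha.
    - apply (is_lim_seq_abs _ (Finite (b n))), Hl.
    - apply is_lim_seq_const. }
  assert (Hea : forall L, ex_series (a L)).
  { intros L. eapply (@ex_series_le R_AbsRing R_CompleteNormedModule); [|exact HM]. apply Ha. }
  assert (Heb : ex_series b).
  { eapply (@ex_series_le R_AbsRing R_CompleteNormedModule); [|exact HM]. apply Hb. }
  assert (HM2 : ex_series (fun n => 2 * M n)) by (apply (ex_series_scal 2 M HM)).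
  assert (Hc : forall L n, 0 <= Rabs (a L n - b n) <= 2 * M n).
  { intros L n. split; [apply Rabs_pos|].
    eapply Rle_trans; [apply Rabs_triang|]. rewrite Rabs_Ropp.
    specialize (Ha L n). specialize (Hb n). lra. }
  assert (HT : is_lim_seq (fun L => Series (fun n => Rabs (a L n - b n))) 0).
  { apply (tannery_zero _ (fun n => 2 * M n)); auto.
    intros n. rewrite <- Rabs_R0. apply (is_lim_seq_abs _ (Finite 0)).
    replace (Finite 0) with (Finite (b n - b n)) by (f_equal; ring).
    apply is_lim_seq_minus'; [apply Hl|apply is_lim_seq_const]. }
  assert (HD : is_lim_seq (fun L => Series (a L) - Series b) 0).
  { apply is_lim_seq_abs_0.
    eapply (is_lim_seq_le_le (fun _ => 0)); [|apply is_lim_seq_const|exact HT].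
    intros L; split; [apply Rabs_pos|].
    rewrite <- Series_minus by auto. apply Series_Rabs.
    eapply (@ex_series_le R_AbsRing R_CompleteNormedModule); [|exact HM2].
    intros n. change (norm ?z) with (Rabs z). rewrite Rabs_Rabsolu. apply Hc. }
  apply is_lim_seq_ext with (fun L => (Series (a L) - Series b) + Series b); [intros; ring|].
  replace (Finite (Series b)) with (Finite (0 + Series b)) by (f_equal; ring).
  apply is_lim_seq_plus'; [exact HD|apply is_lim_seq_const].
Qed.

Lemma tannery_C (a : nat -> nat -> C) (b : nat -> C) (M : nat -> R) :
  (forall L n, Cmod (a L n) <= M n) -> ex_series M ->
  (forall n, clim (fun L => a L n) (b n)) ->
  clim (fun L => CSeries (a L)) (CSeries b).
Proof.
  intros Ha HM Hl. split; simpl.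
  - apply (tannery (fun L n => Re (a L n)) (fun n => Re (b n)) M); auto.
    + intros L n. eapply Rle_trans; [apply re_le_Cmod|apply Ha].
    + intros n; apply Hl.
  - apply (tannery (fun L n => Im (a L n)) (fun n => Im (b n)) M); auto.
    + intros L n. eapply Rle_trans; [apply im_le_Cmod|apply Ha].
    + intros n; apply Hl.
Qed.

Lemma clim_Cmod_le (u : nat -> C) l K : clim u l -> (forall n, Cmod (u n) <= K) -> Cmod l <= K.
Proof.
  intros [A B] H.
  assert (K0 : 0 <= K) by (eapply Rle_trans; [apply Cmod_ge_0|apply (H 0%nat)]).
  apply Rsqr_incr_0; [|apply Cmod_ge_0|exact K0]. rewrite !Rsqr_pow2, Cmod2_alt.
  apply (is_lim_seq_le (fun n => Re (u n) ^ 2 + Im (u n) ^ 2) (fun _ => K ^ 2)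
           (Re l ^ 2 + Im l ^ 2) (K ^ 2)).
  - intros n. rewrite <- Cmod2_alt. apply pow_incr. split; [apply Cmod_ge_0|apply H].
  - simpl. repeat first [apply is_lim_seq_plus' | apply is_lim_seq_mult' | apply is_lim_seq_const]; assumption.
  - apply is_lim_seq_const.
Qed.

Lemma sum_n_le_Series (B : nat -> R) n :
  (forall j, 0 <= B j) -> ex_series B -> sum_n B n <= Series B.
Proof.
  intros HB Hex. rewrite (Series_incr_n B (S n)) by (lia || assumption).
  simpl pred. rewrite <- sum_n_Reals.
  assert (0 <= Series (fun k => B (S n + k)%nat)); [|lra].
  apply Series_nonneg.
  - intros j; apply HB.
  - apply (ex_series_incr_n B (S n)), Hex.
Qed.

Lemma Cmod_Csum_le_Series (u : nat -> C) (B : nat -> R) J :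
  (forall j, Cmod (u j) <= B j) -> ex_series B -> Cmod (Csum u J) <= Series B.
Proof.
  intros H Hex.
  assert (HB : forall j, 0 <= B j) by (intros j; eapply Rle_trans; [apply Cmod_ge_0|apply H]).
  eapply Rle_trans; [apply (Cmod_Csum_le u B J H)|]. destruct J as [|J].
  - apply Series_nonneg; auto.
  - apply sum_n_le_Series; auto.
Qed.

Lemma Cmod_CSeries_le (u : nat -> C) (B : nat -> R) :
  (forall j, Cmod (u j) <= B j) -> ex_series B -> Cmod (CSeries u) <= Series B.
Proof.
  intros H Hex. apply (clim_Cmod_le (Csum u)).
  - apply Cis_series_clim. eapply Cis_series_dom; eassumption.
  - intros n. apply Cmod_Csum_le_Series; assumption.
Qed.

(** Fubini for a double series with a product majorant. The partial sums over [j] of the column sums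
    are series over [m] of partial row sums, and [tannery_C] takes the limit with majorant
    [A m * Series B]. *)
Lemma double_series_swap (u : nat -> nat -> C) (A B : nat -> R) :
  (forall m j, Cmod (u m j) <= A m * B j) -> (forall m, 0 <= A m) ->
  ex_series A -> ex_series B ->
  Cis_series (fun m => CSeries (u m)) (CSeries (fun m => CSeries (u m))) /\
  Cis_series (fun j => CSeries (fun m => u m j)) (CSeries (fun m => CSeries (u m))).
Proof.
  intros H HA EA EB.
  assert (EB' : forall m, ex_series (fun j => A m * B j)) by (intros m; apply (ex_series_scal (A m) B EB)).
  assert (EA' : forall j, ex_series (fun m => A m * B j)) by (intros j; apply (ex_series_scal_r (B j) A EA)).
  assert (EAB : ex_series (fun m => A m * Series B)) by (apply (ex_series_scal_r (Series B) A EA)).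
  assert (D : forall m J, Cmod (Csum (u m) J) <= A m * Series B).
  { intros m J. rewrite <- Series_scal_l. apply Cmod_Csum_le_Series; auto. }
  split.
  - apply (Cis_series_dom _ (fun m => A m * Series B)); auto.
    intros m. rewrite <- Series_scal_l. apply Cmod_CSeries_le; auto.
  - apply Cis_series_clim.
    apply clim_ext with (fun J => CSeries (fun m => Csum (u m) J)).
    + intros J. apply Cis_series_unique. apply Cis_series_Csum. intros j _.
      eapply Cis_series_dom; [|apply (EA' j)]. intros m; apply H.
    + apply (tannery_C (fun J m => Csum (u m) J) _ (fun m => A m * Series B)); auto.
      intros m. apply Cis_series_clim. eapply Cis_series_dom; [apply H|apply EB'].
Qed.

(** The sequence [u] placed on the multiples of [d], with zeros between them. Sums over multiples,
    and divisibility conditions in double sums, thereby become series over all [n]. *)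
Definition sparse (d : nat) (u : nat -> C) (n : nat) : C :=
  if Nat.eqb (n mod d) 0 then u (n / d)%nat else 0%C.

Lemma Csum_sparse d u N : (0 < d)%nat -> Csum (sparse d u) (d * N) = Csum u N.
Proof.
  intros Hd. rewrite Csum_mul. apply Csum_ext. intros l _.
  rewrite (Csum_single _ d 0%nat Hd).
  - unfold sparse. rewrite Nat.add_0_r, Nat.mul_comm, Nat.Div0.mod_mul, Nat.div_mul by lia. reflexivity.
  - intros j Hj Hj0. unfold sparse.
    rewrite Nat.add_comm, Nat.mul_comm, Nat.Div0.mod_add, Nat.mod_small by lia.
    destruct (Nat.eqb_spec j 0); [lia|reflexivity].
Qed.

Lemma Cis_series_sparse d u l : (0 < d)%nat -> Cis_series (sparse d u) l -> Cis_series u l.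
Proof.
  intros Hd H. apply Cis_series_clim in H. apply Cis_series_clim.
  apply (clim_subseq _ (fun N => (d * N)%nat)) in H.
  - eapply clim_ext; [|exact H]. intros N. apply Csum_sparse, Hd.
  - intros P [N HN]. exists N. intros n Hn. apply HN. nia.
Qed.

(** * Exponentials and elementary bounds *)

Lemma Cexp_add (z w : C) : Cexp (z + w) = (Cexp z * Cexp w)%C.
Proof.
  unfold Cexp. rewrite Re_plus, Im_plus, exp_plus, cos_plus, sin_plus.
  unfold Cmult; simpl. f_equal; ring.
Qed.

Lemma Cexp_0 : Cexp 0 = 1%C.
Proof. unfold Cexp; simpl. rewrite exp_0, cos_0, sin_0. unfold RtoC. f_equal; ring. Qed.

Lemma Cexp_RtoC (x : R) : Cexp x = RtoC (exp x).
Proof. unfold Cexp; simpl. rewrite cos_0, sin_0. unfold RtoC. f_equal; ring. Qed.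

Lemma Cmod_Cexp (z : C) : Cmod (Cexp z) = exp (Re z).
Proof.
  unfold Cmod, Cexp; simpl.
  replace (_ + _) with (Rsqr (exp (Re z)) * (Rsqr (sin (Im z)) + Rsqr (cos (Im z)))) by (unfold Rsqr; ring).
  rewrite sin2_cos2, Rmult_1_r. apply sqrt_Rsqr. left; apply exp_pos.
Qed.

Lemma Cexp_neq_0 (z : C) : Cexp z <> 0%C.
Proof. apply Cmod_gt_0. rewrite Cmod_Cexp. apply exp_pos. Qed.

Lemma Cexp_opp (z : C) : Cexp (- z) = (/ Cexp z)%C.
Proof.
  assert (H : (Cexp (- z) * Cexp z = 1)%C).
  { rewrite <- Cexp_add. replace (- z + z)%C with (RtoC 0) by ring. apply Cexp_0. }
  assert (N := Cexp_neq_0 z). rewrite <- (Cmult_1_l (/ Cexp z)), <- H. field. exact N.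
Qed.

Lemma Cexp_pow (z : C) n : (Cexp z ^ n)%C = Cexp (RtoC (INR n) * z).
Proof.
  induction n as [|n IH].
  - simpl. rewrite Cmult_0_l, Cexp_0. reflexivity.
  - rewrite Cpow_S, IH, <- Cexp_add. f_equal. rewrite S_INR, RtoC_plus. ring.
Qed.

Definition Ce (x : R) : C := Cexp (Ci * RtoC x).

Lemma Ce_val x : Ce x = (cos x, sin x).
Proof.
  unfold Ce, Cexp; simpl. replace (0 * x - 1 * 0) with 0 by ring. rewrite exp_0.
  replace (0 * 0 + 1 * x) with x by ring. f_equal; ring.
Qed.

Lemma Ce_add x y : Ce (x + y) = (Ce x * Ce y)%C.
Proof. unfold Ce. rewrite <- Cexp_add. f_equal. rewrite RtoC_plus. ring. Qed.

Lemma Ce_pow x n : (Ce x ^ n)%C = Ce (INR n * x).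
Proof. unfold Ce. rewrite Cexp_pow. f_equal. rewrite RtoC_mult. ring. Qed.

Lemma Ce_period x (n : Z) : Ce (x + 2 * PI * IZR n) = Ce x.
Proof.
  rewrite !Ce_val. destruct (Z_le_gt_dec 0 n) as [H|H].
  - rewrite <- (Z2Nat.id n) by lia. rewrite <- INR_IZR_INZ.
    replace (x + 2 * PI * INR (Z.to_nat n)) with (x + 2 * INR (Z.to_nat n) * PI) by ring.
    rewrite cos_period, sin_period. reflexivity.
  - rewrite <- (cos_period (x + 2 * PI * IZR n) (Z.to_nat (- n))), <- (sin_period (x + 2 * PI * IZR n) (Z.to_nat (- n))).
    rewrite INR_IZR_INZ, Z2Nat.id by lia. rewrite opp_IZR.
    replace (x + 2 * PI * IZR n + 2 * - IZR n * PI) with x by ring. reflexivity.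
Qed.

Lemma Ce_2PI (n : Z) : Ce (2 * PI * IZR n) = 1%C.
Proof.
  rewrite <- (Rplus_0_l (2 * PI * IZR n)), Ce_period, Ce_val, cos_0, sin_0. reflexivity.
Qed.

Lemma Cmod_Ce x : Cmod (Ce x) = 1.
Proof. unfold Ce. rewrite Cmod_Cexp. simpl. rewrite <- exp_0. f_equal. ring. Qed.

Lemma Ce_neq_1 x : 0 < x < 2 * PI -> Ce x <> 1%C.
Proof.
  intros H E. rewrite Ce_val in E. injection E as E _.
  assert (S0 : 0 < sin (x / 2)) by (apply sin_gt_0; lra).
  replace x with (2 * (x / 2)) in E by field. rewrite cos_2a_sin in E. nra.
Qed.

(** Equivalent to [ln (v / p) <= v / p] after multiplication by [p]. The bound is [p^p], without the
    factor [exp (- p)] of the true maximum at [v = p]. *)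
Lemma Rpower_exp_bound (p v : R) : 0 < p -> 0 < v -> Rpower v p * exp (- v) <= exp (p * ln p).
Proof.
  intros Hp Hv. unfold Rpower. rewrite <- exp_plus.
  assert (H : ln (v / p) <= v / p).
  { left. apply exp_lt_inv. rewrite exp_ln by (apply Rdiv_lt_0_compat; lra).
    assert (0 < v / p) by (apply Rdiv_lt_0_compat; lra).
    generalize (exp_ineq1 (v / p)). lra. }
  unfold Rdiv in H at 1. rewrite ln_mult, ln_Rinv in H by (try apply Rinv_0_lt_compat; lra).
  assert (H2 : p * ln v - p * ln p <= v).
  { replace v with (p * (v / p)) at 2 by (field; lra). rewrite <- Rmult_minus_distr_l.
    apply Rmult_le_compat_l; lra. }
  destruct (Req_dec (p * ln v + - v) (p * ln p)) as [E|E]; [rewrite E; lra|].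
  left. apply exp_increasing. lra.
Qed.

Lemma pow_exp_bound (p : nat) : exists K, 0 < K /\ forall v, 0 < v -> v ^ p * exp (- v) <= K.
Proof.
  destruct p as [|p].
  - exists 1. split; [lra|]. intros v Hv. simpl. rewrite Rmult_1_l, <- exp_0. left. apply exp_increasing; lra.
  - exists (exp (INR (S p) * ln (INR (S p)))). split; [apply exp_pos|]. intros v Hv.
    rewrite <- Rpower_pow by exact Hv. apply Rpower_exp_bound; [apply lt_0_INR; lia|exact Hv].
Qed.

Lemma INR_S_pos n : 0 < INR (S n).
Proof. apply lt_0_INR; lia. Qed.

Lemma poly_exp_decay (p : nat) (b : R) : 0 < b ->
  exists K, 0 < K /\ forall n, INR (S n) ^ p * exp (- (b * INR n)) <= K * / INR (S n) ^ 2.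
Proof.
  intros Hb. destruct (pow_exp_bound (p + 2)) as [K [HK H]].
  (* Two extra powers of [b * INR (S n)] buy the inverse square; [exp b] pays for the shift from [n]
     to [S n] in the exponential. *)
  exists (K * / b ^ (p + 2) * exp b). split.
  { repeat apply Rmult_lt_0_compat; try assumption; try apply exp_pos. apply Rinv_0_lt_compat, pow_lt, Hb. }
  intros n. assert (Hn := INR_S_pos n).
  specialize (H (b * INR (S n)) ltac:(nra)).
  assert (Hbp : 0 < b ^ (p + 2)) by (apply pow_lt, Hb).
  assert (Hn2 : 0 < INR (S n) ^ 2) by (apply pow_lt, Hn).
  apply (Rmult_le_reg_r (INR (S n) ^ 2 * b ^ (p + 2) * exp (- b))).
  { apply Rmult_lt_0_compat; [apply Rmult_lt_0_compat; assumption|apply exp_pos]. }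
  replace (K * / b ^ (p + 2) * exp b * / INR (S n) ^ 2 * (INR (S n) ^ 2 * b ^ (p + 2) * exp (- b))) with (K * (exp b * exp (- b)))
    by (field; lra).
  rewrite <- exp_plus, Rplus_opp_r, exp_0, Rmult_1_r.
  eapply Rle_trans; [|exact H]. right.
  rewrite Rpow_mult_distr, pow_add.
  replace (- (b * INR (S n))) with (- (b * INR n) + - b) by (rewrite S_INR; ring).
  rewrite exp_plus, pow_add. ring.
Qed.

(** A discrete form of comparing [s x^(-1-s)] with the derivative of [- x^(-s)]: for [b = a + 1],
    [ln (b / a) >= 1 / b] and [exp u >= 1 + u] give [a^(-s) >= b^(-s) (1 + s / b)]. Telescoping then
    sums [n^(-1-s)] for every [s > 0]. *)
Lemma Rpower_telescope (s : R) n : 0 < s ->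
  s * Rpower (INR (S (S n))) (- (1 + s)) <= Rpower (INR (S n)) (- s) - Rpower (INR (S (S n))) (- s).
Proof.
  intros Hs. assert (H1 := INR_S_pos n). assert (H2 := INR_S_pos (S n)).
  set (a := INR (S n)) in *. set (b := INR (S (S n))) in *.
  assert (E : b = a + 1) by (unfold b; rewrite S_INR; reflexivity).
  replace (- (1 + s)) with (- (1) + - s) by ring.
  rewrite Rpower_plus, (Rpower_Ropp b 1), Rpower_1 by exact H2.
  assert (P : 0 < Rpower b (- s)) by apply exp_pos.
  assert (Q : Rpower a (- s) = Rpower b (- s) * exp (s * ln (b / a))).
  { unfold Rpower. rewrite <- exp_plus. f_equal. unfold Rdiv.
    rewrite ln_mult, ln_Rinv by (try apply Rinv_0_lt_compat; lra). ring. }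
  assert (L : / b <= ln (b / a)).
  { replace (b / a) with (/ (a / b)) by (field; lra).
    rewrite ln_Rinv by (apply Rdiv_lt_0_compat; lra).
    assert (ln (a / b) <= a / b - 1).
    { rewrite <- (ln_exp (a / b - 1)). apply ln_le; [apply Rdiv_lt_0_compat; lra|].
      replace (a / b) with (1 + (a / b - 1)) at 1 by ring. apply exp_ineq1_le. }
    replace (/ b) with (1 - a / b) by (rewrite E; field; lra). lra. }
  rewrite Q.
  assert (X : 1 + s * / b <= exp (s * ln (b / a))).
  { eapply Rle_trans; [|apply exp_ineq1_le]. apply Rplus_le_compat_l, Rmult_le_compat_l; lra. }
  nra.
Qed.

Lemma ex_series_Rpower (s : R) : 0 < s -> ex_series (fun n => Rpower (INR (S n)) (- (1 + s))).
Proof.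
  intros Hs. apply ex_series_incr_1.
  assert (T : ex_series (fun n => Rpower (INR (S n)) (- s) - Rpower (INR (S (S n))) (- s))).
  { destruct (ex_finite_lim_seq_decr (fun n => Rpower (INR (S n)) (- s)) 0) as [l Hl].
    - intros n. assert (T := Rpower_telescope s n Hs).
      assert (0 < Rpower (INR (S (S n))) (- (1 + s))) by apply exp_pos. nra.
    - intros n. left. apply exp_pos.
    - exists (1 - l). apply is_lim_seq_incr_1 in Hl.
      eapply filterlim_ext; [|exact (is_lim_seq_minus' (fun _ => 1) _ 1 l (is_lim_seq_const 1) Hl)].
      intros n. cbv beta. symmetry. induction n as [|n IH].
      + rewrite sum_O. simpl INR at 1. unfold Rpower at 1. rewrite ln_1, Rmult_0_r, exp_0. reflexivity.
      + rewrite sum_Sn, IH. unfold plus; simpl. ring. }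
  apply (@ex_series_le R_AbsRing R_CompleteNormedModule _
    (fun n => / s * (Rpower (INR (S n)) (- s) - Rpower (INR (S (S n))) (- s)))).
  - intros n. change (norm ?z) with (Rabs z). rewrite Rabs_pos_eq by (left; apply exp_pos).
    assert (T' := Rpower_telescope s n Hs).
    apply (Rmult_le_reg_l s); [exact Hs|]. rewrite <- Rmult_assoc, Rinv_r, Rmult_1_l by lra. exact T'.
  - apply (ex_series_scal (/ s) _ T).
Qed.

Lemma ex_series_inv_sq : ex_series (fun n => / INR (S n) ^ 2).
Proof.
  eapply ex_series_ext; [|apply (ex_series_Rpower 1); lra].
  intros n. assert (H := INR_S_pos n). simpl.
  replace (- (1 + 1)) with (- INR 2) by (simpl; ring). rewrite Rpower_Ropp, Rpower_pow by exact H. reflexivity.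
Qed.

(** The product [(x + 1) ... (x + k)]. It stands in for [x^k], to which it is asymptotic, because
    its generating function is exactly [k! / (1 - z)^(k+1)], whereas that of [n^k] has an Eulerian
    numerator. *)
Fixpoint rise (k : nat) (x : R) : R :=
  match k with O => 1 | S j => rise j x * (x + INR (S j)) end.

Lemma rise_shift k x : (x + 1) * rise k (x + 1) = rise (S k) x.
Proof.
  induction k as [|k IH]; [simpl; ring|].
  change (rise (S (S k)) x) with (rise (S k) x * (x + INR (S (S k)))).
  rewrite <- IH. change (rise (S k) (x + 1)) with (rise k (x + 1) * (x + 1 + INR (S k))).
  rewrite !S_INR. ring.
Qed.

Lemma rise_bound k x y : 0 <= x -> x <= y -> 0 <= rise k x <= (y + INR k) ^ k.
Proof.
  intros Hx Hy. induction k as [|k IH]; [simpl; lra|].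
  change (rise (S k) x) with (rise k x * (x + INR (S k))).
  assert (H1 := INR_S_pos k). assert (H2 := pos_INR k). split.
  - apply Rmult_le_pos; [apply IH|lra].
  - replace ((y + INR (S k)) ^ S k) with ((y + INR (S k)) ^ k * (y + INR (S k))) by (simpl; ring).
    apply Rmult_le_compat; try lra.
    eapply Rle_trans; [apply IH|]. apply pow_incr. rewrite S_INR. lra.
Qed.

(** Summation by parts: by [rise_shift] the difference of [rise (S k)] at [n] and [n - 1] is
    [(k + 1) * rise k n], and the last term is the boundary contribution. *)
Lemma rise_Csum k (z : C) n :
  ((1 - z) * Csum (fun i => RtoC (rise (S k) (INR i)) * z ^ i) n =
   RtoC (INR (S k)) * Csum (fun i => RtoC (rise k (INR i)) * z ^ i) n
   - RtoC (INR n * rise k (INR n)) * z ^ n)%C.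
Proof.
  induction n as [|n IH]; [simpl; rewrite Rmult_0_l; ring|].
  change (Csum ?f (S n)) with (Csum f n + f n)%C.
  rewrite Cmult_plus_distr_l, IH. rewrite (S_INR n), rise_shift.
  change (rise (S k) (INR n)) with (rise k (INR n) * (INR n + INR (S k))).
  rewrite Cpow_S, !RtoC_mult, RtoC_plus. ring.
Qed.

Lemma rise_le_pow k n : 0 <= rise k (INR n) <= INR (S k) ^ k * INR (S n) ^ k.
Proof.
  destruct (rise_bound k (INR n) (INR n) (pos_INR n) (Rle_refl _)) as [H1 H2]. split; [exact H1|].
  eapply Rle_trans; [exact H2|]. rewrite <- Rpow_mult_distr. apply pow_incr.
  assert (A := pos_INR n). assert (B := pos_INR k). rewrite !S_INR. split; [lra|nra].
Qed.

Lemma clim_0_dom (u : nat -> C) (M : nat -> R) :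
  (forall n, Cmod (u n) <= M n) -> is_lim_seq M 0 -> clim u 0.
Proof.
  intros H HM. split; simpl; apply is_lim_seq_abs_0;
  (eapply (is_lim_seq_le_le (fun _ => 0)); [|apply is_lim_seq_const|exact HM]);
  intros n; split; try apply Rabs_pos; (eapply Rle_trans; [|apply H]); [apply re_le_Cmod|apply im_le_Cmod].
Qed.

(** Induction on [k], letting [n] tend to infinity in [rise_Csum]. Writing [|z|] as [exp (- b)] lets
    [poly_exp_decay] remove the boundary term. *)
Lemma is_series_rise k (z : C) (b : R) : 0 < b -> Cmod z = exp (- b) ->
  Cis_series (fun i => RtoC (rise k (INR i)) * z ^ i)%C (RtoC (INR (fact k)) / (1 - z) ^ S k)%C.
Proof.
  intros Hb Hz.
  assert (Hz1 : (1 - z)%C <> 0%C).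
  { intros E. assert (E' : z = 1%C) by (rewrite <- (Cplus_0_l z), <- E; ring).
    rewrite E', Cmod_1 in Hz. rewrite <- exp_0 in Hz. apply exp_inv in Hz. lra. }
  assert (Hpow : forall n, Cmod (z ^ n) = exp (- (b * INR n))).
  { intros n. rewrite Cmod_pow, Hz, <- Rpower_pow by apply exp_pos. unfold Rpower. rewrite ln_exp. f_equal; ring. }
  assert (Z0 : forall k, clim (fun n => RtoC (INR n * rise k (INR n)) * z ^ n)%C 0).
  { intros j. destruct (poly_exp_decay (S j) b Hb) as [K [HK HD]].
    apply (clim_0_dom _ (fun n => INR (S j) ^ j * K * / INR (S n) ^ 2)).
    - intros n. rewrite Cmod_mult, Hpow, Cmod_R.
      destruct (rise_le_pow j n) as [R1 R2]. assert (A := pos_INR n).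
      rewrite Rabs_pos_eq by (apply Rmult_le_pos; assumption).
      apply Rle_trans with (INR (S j) ^ j * (INR (S n) ^ S j * exp (- (b * INR n)))).
      + rewrite <- Rmult_assoc. apply Rmult_le_compat_r; [left; apply exp_pos|].
        replace (INR (S j) ^ j * INR (S n) ^ S j) with (INR (S n) * (INR (S j) ^ j * INR (S n) ^ j)) by (simpl; ring).
        apply Rmult_le_compat; try assumption. rewrite S_INR; lra.
      + rewrite Rmult_assoc. apply Rmult_le_compat_l; [apply pow_le, pos_INR|apply HD].
    - assert (E := ex_series_lim_0 _ ex_series_inv_sq).
      apply (is_lim_seq_scal_l _ (INR (S j) ^ j * K)) in E. simpl in E. rewrite Rmult_0_r in E. exact E. }
  induction k as [|k IH].
  - apply Cis_series_clim.
    apply clim_ext with (fun n => (1 - z ^ n) * / (1 - z))%C.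
    + intros n. induction n as [|n IH']; [simpl; ring|].
      change (Csum ?f (S n)) with (Csum f n + f n)%C. rewrite <- IH'. rewrite Cpow_S. simpl rise. field. exact Hz1.
    + replace (RtoC (INR (fact 0)) / (1 - z) ^ 1)%C with ((1 + - (1) * 0) * / (1 - z))%C by (simpl; field; exact Hz1).
      apply clim_mult; [|apply clim_const].
      apply clim_ext with (fun n => 1 + - (1) * z ^ n)%C; [intros; ring|].
      apply clim_plus; [apply clim_const|]. apply clim_mult; [apply clim_const|].
      apply (clim_0_dom _ (fun n => exp (- b) ^ n)).
      * intros n. rewrite Cmod_pow, Hz. lra.
      * apply is_lim_seq_geom. rewrite Rabs_pos_eq by (left; apply exp_pos). rewrite <- exp_0. apply exp_increasing; lra.
  - apply Cis_series_clim. apply Cis_series_clim in IH.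
    apply clim_ext with (fun n => / (1 - z) * (RtoC (INR (S k)) * Csum (fun i => RtoC (rise k (INR i)) * z ^ i) n
      + - (1) * (RtoC (INR n * rise k (INR n)) * z ^ n)))%C.
    + intros n. replace (RtoC (INR (S k)) * Csum (fun i => RtoC (rise k (INR i)) * z ^ i) n
      + - (1) * (RtoC (INR n * rise k (INR n)) * z ^ n))%C with (RtoC (INR (S k)) * Csum (fun i => RtoC (rise k (INR i)) * z ^ i) n
      - RtoC (INR n * rise k (INR n)) * z ^ n)%C by ring.
      rewrite <- rise_Csum. field. exact Hz1.
    + replace (RtoC (INR (fact (S k))) / (1 - z) ^ S (S k))%C
        with (/ (1 - z) * (RtoC (INR (S k)) * (RtoC (INR (fact k)) / (1 - z) ^ S k) + - (1) * 0))%C.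
      2:{ rewrite (fact_simpl k), mult_INR, RtoC_mult, (Cpow_S (1 - z) (S k)). field.
          split; [apply Cpow_nz, Hz1|exact Hz1]. }
      apply clim_mult; [apply clim_const|]. apply clim_plus; (apply clim_mult; [apply clim_const|]); [exact IH|apply Z0].
Qed.

(** * Lipschitz summation twisted by a periodic function *)

Lemma one_minus_cos_ge x : Rabs x <= PI -> x ^ 2 / 32 <= 1 - cos x.
Proof.
  intros H. rewrite <- (pow2_abs x).
  replace (cos x) with (cos (Rabs x)) by (unfold Rabs; destruct (Rcase_abs x); [apply cos_neg|reflexivity]).
  assert (P := Rabs_pos x). revert H P. generalize (Rabs x). clear x. intros x H P.
  replace x with (2 * (x / 2)) at 2 by field. rewrite cos_2a_sin.
  set (y := x / 2). assert (Hy : 0 <= y <= 2) by (generalize PI_4; unfold y; lra).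
  (* As [1 - cos x = 2 sin^2 (x / 2)], it suffices that [sin y >= y / 4] on [[0, 2]], which is read
     off the Taylor polynomial of degree 7. The constant is far from sharp. *)
  assert (S1 : y / 4 <= sin y).
  { destruct (SIN y) as [S _]; [lra|generalize PI_4; unfold y in *; lra|].
    eapply Rle_trans; [|exact S]. unfold sin_lb, sin_approx, sin_term; simpl.
    assert (U : 0 <= y * y <= 4) by nra.
    field_simplify.
    apply Rle_trans with (y * (1 - (y*y) / 6 + (y*y)*(y*y) / 120 - (y*y)*(y*y)*(y*y) / 5040)).
    - replace (y / 4) with (y * (1/4)) by field. apply Rmult_le_compat_l; [lra|].
      set (u := y * y) in *. nra.
    - right. field. }
  replace (x ^ 2 / 32) with (2 * (y / 4) * (y / 4)) by (unfold y; field). nra.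
Qed.

(** With [r = exp (- Re w / M)] and [th = Im w / M], the square of [|1 - r exp (- i th)|] is
    [(1 - r)^2 + 2 r (1 - cos th)]. The restriction on [Im w] keeps [|th| <= pi], where [1 - cos th]
    is comparable with [th^2]. The lower bound does not depend on [M], so it yields a majorant for
    the limit [M -> oo]. *)
Lemma Cmod_one_minus_Cexp_ge (w : C) (M : R) : 0 < Re w -> 1 <= M -> Rabs (Im w) <= PI * M ->
  exp (- Re w) / 4 * Cmod w <= Cmod (RtoC M * (1 - Cexp (- (w / RtoC M)))).
Proof.
  intros Hb HM Hv. set (b := Re w) in *. set (v := Im w) in *.
  set (r := exp (- (b / M))). set (th := v / M).
  assert (HM0 : M <> 0) by lra.
  assert (E : Cexp (- (w / RtoC M)) = (r * cos th, - (r * sin th))).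
  { unfold Cexp. replace (Re (- (w / RtoC M))) with (- (b / M)).
    2:{ unfold b; destruct w as [w1 w2]; simpl. field. exact HM0. }
    replace (Im (- (w / RtoC M))) with (- th).
    2:{ unfold th, v; destruct w as [w1 w2]; simpl. field. exact HM0. }
    rewrite cos_neg, sin_neg. unfold r. f_equal; ring. }
  assert (Hbm : 0 < b / M) by (apply Rdiv_lt_0_compat; lra).
  assert (Hr1 : r <= 1) by (unfold r; rewrite <- exp_0; left; apply exp_increasing; lra).
  assert (Hr0 : 0 < r) by apply exp_pos.
  assert (Hrb : exp (- b) <= r).
  { unfold r. assert (- b <= - (b / M)).
    { apply Ropp_le_contravar. apply (Rmult_le_reg_r M); [lra|]. replace (b / M * M) with b by (field; lra). nra. }
    destruct H as [H|H]; [left; apply exp_increasing, H|rewrite H; lra]. }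
  assert (H1r : r * (b / M) <= 1 - r).
  { assert (X := exp_ineq1_le (b / M)). assert (Y : r * exp (b / M) = 1).
    { unfold r. rewrite <- exp_plus, Rplus_opp_l, exp_0. reflexivity. }
    nra. }
  assert (Hth : Rabs th <= PI).
  { unfold th. unfold Rdiv. rewrite Rabs_mult, (Rabs_pos_eq (/ M)) by (left; apply Rinv_0_lt_compat; lra).
    apply (Rmult_le_reg_r M); [lra|]. rewrite Rmult_assoc, Rinv_l by lra. lra. }
  assert (HC := one_minus_cos_ge th Hth).
  assert (Hexp0 := exp_pos (- b)).
  apply Rsqr_incr_0; [|apply Rmult_le_pos; [lra|apply Cmod_ge_0]|apply Cmod_ge_0].
  rewrite !Rsqr_pow2, Cmod_mult, !Rpow_mult_distr, Cmod_R, pow2_abs, !Cmod2_alt, E.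
  fold b v. simpl Re; simpl Im.
  replace (M ^ 2 * ((1 + - (r * cos th)) ^ 2 + (0 + - - (r * sin th)) ^ 2))
    with (M ^ 2 * ((1 - r) ^ 2 + 2 * r * (1 - cos th) + r ^ 2 * (Rsqr (sin th) + Rsqr (cos th) - 1)))
    by (unfold Rsqr; ring).
  rewrite sin2_cos2. replace (r ^ 2 * (1 - 1)) with 0 by ring. rewrite Rplus_0_r.
  apply Rle_trans with (r ^ 2 * (b ^ 2 + v ^ 2 / 16)).
  - replace ((exp (- b) / 4) ^ 2 * (b ^ 2 + v ^ 2)) with (exp (- b) ^ 2 * (b ^ 2 / 16 + v ^ 2 / 16)) by field.
    apply Rmult_le_compat; [apply pow2_ge_0| |apply pow_incr; lra|];
      generalize (pow2_ge_0 b) (pow2_ge_0 v); lra.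
  - assert (Bm : b = M * (b / M)) by (field; lra). assert (Vm : v = M * th) by (unfold th; field; lra).
    rewrite Bm at 1. rewrite Vm.
    replace (r ^ 2 * ((M * (b / M)) ^ 2 + (M * th) ^ 2 / 16)) with (M ^ 2 * ((r * (b / M)) ^ 2 + r ^ 2 * (th ^ 2 / 16))) by (field; lra).
    apply Rmult_le_compat_l; [apply pow2_ge_0|]. apply Rplus_le_compat.
    + apply pow_incr. split; [nra|exact H1r].
    + apply Rle_trans with (r * (th ^ 2 / 16)).
      * apply Rmult_le_compat_r; [generalize (pow2_ge_0 th); lra|nra].
      * rewrite (Rmult_comm 2 r), Rmult_assoc. apply Rmult_le_compat_l; lra.
Qed.

Lemma is_lim_seq_derive (f : R -> R) (l : R) (u : nat -> R) :
  is_derive f 0 l -> f 0 = 0 -> (forall n, 0 < u n) -> is_lim_seq u p_infty ->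
  is_lim_seq (fun n => u n * f (/ u n)) l.
Proof.
  intros Hd H0 Hpos Hu. apply is_derive_Reals in Hd.
  apply is_lim_seq_spec. intros eps. destruct (Hd eps (cond_pos eps)) as [delta H].
  assert (Hi : is_lim_seq (fun n => / u n) 0).
  { apply (is_lim_seq_inv u p_infty); [exact Hu|discriminate]. }
  apply is_lim_seq_spec in Hi. destruct (Hi delta) as [N HN]. exists N. intros n Hn.
  specialize (HN n Hn). rewrite Rminus_0_r in HN. specialize (Hpos n).
  specialize (H (/ u n) (Rinv_neq_0_compat _ (Rgt_not_eq _ _ Hpos)) HN).
  rewrite Rplus_0_l, H0, Rminus_0_r in H. unfold Rdiv in H. rewrite Rinv_inv in H.
  rewrite Rmult_comm. exact H.
Qed.

(** The derivative at 0 of [1 - exp (- t w)] in [t] is [w]; it is taken along [t = 1 / u n], in real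
    and imaginary parts. *)
Lemma clim_one_minus_Cexp (w : C) (u : nat -> R) :
  (forall n, 0 < u n) -> is_lim_seq u p_infty ->
  clim (fun n => RtoC (u n) * (1 - Cexp (- (w / RtoC (u n)))))%C w.
Proof.
  intros Hpos Hu. destruct w as [b v]. split; simpl.
  - eapply is_lim_seq_ext; [|apply (is_lim_seq_derive (fun t => 1 - exp (- (b * t)) * cos (v * t)) b u)]; auto.
    + intros n. cbv beta. assert (N : u n <> 0) by (specialize (Hpos n); lra).
      replace (b * (u n / (u n * (u n * 1) + 0 * (0 * 1))) - v * (- 0 / (u n * (u n * 1) + 0 * (0 * 1)))) with (b * / u n) by (field; lra).
      replace (b * (- 0 / (u n * (u n * 1) + 0 * (0 * 1))) + v * (u n / (u n * (u n * 1) + 0 * (0 * 1)))) with (v * / u n) by (field; lra).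
      rewrite cos_neg. ring.
    + auto_derive; [exact I|]. rewrite !Rmult_0_r, Ropp_0, exp_0, cos_0, sin_0. ring.
    + rewrite !Rmult_0_r, Ropp_0, exp_0, cos_0. ring.
  - eapply is_lim_seq_ext; [|apply (is_lim_seq_derive (fun t => exp (- (b * t)) * sin (v * t)) v u)]; auto.
    + intros n. cbv beta. assert (N : u n <> 0) by (specialize (Hpos n); lra).
      replace (b * (u n / (u n * (u n * 1) + 0 * (0 * 1))) - v * (- 0 / (u n * (u n * 1) + 0 * (0 * 1)))) with (b * / u n) by (field; lra).
      replace (b * (- 0 / (u n * (u n * 1) + 0 * (0 * 1))) + v * (u n / (u n * (u n * 1) + 0 * (0 * 1)))) with (v * / u n) by (field; lra).
      rewrite sin_neg. ring.
    + auto_derive; [exact I|]. rewrite !Rmult_0_r, Ropp_0, exp_0, cos_0, sin_0. ring.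
    + rewrite !Rmult_0_r, sin_0. ring.
Qed.

Lemma Csum_Ce_roots (M N : nat) : (0 < M)%nat ->
  Csum (fun l => Ce (2 * PI * INR N / INR M) ^ l)%C M =
  if Nat.eqb (N mod M) 0 then RtoC (INR M) else 0%C.
Proof.
  intros HM. assert (HMR : 0 < INR M) by (apply lt_0_INR, HM).
  assert (E : Ce (2 * PI * INR N / INR M) = Ce (2 * PI * INR (N mod M) / INR M)).
  { rewrite (Nat.div_mod_eq N M) at 1. rewrite plus_INR, mult_INR.
    replace (2 * PI * (INR M * INR (N / M) + INR (N mod M)) / INR M)
      with (2 * PI * INR (N mod M) / INR M + 2 * PI * IZR (Z.of_nat (N / M))).
    - apply Ce_period.
    - rewrite <- INR_IZR_INZ. field. lra. }
  rewrite E. clear E. assert (Hlt := Nat.mod_upper_bound N M ltac:(lia)).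
  destruct (Nat.eqb_spec (N mod M) 0) as [H|H].
  - rewrite H. replace (2 * PI * INR 0 / INR M) with (2 * PI * IZR 0) by (simpl; field; lra).
    rewrite Ce_2PI. clear. induction M as [|M IH]; [reflexivity|].
    change (Csum ?f (S M)) with (Csum f M + f M)%C. rewrite IH, S_INR, RtoC_plus, Cpow_1_l. reflexivity.
  - set (w := Ce (2 * PI * INR (N mod M) / INR M)).
    assert (Hw : w <> 1%C).
    { apply Ce_neq_1. assert (0 < INR (N mod M)) by (apply lt_0_INR; lia).
      assert (INR (N mod M) < INR M) by (apply lt_INR; lia). assert (P := PI_RGT_0). split.
      - apply Rdiv_lt_0_compat; nra.
      - apply (Rmult_lt_reg_r (INR M)); [lra|]. unfold Rdiv. rewrite Rmult_assoc, Rinv_l by lra. nra. }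
    assert (G : forall n, ((w - 1) * Csum (fun l => w ^ l) n = w ^ n - 1)%C).
    { intros n. induction n as [|n IH]; [simpl; ring|].
      change (Csum ?f (S n)) with (Csum f n + f n)%C. rewrite Cmult_plus_distr_l, IH, Cpow_S. ring. }
    assert (W : (w ^ M = 1)%C).
    { unfold w. rewrite Ce_pow. replace (INR M * (2 * PI * INR (N mod M) / INR M)) with (2 * PI * IZR (Z.of_nat (N mod M))).
      - apply Ce_2PI.
      - rewrite <- INR_IZR_INZ. field. lra. }
    specialize (G M). rewrite W in G.
    assert (D : (w - 1)%C <> 0%C).
    { intros D. apply Hw. replace w with ((w - 1) + 1)%C by ring. rewrite D. ring. }
    replace (Csum (fun l => w ^ l)%C M) with (/ (w - 1) * ((w - 1) * Csum (fun l => w ^ l)%C M))%C by (field; exact D).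
    rewrite G. ring.
Qed.

(** The finite Fourier transform of [chi] over one period, unnormalised. For a primitive character
    it reduces to the Gauss sum. *)
Definition dft (q : nat) (chi : Z -> C) (n : nat) : C :=
  Csum (fun h => chi (Z.of_nat h) * Ce (2 * PI * INR h * INR n / INR q))%C q.

Lemma periodic_mul (q : Z) (chi : Z -> C) : (forall n, chi (n + q)%Z = chi n) ->
  forall n (l : nat), chi (n + q * Z.of_nat l)%Z = chi n.
Proof.
  intros H n l. induction l as [|l IH].
  - f_equal; lia.
  - rewrite <- IH, <- (H (n + q * Z.of_nat l)%Z). f_equal. lia.
Qed.

(** Replaces the period [[0, 2T)] by the centred one [[-T, T)], on which the lower bound of
    [Cmod_one_minus_Cexp_ge] is available. Reversal and periodicity carry the upper half of the
    first range to the negative integers. *)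
Lemma Csum_balanced (phi : Z -> C) (T : nat) :
  (forall n, phi (n + 2 * Z.of_nat T)%Z = phi n) ->
  Csum (fun m => phi (Z.of_nat m) + phi (-1 - Z.of_nat m)%Z)%C T =
  Csum (fun m => phi (Z.of_nat m)) (2 * T).
Proof.
  intros H. replace (2 * T)%nat with (T + T)%nat by lia.
  rewrite Csum_add, Csum_plus. f_equal.
  rewrite <- (Csum_rev (fun i => phi (Z.of_nat (T + i)))). apply Csum_ext. intros i Hi.
  rewrite <- H. f_equal. lia.
Qed.

(* Over a full period of length [2 q L], only the [N] divisible by [2 L] survive. *)
Lemma dft_filter (q L N : nat) (chi : Z -> C) : (0 < q)%nat -> (0 < L)%nat ->
  (forall n, chi (n + Z.of_nat q)%Z = chi n) ->
  let phi m := (chi m * Ce (2 * PI * IZR m * INR N / (INR q * INR (2 * L))))%C in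
  Csum (fun m => phi (Z.of_nat m) + phi (-1 - Z.of_nat m)%Z)%C (q * L) =
  if Nat.eqb (N mod (2 * L)) 0 then (RtoC (INR (2 * L)) * dft q chi (N / (2 * L)))%C else 0%C.
Proof.
  intros Hq HL Hper phi.
  assert (Hq' : 0 < INR q) by (apply lt_0_INR, Hq).
  assert (HM' : 0 < INR (2 * L)) by (apply lt_0_INR; lia).
  rewrite Csum_balanced.
  2:{ intros n. unfold phi. f_equal.
      - rewrite <- (periodic_mul _ _ Hper n (2 * L)). f_equal. lia.
      - rewrite <- (Ce_period (2 * PI * IZR n * INR N / (INR q * INR (2 * L))) (Z.of_nat N)). f_equal.
        rewrite plus_IZR, mult_IZR, <- !INR_IZR_INZ, !mult_INR.
        rewrite mult_INR in HM'. change (INR 2) with 2 in *. field. split; nra. }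
  replace (2 * (q * L))%nat with (q * (2 * L))%nat by lia.
  rewrite Csum_mul.
  (* With [m = q l + h] the function [chi] sees only [h], and the sum over [l] is a complete sum
     over [2 L]-th roots of unity. *)
  rewrite (Csum_ext _ (fun l => Csum (fun h => chi (Z.of_nat h) * Ce (2 * PI * INR h * INR N / (INR q * INR (2 * L)))) q
     * Ce (2 * PI * INR N / INR (2 * L)) ^ l)%C).
  2:{ intros l _. rewrite (Cmult_comm (Csum _ _)), <- Csum_scal. apply Csum_ext. intros h _. unfold phi.
      rewrite Nat2Z.inj_add, Nat2Z.inj_mul, Z.add_comm, (periodic_mul _ _ Hper).
      rewrite Ce_pow, (Cmult_comm (Ce _)), <- Cmult_assoc, <- Ce_add. do 2 f_equal.
      rewrite plus_IZR, mult_IZR, <- !INR_IZR_INZ. field. split; lra. }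
  rewrite Csum_scal, Csum_Ce_roots by lia.
  destruct (Nat.eqb_spec (N mod (2 * L)) 0) as [H|H]; [|ring].
  rewrite Cmult_comm. f_equal. unfold dft. apply Csum_ext. intros h _. do 2 f_equal.
  rewrite (Nat.div_mod_eq N (2 * L)) at 1. rewrite H, Nat.add_0_r, (mult_INR (2 * L)).
  field. split; lra.
Qed.

(** The number [beta - 2 i pi m / q], whose inverse powers are the terms of Lipschitz's formula. The
    [N]-th power of [exp (- freq / M)] has modulus [exp (- beta N / M)] and phase
    [2 pi m N / (q M)]. *)
Definition freq (q : nat) (beta : R) (m : Z) : C := (beta, - (2 * PI * IZR m / INR q)).

Lemma freq_lower_bound q beta : (0 < q)%nat -> 0 < beta ->
  exists c, 0 < c /\ forall m, c * (Rabs (IZR m) + 1) <= Cmod (freq q beta m).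
Proof.
  intros Hq Hb. assert (Hq' : 0 < INR q) by (apply lt_0_INR, Hq). assert (HP := PI_RGT_0).
  set (d := 2 * PI / INR q). assert (Hd : 0 < d) by (apply Rdiv_lt_0_compat; lra).
  exists (Rmin beta d / 2). assert (Hm := Rmin_glb_lt _ _ _ Hb Hd). split; [lra|].
  intros m. assert (H1 := re_le_Cmod (freq q beta m)). assert (H2 := im_le_Cmod (freq q beta m)).
  simpl in H1, H2. rewrite Rabs_pos_eq in H1 by lra. rewrite Rabs_Ropp in H2.
  replace (2 * PI * IZR m / INR q) with (d * IZR m) in H2 by (unfold d; field; lra).
  rewrite Rabs_mult, (Rabs_pos_eq d) in H2 by lra.
  assert (A := Rmin_l beta d). assert (B := Rmin_r beta d). assert (P := Rabs_pos (IZR m)). nra.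
Qed.

Lemma Cexp_freq_pow q beta m M N : (0 < q)%nat -> 0 < M ->
  (Cexp (- (freq q beta m / RtoC M)) ^ N)%C =
  (RtoC (exp (- (beta / M * INR N))) * Ce (2 * PI * IZR m * INR N / (INR q * M)))%C.
Proof.
  intros Hq HM. assert (Hq' : 0 < INR q) by (apply lt_0_INR, Hq).
  rewrite Cexp_pow, <- Cexp_RtoC. unfold Ce. rewrite <- Cexp_add. f_equal.
  unfold freq, Cdiv, Cmult, Cinv, Cplus, Copp, RtoC; simpl. f_equal; field; lra.
Qed.

Lemma dft_bound q chi K n : (forall m, Cmod (chi m) <= K) -> Cmod (dft q chi n) <= INR q * K.
Proof.
  intros HK. unfold dft. generalize q at 2 3. intros j. induction j as [|j IH].
  - simpl. rewrite Cmod_0. lra.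
  - change (Csum ?f (S j)) with (Csum f j + f j)%C. eapply Rle_trans; [apply Cmod_triangle|].
    rewrite Cmod_mult, Cmod_Ce, Rmult_1_r, S_INR. specialize (HK (Z.of_nat j)). lra.
Qed.

Lemma rise_scaled_lim k x (u : nat -> R) : (forall n, 0 < u n) -> is_lim_seq u p_infty ->
  is_lim_seq (fun L => rise k (u L * x) / u L ^ k) (x ^ k).
Proof.
  intros Hpos Hu. induction k as [|k IH].
  - apply is_lim_seq_ext with (fun _ => 1); [intros; simpl; field|apply is_lim_seq_const].
  - apply is_lim_seq_ext with (fun L => (x + INR (S k) * / u L) * (rise k (u L * x) / u L ^ k)).
    + intros n. change (rise (S k) (u n * x)) with (rise k (u n * x) * (u n * x + INR (S k))).
      change (u n ^ S k) with (u n * u n ^ k). specialize (Hpos n). field. split; [apply pow_nonzero|]; lra.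
    + change (x ^ S k) with (x * x ^ k). apply is_lim_seq_mult'; [|exact IH].
      replace (Finite x) with (Finite (x + INR (S k) * 0)) by (f_equal; ring).
      apply is_lim_seq_plus'; [apply is_lim_seq_const|]. apply is_lim_seq_mult'; [apply is_lim_seq_const|].
      apply (is_lim_seq_inv u p_infty); [exact Hu|discriminate].
Qed.

Section TwistedLipschitz.
Variables (q : nat) (chi : Z -> C) (K beta : R) (k : nat).
Hypotheses (Hq : (0 < q)%nat) (Hper : forall n, chi (n + Z.of_nat q)%Z = chi n)
  (HK : forall n, Cmod (chi n) <= K) (Hb : 0 < beta) (Hk : (1 <= k)%nat).

(** The sampling modulus is even, so that the full period [q * step L] splits into two halves of
    length [q * S L] around 0. As it grows, [discrete_freq] tends to [freq]. *)
Let step (L : nat) : R := INR (2 * S L).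
Let discrete_freq (L : nat) (m : Z) : C := (RtoC (step L) * (1 - Cexp (- (freq q beta m / RtoC (step L)))))%C.
Let discrete_term (L m : nat) : C :=
  (chi (Z.of_nat m) / discrete_freq L (Z.of_nat m) ^ S k + chi (-1 - Z.of_nat m)%Z / discrete_freq L (-1 - Z.of_nat m)%Z ^ S k)%C.

Lemma step_pos L : 1 <= step L.
Proof. unfold step. change 1 with (INR 1). apply le_INR. lia. Qed.

Lemma step_lim : is_lim_seq step p_infty.
Proof.
  unfold step. apply is_lim_seq_le_p_loc with INR; [|apply is_lim_seq_INR].
  exists 0%nat. intros n _. apply le_INR. lia.
Qed.

Lemma one_minus_Cexp_freq_neq_0 L m : (1 - Cexp (- (freq q beta m / RtoC (step L))))%C <> 0%C.
Proof.
  assert (HM := step_pos L). intros E.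
  assert (E' : Cmod (Cexp (- (freq q beta m / RtoC (step L))) ^ 1) = 1).
  { rewrite Cpow_1_r. replace (Cexp _) with (1 - (1 - Cexp (- (freq q beta m / RtoC (step L)))))%C by ring.
    rewrite E. replace (1 - 0)%C with (RtoC 1) by ring. apply Cmod_1. }
  rewrite (Cexp_freq_pow q beta m (step L) 1 Hq), Cmod_mult, Cmod_Ce, Cmod_R, Rabs_pos_eq in E'
    by (try (left; apply exp_pos); lra).
  rewrite Rmult_1_r, <- exp_0 in E'. apply exp_inv in E'. change (INR 1) with 1 in E'.
  assert (0 < beta / step L) by (apply Rdiv_lt_0_compat; lra). lra.
Qed.

(* Evaluates the generating function [k! / (1 - z)^(k+1)] of [rise k] at the points
   [exp (- freq m / (2 (L+1)))] and lets [dft_filter] extract the multiples of [2 (L+1)];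
   Lipschitz's formula is the limit [L -> oo]. *)
Lemma discrete_lipschitz L :
  Cis_series (fun n => RtoC (rise k (step L * INR n) / step L ^ k) * dft q chi n * RtoC (exp (- (beta * INR n))))%C
    (RtoC (INR (fact k)) * Csum (discrete_term L) (q * S L))%C.
Proof.
  assert (HM := step_pos L). set (M := step L) in *.
  set (z := fun m : Z => Cexp (- (freq q beta m / RtoC M))).
  assert (Hz : forall m, Cis_series (fun i => chi m * (RtoC (rise k (INR i)) * z m ^ i))%C
             (chi m * (RtoC (INR (fact k)) / (1 - z m) ^ S k))%C).
  { intros m. apply Cis_series_scal. apply (is_series_rise k (z m) (beta / M)).
    - apply Rdiv_lt_0_compat; lra.
    - rewrite <- (Cpow_1_r (z m)). unfold z. rewrite Cexp_freq_pow by (assumption || lra).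
      rewrite Cmod_mult, Cmod_Ce, Cmod_R, Rabs_pos_eq by (left; apply exp_pos).
      change (INR 1) with 1. rewrite !Rmult_1_r. reflexivity. }
  assert (H1 := Cis_series_Csum
    (fun i m => chi (Z.of_nat m) * (RtoC (rise k (INR i)) * z (Z.of_nat m) ^ i)
              + chi (-1 - Z.of_nat m)%Z * (RtoC (rise k (INR i)) * z (-1 - Z.of_nat m)%Z ^ i))%C
    (fun m => chi (Z.of_nat m) * (RtoC (INR (fact k)) / (1 - z (Z.of_nat m)) ^ S k)
            + chi (-1 - Z.of_nat m)%Z * (RtoC (INR (fact k)) / (1 - z (-1 - Z.of_nat m)%Z) ^ S k))%C
    (q * S L) (fun m _ => Cis_series_plus _ _ _ _ (Hz _) (Hz _))).
  apply (Cis_series_ext _ (sparse (2 * S L) (fun n => RtoC (rise k (M * INR n)) * RtoC (exp (- (beta * INR n))) * (RtoC M * dft q chi n))%C)) in H1.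
  2:{ intros i.
      rewrite (Csum_ext _ (fun m => (RtoC (rise k (INR i)) * RtoC (exp (- (beta / M * INR i)))) *
        (chi (Z.of_nat m) * Ce (2 * PI * IZR (Z.of_nat m) * INR i / (INR q * M))
        + chi (-1 - Z.of_nat m)%Z * Ce (2 * PI * IZR (-1 - Z.of_nat m)%Z * INR i / (INR q * M))))%C).
      2:{ intros m _. unfold z. rewrite !Cexp_freq_pow by (assumption || lra). ring. }
      rewrite Csum_scal. unfold M, step.
      rewrite (dft_filter q (S L) i chi Hq (Nat.lt_0_succ L) Hper). unfold sparse.
      fold (step L). fold M.
      destruct (Nat.eqb_spec (i mod (2 * S L)) 0) as [E|E]; [|ring].
      assert (Ei : INR i = M * INR (i / (2 * S L))).
      { rewrite (Nat.div_mod_eq i (2 * S L)) at 1. rewrite E, Nat.add_0_r, mult_INR. reflexivity. }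
      rewrite Ei. replace (beta / M * (M * INR (i / (2 * S L)))) with (beta * INR (i / (2 * S L))) by (field; lra).
      reflexivity. }
  apply Cis_series_sparse in H1; [|lia].
  (* One of the [k + 1] powers of [M] cancels the factor [2 (L + 1)] from [dft_filter]; the other
     [k] scale [rise k] so that it tends to a power. *)
  apply (Cis_series_scal (/ RtoC M ^ S k)) in H1.
  assert (HMC : RtoC M <> 0%C) by (intros E; apply RtoC_inj in E; lra).
  replace (RtoC (INR (fact k)) * Csum (discrete_term L) (q * S L))%C with (/ RtoC M ^ S k *
    Csum (fun m => chi (Z.of_nat m) * (RtoC (INR (fact k)) / (1 - z (Z.of_nat m)) ^ S k)
            + chi (-1 - Z.of_nat m)%Z * (RtoC (INR (fact k)) / (1 - z (-1 - Z.of_nat m)%Z) ^ S k))%C (q * S L))%C.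
  - eapply Cis_series_ext; [|exact H1]. intros n. cbv beta.
    rewrite RtoC_div by (apply pow_nonzero; lra). rewrite RtoC_pow, Cpow_S. field.
    split; [apply Cpow_nz|]; exact HMC.
  - rewrite <- !Csum_scal. apply Csum_ext. intros m _. unfold discrete_term, discrete_freq. fold M.
    rewrite !Cpow_mult_l. fold (z (Z.of_nat m)). fold (z (-1 - Z.of_nat m)%Z). field.
    repeat split; apply Cpow_nz; try exact HMC; apply one_minus_Cexp_freq_neq_0.
Qed.

(** For [m < q (L + 1)] both [m] and [-1 - m] have absolute value at most [q (L + 1)], which amounts
    to [|Im freq| <= pi * step L]. Hence [|discrete_freq|] is at least a constant times [m + 1],
    uniformly in [L], and [k + 1 >= 2] leaves an inverse square. *)
Lemma discrete_term_bound : exists B, forall L m, (m < q * S L)%nat -> Cmod (discrete_term L m) <= B * / INR (S m) ^ 2.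
Proof.
  destruct (freq_lower_bound q beta Hq Hb) as [c [Hc Hlow]].
  set (d := exp (- beta) / 4 * c).
  assert (Hd : 0 < d) by (unfold d; generalize (exp_pos (- beta)); intros; apply Rmult_lt_0_compat; lra).
  assert (HK0 : 0 <= K) by (eapply Rle_trans; [apply Cmod_ge_0|apply (HK 0%Z)]).
  assert (Hone : forall L (m : nat) (j : Z), (m < q * S L)%nat -> (Z.of_nat m <= Z.abs j <= Z.of_nat (q * S L))%Z ->
     Cmod (chi j / discrete_freq L j ^ S k) <= K * / d ^ S k * / INR (S m) ^ 2).
  { intros L m j Hm [Hj1 Hj2].
    assert (Hdm : 0 < d * INR (S m)) by (apply Rmult_lt_0_compat; [exact Hd|apply INR_S_pos]).
    assert (Hz : d * INR (S m) <= Cmod (discrete_freq L j)).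
    { unfold discrete_freq. eapply Rle_trans; [|apply Cmod_one_minus_Cexp_ge].
      - simpl Re. unfold d. rewrite Rmult_assoc. apply Rmult_le_compat_l; [generalize (exp_pos (- beta)); lra|].
        eapply Rle_trans; [|apply Hlow]. apply Rmult_le_compat_l; [lra|].
        rewrite S_INR. apply Rplus_le_compat_r. rewrite INR_IZR_INZ, <- abs_IZR. apply IZR_le, Hj1.
      - exact Hb.
      - apply step_pos.
      - simpl Im. rewrite Rabs_Ropp. apply IZR_le in Hj2. rewrite abs_IZR, <- INR_IZR_INZ, mult_INR in Hj2.
        unfold step. rewrite mult_INR. change (INR 2) with 2.
        assert (Hq' : 0 < INR q) by (apply lt_0_INR, Hq). assert (P := PI_RGT_0).
        unfold Rdiv. rewrite !Rabs_mult, (Rabs_pos_eq (/ INR q)), (Rabs_pos_eq 2), (Rabs_pos_eq PI)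
          by (try (left; apply Rinv_0_lt_compat); lra).
        apply (Rmult_le_reg_r (INR q)); [lra|]. rewrite Rmult_assoc, Rinv_l by lra. nra. }
    assert (Hz0 : discrete_freq L j <> 0%C) by (apply Cmod_gt_0; lra).
    rewrite Cmod_div by (apply Cpow_nz, Hz0). rewrite Cmod_pow. unfold Rdiv. rewrite Rmult_assoc.
    apply Rmult_le_compat; [apply Cmod_ge_0|left; apply Rinv_0_lt_compat, pow_lt, Cmod_gt_0, Hz0|apply HK|].
    rewrite <- Rinv_mult. apply Rinv_le_contravar.
    - apply Rmult_lt_0_compat; apply pow_lt; [exact Hd|apply INR_S_pos].
    - apply Rle_trans with ((d * INR (S m)) ^ S k); [|apply pow_incr; lra].
      rewrite Rpow_mult_distr. apply Rmult_le_compat_l; [apply pow_le; lra|].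
      apply Rle_pow; [|lia]. change 1 with (INR 1). apply le_INR. lia. }
  exists (K * / d ^ S k + K * / d ^ S k). intros L m Hm. unfold discrete_term.
  eapply Rle_trans; [apply Cmod_triangle|]. rewrite Rmult_plus_distr_r.
  apply Rplus_le_compat; apply Hone; lia.
Qed.

Lemma freq_neq_0 m : freq q beta m <> 0%C.
Proof. intros E. injection E as E _. lra. Qed.

Lemma twisted_lipschitz_balanced :
  CSeries (fun n => RtoC (INR n ^ k) * dft q chi n * RtoC (exp (- (beta * INR n))))%C =
  (RtoC (INR (fact k)) *
   CSeries (fun m => chi (Z.of_nat m) / freq q beta (Z.of_nat m) ^ S k
                   + chi (-1 - Z.of_nat m)%Z / freq q beta (-1 - Z.of_nat m)%Z ^ S k))%C.
Proof.
  assert (HK0 : 0 <= K) by (eapply Rle_trans; [apply Cmod_ge_0|apply (HK 0%Z)]).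
  assert (Hst : forall n, 0 < step n) by (intros n; generalize (step_pos n); lra).
  set (lhs := fun L n => (RtoC (rise k (step L * INR n) / step L ^ k) * dft q chi n * RtoC (exp (- (beta * INR n))))%C).
  (* Extension by zero turns finite sums of varying length into series over one index set, as
     [tannery_C] requires. *)
  set (rhs := fun L m => if Nat.ltb m (q * S L) then discrete_term L m else 0%C).
  assert (E : forall L, CSeries (lhs L) = (RtoC (INR (fact k)) * CSeries (rhs L))%C).
  { intros L. unfold lhs. rewrite (Cis_series_unique _ _ (discrete_lipschitz L)). f_equal.
    rewrite (Cis_series_unique (rhs L) (Csum (rhs L) (q * S L))).
    - apply Csum_ext. intros i Hi. unfold rhs. destruct (Nat.ltb_spec i (q * S L)); [reflexivity|lia].
    - apply Cis_series_finite. intros n Hn. unfold rhs. destruct (Nat.ltb_spec n (q * S L)); [lia|reflexivity]. }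
  apply (clim_unique (fun L => CSeries (lhs L))).
  - destruct (poly_exp_decay k beta Hb) as [D [HD HDn]].
    apply (tannery_C lhs _ (fun n => INR (S k) ^ k * (INR q * K) * D * / INR (S n) ^ 2)).
    + intros L n. unfold lhs. rewrite !Cmod_mult, !Cmod_R.
      rewrite (Rabs_pos_eq (exp _)) by (left; apply exp_pos).
      (* Uniform in [L] because [M = step L >= 1] gives [M n + k <= M (k + 1) (n + 1)]. *)
      assert (Hr : 0 <= rise k (step L * INR n) / step L ^ k <= INR (S k) ^ k * INR (S n) ^ k).
      { specialize (Hst L). assert (HM := step_pos L). assert (HSk : 0 < step L ^ k) by (apply pow_lt, Hst).
        assert (A := pos_INR n). assert (A' := pos_INR k).
        destruct (rise_bound k (step L * INR n) (step L * INR n)) as [R1 R2]; [nra|lra|]. split.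
        - apply Rmult_le_pos; [exact R1|left; apply Rinv_0_lt_compat, HSk].
        - apply (Rmult_le_reg_r (step L ^ k)); [exact HSk|]. unfold Rdiv.
          rewrite Rmult_assoc, Rinv_l, Rmult_1_r by lra. eapply Rle_trans; [exact R2|].
          rewrite <- !Rpow_mult_distr. apply pow_incr. split; [nra|]. rewrite !S_INR.
          assert (0 <= INR k * INR n) by nra. nra. }
      rewrite Rabs_pos_eq by apply Hr.
      apply Rle_trans with (INR (S k) ^ k * INR (S n) ^ k * (INR q * K) * exp (- (beta * INR n))).
      * apply Rmult_le_compat_r; [left; apply exp_pos|].
        apply Rmult_le_compat; [apply Hr|apply Cmod_ge_0|apply Hr|apply dft_bound, HK].
      * replace (INR (S k) ^ k * INR (S n) ^ k * (INR q * K) * exp (- (beta * INR n)))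
          with (INR (S k) ^ k * (INR q * K) * (INR (S n) ^ k * exp (- (beta * INR n)))) by ring.
        rewrite (Rmult_assoc _ D). apply Rmult_le_compat_l; [|apply HDn].
        apply Rmult_le_pos; [apply pow_le, pos_INR|apply Rmult_le_pos; [apply pos_INR|exact HK0]].
    + apply (ex_series_scal (INR (S k) ^ k * (INR q * K) * D) _ ex_series_inv_sq).
    + intros n. unfold lhs. apply clim_mult; [|apply clim_const]. apply clim_mult; [|apply clim_const].
      split; simpl; [|apply is_lim_seq_const].
      apply rise_scaled_lim; [exact Hst|exact step_lim].
  - apply clim_ext with (fun L => RtoC (INR (fact k)) * CSeries (rhs L))%C; [intros; symmetry; apply E|].
    apply clim_mult; [apply clim_const|]. destruct discrete_term_bound as [B HB].
    assert (HB0 : 0 <= B).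
    { specialize (HB 0%nat 0%nat ltac:(lia)). simpl in HB.
      assert (T := Rle_trans _ _ _ (Cmod_ge_0 _) HB). rewrite !Rmult_1_l, Rinv_1 in T. lra. }
    apply (tannery_C rhs _ (fun m => B * / INR (S m) ^ 2)).
    + intros L m. unfold rhs. destruct (Nat.ltb_spec m (q * S L)) as [H|H]; [apply HB, H|].
      rewrite Cmod_0. apply Rmult_le_pos; [exact HB0|]. left. apply Rinv_0_lt_compat, pow_lt, INR_S_pos.
    + apply (ex_series_scal B _ ex_series_inv_sq).
    + intros m.
      assert (T : forall j, clim (fun L => chi j / discrete_freq L j ^ S k)%C (chi j / freq q beta j ^ S k)%C).
      { intros j. apply clim_mult; [apply clim_const|]. apply clim_inv; [apply Cpow_nz, freq_neq_0|].
        apply clim_pow. apply clim_one_minus_Cexp; [exact Hst|exact step_lim]. }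
      destruct (clim_plus _ _ _ _ (T (Z.of_nat m)) (T (-1 - Z.of_nat m)%Z)) as [T1 T2].
      split; [refine (is_lim_seq_ext_loc _ _ _ _ T1)|refine (is_lim_seq_ext_loc _ _ _ _ T2)];
      exists m; intros L HL; unfold rhs; (destruct (Nat.ltb_spec m (q * S L)); [reflexivity|nia]).
Qed.
End TwistedLipschitz.

(** * Dirichlet characters and Gauss sums *)

Lemma fold_right_Csum (f : nat -> C) s n :
  fold_right Cplus 0%C (map f (seq s n)) = Csum (fun i => f (s + i)%nat) n.
Proof.
  revert s. induction n as [|n IH]; intros s; [reflexivity|].
  rewrite Csum_S_l. simpl. rewrite IH, Nat.add_0_r. f_equal.
  apply Csum_ext. intros i _. f_equal. lia.
Qed.

Lemma fold_right_Cplus_perm (l l' : list C) :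
  Permutation l l' -> fold_right Cplus 0%C l = fold_right Cplus 0%C l'.
Proof.
  induction 1; simpl; try congruence. ring.
Qed.

Lemma periodic_Z (q : Z) (psi : Z -> C) : (forall n, psi (n + q)%Z = psi n) ->
  forall n j, psi (n + q * j)%Z = psi n.
Proof.
  intros H n j. destruct (Z_le_gt_dec 0 j) as [Hj|Hj].
  - rewrite <- (Z2Nat.id j) by exact Hj. apply periodic_mul, H.
  - rewrite <- (periodic_mul q psi H (n + q * j) (Z.to_nat (- j))). f_equal. rewrite Z2Nat.id by lia. lia.
Qed.

(** Multiplication by a unit permutes the residues: injectivity on [[0, q)] is Gauss's lemma, and an
    injective map of a finite range into itself is a permutation. *)
Lemma Csum_unit_mul (q a : Z) (psi : Z -> C) : (0 < q)%Z -> Z.gcd a q = 1%Z ->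
  (forall n, psi (n + q)%Z = psi n) ->
  Csum (fun h => psi (a * Z.of_nat h)%Z) (Z.to_nat q) = Csum (fun h => psi (Z.of_nat h)) (Z.to_nat q).
Proof.
  intros Hq Hg Hper. set (N := Z.to_nat q).
  assert (HN : Z.of_nat N = q) by (unfold N; lia).
  set (s := fun h : nat => Z.to_nat ((a * Z.of_nat h) mod q)).
  assert (Hs : forall h, Z.of_nat (s h) = ((a * Z.of_nat h) mod q)%Z).
  { intros h. unfold s. rewrite Z2Nat.id; [reflexivity|]. apply Z.mod_pos_bound, Hq. }
  assert (P : Permutation (map s (seq 0 N)) (seq 0 N)).
  { apply NoDup_Permutation_bis.
    - apply NoDup_map_NoDup_ForallPairs; [|apply seq_NoDup].
      intros x y Hx Hy E. apply in_seq in Hx. apply in_seq in Hy.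
      assert (E' : ((a * Z.of_nat x) mod q = (a * Z.of_nat y) mod q)%Z) by (rewrite <- !Hs, E; reflexivity).
      assert (D : (q | a * (Z.of_nat x - Z.of_nat y))%Z).
      { rewrite Z.mul_sub_distr_l. apply Z.mod_divide; [lia|]. rewrite Zminus_mod, E', Z.sub_diag. apply Z.mod_0_l. lia. }
      apply Z.gauss in D; [|rewrite Z.gcd_comm; exact Hg]. destruct D as [t Ht].
      assert (t = 0)%Z by nia. nia.
    - rewrite length_map. lia.
    - intros y Hy. apply in_map_iff in Hy. destruct Hy as [x [<- Hx]]. apply in_seq.
      assert (B := Z.mod_pos_bound (a * Z.of_nat x) q Hq). specialize (Hs x). lia. }
  assert (E1 := fold_right_Csum (fun h => psi (Z.of_nat h)) 0 N).
  assert (E2 := fold_right_Csum (fun h => psi (Z.of_nat (s h))) 0 N).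
  simpl in E1, E2. rewrite <- E1. transitivity (Csum (fun h => psi (Z.of_nat (s h))) N).
  - apply Csum_ext. intros h _. rewrite Hs.
    rewrite (Z.div_mod (a * Z.of_nat h) q) at 1 by lia. rewrite Z.add_comm. apply periodic_Z, Hper.
  - rewrite <- E2. rewrite <- (map_map s (fun h => psi (Z.of_nat h))).
    apply fold_right_Cplus_perm, Permutation_map, P.
Qed.

Lemma periodic_bounded (q : Z) (chi : Z -> C) : (0 < q)%Z -> (forall n, chi (n + q)%Z = chi n) ->
  exists K, forall n, Cmod (chi n) <= K.
Proof.
  intros Hq Hper.
  assert (HB : forall N : nat, exists K, forall i, (i < N)%nat -> Cmod (chi (Z.of_nat i)) <= K).
  { induction N as [|N [K HK]]; [exists 0; intros; lia|].
    exists (Rmax K (Cmod (chi (Z.of_nat N)))). intros i Hi.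
    destruct (Nat.eq_dec i N) as [->|Hn]; [apply Rmax_r|].
    eapply Rle_trans; [apply HK; lia|apply Rmax_l]. }
  destruct (HB (Z.to_nat q)) as [K HK]. exists K. intros n.
  rewrite (Z.div_mod n q) by lia. rewrite Z.add_comm, periodic_Z by exact Hper.
  assert (B := Z.mod_pos_bound n q Hq).
  rewrite <- (Z2Nat.id (n mod q)) by lia. apply HK. lia.
Qed.

Section Character.
Variables (q : Z) (chi : Z -> C).
Hypothesis Hchi : dirichlet_char q chi.

Lemma char_pos : (0 < q)%Z. Proof. apply Hchi. Qed.
Lemma char_mul m n : chi (m * n)%Z = (chi m * chi n)%C. Proof. apply Hchi. Qed.
Lemma char_period n : chi (n + q)%Z = chi n. Proof. apply Hchi. Qed.
Lemma char_neq_0 n : chi n <> 0%C <-> Z.gcd n q = 1%Z. Proof. apply Hchi. Qed.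

Lemma char_1 : chi 1%Z = 1%C.
Proof.
  assert (N : chi 1%Z <> 0%C) by (apply char_neq_0, Z.gcd_1_l).
  assert (E := char_mul 1 1). rewrite Z.mul_1_l in E.
  replace (chi 1%Z) with (/ chi 1%Z * (chi 1%Z * chi 1%Z))%C by (field; exact N).
  rewrite <- E. field. exact N.
Qed.

Lemma char_eq_0 n : Z.gcd n q <> 1%Z -> chi n = 0%C.
Proof. intros H. apply NNPP. intros E. apply H, char_neq_0, E. Qed.

Lemma char_inverse n : Z.gcd n q = 1%Z -> exists u, (chi u * chi n = 1)%C.
Proof.
  intros H. destruct (Z.gcd_bezout n q 1 H) as [u [v E]]. exists u.
  rewrite <- char_mul, <- char_1, <- E. symmetry. rewrite (Z.mul_comm v q).
  apply periodic_Z, char_period.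
Qed.

(* The powers of [chi n] are values of [chi], hence bounded. *)
Lemma char_Cmod_le_1 n : Cmod (chi n) <= 1.
Proof.
  destruct (periodic_bounded q chi char_pos char_period) as [K HK].
  destruct (Rle_dec (Cmod (chi n)) 1) as [H|H]; [exact H|exfalso].
  assert (P : forall j : nat, Cmod (chi n) ^ j <= K).
  { intros j. rewrite <- Cmod_pow. replace (chi n ^ j)%C with (chi (n ^ Z.of_nat j)%Z); [apply HK|].
    induction j as [|j IH]; [apply char_1|].
    rewrite Nat2Z.inj_succ, Z.pow_succ_r by lia. rewrite char_mul, IH. reflexivity. }
  destruct (Pow_x_infinity (Cmod (chi n))) with (b := K + 1) as [N HN].
  - rewrite Rabs_pos_eq by apply Cmod_ge_0. lra.
  - specialize (HN N (Nat.le_refl _)). rewrite Rabs_pos_eq in HN by (apply pow_le, Cmod_ge_0).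
    specialize (P N). lra.
Qed.

(** Both moduli are at most 1 and their product is 1, so [|chi n| = 1] and the inverse of [chi n] is
    its conjugate. *)
Lemma char_conj_inverse n u : (chi u * chi n = 1)%C -> chi u = Cconj (chi n).
Proof.
  intros E.
  assert (M : Cmod (chi n) = 1).
  { assert (M := f_equal Cmod E). rewrite Cmod_mult, Cmod_1 in M.
    assert (A := char_Cmod_le_1 n). assert (B := char_Cmod_le_1 u).
    assert (A' := Cmod_ge_0 (chi n)). assert (B' := Cmod_ge_0 (chi u)). nra. }
  assert (C1 := Cmod2_conj (chi n)). rewrite M in C1.
  replace (chi u) with (chi u * RtoC (1 ^ 2))%C by (rewrite pow1; ring).
  rewrite C1, Cmult_assoc, E. ring.
Qed.

Definition unit_circle_char (m : Z) : C := Ce (2 * PI * IZR m / IZR q).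

Lemma unit_circle_char_period m j : unit_circle_char (m + q * j) = unit_circle_char m.
Proof.
  assert (Hq := char_pos). apply IZR_lt in Hq. unfold unit_circle_char.
  rewrite <- (Ce_period (2 * PI * IZR m / IZR q) j). f_equal.
  rewrite plus_IZR, mult_IZR. field. lra.
Qed.

Lemma gauss_sum_Csum :
  gauss_sum q chi = Csum (fun h => chi (Z.of_nat h) * unit_circle_char (Z.of_nat h))%C (Z.to_nat q).
Proof.
  assert (Hq := char_pos). unfold gauss_sum. rewrite fold_right_Csum.
  set (f := fun h => (chi (Z.of_nat h) * unit_circle_char (Z.of_nat h))%C).
  rewrite (Csum_ext _ (fun i => f (S i))).
  2:{ intros i _. unfold f, unit_circle_char, Ce. do 3 f_equal. rewrite INR_IZR_INZ. reflexivity. }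
  assert (E := Csum_S_l f (Z.to_nat q)). simpl in E.
  (* The Gauss sum runs over [1..q], the Fourier sum over [0..q-1]; periodicity identifies the two
     end terms. *)
  assert (E0 : f (Z.to_nat q) = f 0%nat).
  { unfold f. rewrite Z2Nat.id by lia. f_equal.
    - apply (char_period 0).
    - rewrite <- (unit_circle_char_period (Z.of_nat 0) 1). f_equal. lia. }
  rewrite E0 in E.
  replace (Csum (fun i => f (S i)) (Z.to_nat q)) with ((f 0%nat + Csum (fun i => f (S i)) (Z.to_nat q)) - f 0%nat)%C by ring.
  rewrite <- E. ring.
Qed.

Lemma dft_char n :
  dft (Z.to_nat q) chi n =
  Csum (fun h => chi (Z.of_nat h) * unit_circle_char (Z.of_nat n * Z.of_nat h))%C (Z.to_nat q).
Proof.
  assert (Hq := char_pos). unfold dft. apply Csum_ext. intros h _. unfold unit_circle_char. do 2 f_equal.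
  rewrite (INR_IZR_INZ (Z.to_nat q)), Z2Nat.id by lia. rewrite mult_IZR, <- !INR_IZR_INZ.
  unfold Rdiv. ring.
Qed.

Hypothesis Hprim : primitive_char q chi.
Hypothesis Hq1 : (1 < q)%Z.

(** For [n] prime to [q], the substitution [h -> n h] pulls out the inverse of [chi n]. Otherwise
    the right-hand side is 0, and the left-hand side [S] satisfies [chi a * S = S] for some [a] with
    [chi a <> 1], supplied by primitivity at the proper divisor [q / gcd (n, q)]. *)
Lemma gauss_separable n :
  dft (Z.to_nat q) chi n = (gauss_sum q chi * Cconj (chi (Z.of_nat n)))%C.
Proof.
  assert (Hq := char_pos). rewrite dft_char.
  destruct (Z.eq_dec (Z.gcd (Z.of_nat n) q) 1) as [Hg|Hg].
  - destruct (char_inverse _ Hg) as [u Hu]. rewrite <- (char_conj_inverse _ _ Hu), gauss_sum_Csum.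
    rewrite Cmult_comm, <- Csum_scal.
    rewrite <- (Csum_unit_mul q (Z.of_nat n) (fun m => chi u * (chi m * unit_circle_char m))%C Hq Hg).
    + apply Csum_ext. intros h _. rewrite char_mul.
      replace (chi u * (chi (Z.of_nat n) * chi (Z.of_nat h) * unit_circle_char (Z.of_nat n * Z.of_nat h)))%C
        with ((chi u * chi (Z.of_nat n)) * (chi (Z.of_nat h) * unit_circle_char (Z.of_nat n * Z.of_nat h)))%C by ring.
      rewrite Hu. ring.
    + intros m. rewrite char_period. do 2 f_equal.
      replace (m + q)%Z with (m + q * 1)%Z by lia. apply unit_circle_char_period.
  - rewrite (char_eq_0 _ Hg). assert (C0 : Cconj 0 = 0%C) by (unfold Cconj, RtoC; simpl; rewrite Ropp_0; reflexivity).
    rewrite C0, Cmult_0_r.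
    set (g := Z.gcd (Z.of_nat n) q) in *.
    assert (Hg0 : (0 <= g)%Z) by apply Z.gcd_nonneg.
    destruct (Z.gcd_divide_r (Z.of_nat n) q) as [d Hd]. fold g in Hd.
    destruct (Z.gcd_divide_l (Z.of_nat n) q) as [e He]. fold g in He.
    assert (g <> 0)%Z by nia.
    destruct (proj2 Hprim d) as [a [Ha1 [Ha2 Ha3]]]; [nia|exists g; lia|nia|].
    assert (Hda : (d | a - 1)%Z).
    { apply Z.mod_divide; [nia|]. rewrite Zminus_mod, Ha2, Z.sub_diag. apply Z.mod_0_l. nia. }
    destruct Hda as [t Ht].
    set (phi := fun m => (chi m * unit_circle_char (Z.of_nat n * m))%C).
    change (Csum (fun h => phi (Z.of_nat h)) (Z.to_nat q) = 0%C).
    assert (Hphi : forall m, phi (m + q)%Z = phi m).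
    { intros m. unfold phi. rewrite char_period. f_equal.
      replace (Z.of_nat n * (m + q))%Z with (Z.of_nat n * m + q * Z.of_nat n)%Z by lia.
      apply unit_circle_char_period. }
    assert (E := Csum_unit_mul q a phi Hq Ha1 Hphi).
    rewrite (Csum_ext _ (fun h => chi a * phi (Z.of_nat h))%C) in E.
    2:{ intros h _. unfold phi. rewrite char_mul.
        (* As [a - 1 = t d], [n = e g] and [q = d g], the difference [n a - n] is a multiple of [q],
           so the additive character does not see [a]. *)
        replace (Z.of_nat n * (a * Z.of_nat h))%Z with (Z.of_nat n * Z.of_nat h + q * (e * t * Z.of_nat h))%Z.
        - rewrite unit_circle_char_period. ring.
        - replace a with (t * d + 1)%Z by lia. rewrite He at 1 2. rewrite Hd. ring. }
    rewrite Csum_scal in E.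
    set (S := Csum (fun h => phi (Z.of_nat h)) (Z.to_nat q)) in *.
    assert (D : (chi a - 1)%C <> 0%C).
    { intros D. apply Ha3. replace (chi a) with ((chi a - 1) + 1)%C by ring. rewrite D. ring. }
    replace S with (/ (chi a - 1) * (chi a * S - S))%C by (field; exact D). rewrite E. ring.
Qed.
End Character.

(** Modulus 1 would make [chi] constant, against [chi 1 = 1] and [chi (-1) = -1]. It is from [q > 1]
    that [chi 0 = 0] follows later. *)
Lemma odd_char_modulus q chi : dirichlet_char q chi -> odd_char chi -> (1 < q)%Z.
Proof.
  intros H Ho. assert (Hq := char_pos q chi H).
  destruct (Z.eq_dec q 1) as [E|E]; [exfalso|lia].
  assert (E1 := char_period q chi H (-1)). assert (E2 := char_period q chi H 0).
  rewrite E in E1, E2. simpl in E1, E2. rewrite (char_1 q chi H) in E2. unfold odd_char in Ho.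
  rewrite Ho, <- E2 in E1. injection E1. lra.
Qed.

Lemma Cis_series_decr_1 (a : nat -> C) (l : C) :
  Cis_series (fun n => a (S n)) l -> Cis_series a (a 0%nat + l)%C.
Proof.
  intros H. apply (is_series_decr_1 (K := C_AbsRing) (V := C_NormedModule)).
  assert (E : l = (a 0%nat + l + - a 0%nat)%C) by ring. rewrite E in H. exact H.
Qed.

Lemma freq_series_bound q beta k chi K : (0 < q)%nat -> 0 < beta -> (1 <= k)%nat ->
  (forall n, Cmod (chi n) <= K) ->
  exists B, forall j : Z, Cmod (chi j / freq q beta j ^ S k)%C <= B * / (Rabs (IZR j) + 1) ^ 2.
Proof.
  intros Hq Hb Hk HK. destruct (freq_lower_bound q beta Hq Hb) as [c [Hc Hlow]].
  exists (K * / c ^ S k). intros j.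
  assert (P := Rabs_pos (IZR j)).
  assert (H0 : freq q beta j <> 0%C) by (apply freq_neq_0, Hb).
  rewrite Cmod_div by (apply Cpow_nz, H0). rewrite Cmod_pow. unfold Rdiv. rewrite Rmult_assoc.
  apply Rmult_le_compat; [apply Cmod_ge_0|left; apply Rinv_0_lt_compat, pow_lt, Cmod_gt_0, H0|apply HK|].
  rewrite <- Rinv_mult. apply Rinv_le_contravar.
  - apply Rmult_lt_0_compat; apply pow_lt; lra.
  - apply Rle_trans with ((c * (Rabs (IZR j) + 1)) ^ S k).
    + rewrite Rpow_mult_distr. apply Rmult_le_compat_l; [apply pow_le; lra|]. apply Rle_pow; [lra|lia].
    + apply pow_incr. split; [apply Rmult_le_pos; lra|apply Hlow].
Qed.

(** The pairs [m], [-1 - m] of the centred sum are regrouped as [m], [-m] with [m = 0] apart, which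
    is the pairing that parity acts on. Each half converges absolutely, so the two series can be
    separated and recombined. *)
Theorem twisted_lipschitz q chi K beta k : (0 < q)%nat ->
  (forall n, chi (n + Z.of_nat q)%Z = chi n) -> (forall n, Cmod (chi n) <= K) ->
  0 < beta -> (1 <= k)%nat ->
  CSeries (fun n => RtoC (INR n ^ k) * dft q chi n * RtoC (exp (- (beta * INR n))))%C =
  (RtoC (INR (fact k)) * (chi 0%Z / RtoC beta ^ S k +
   CSeries (fun m => chi (Z.of_nat (S m)) / freq q beta (Z.of_nat (S m)) ^ S k
                   + chi (- Z.of_nat (S m))%Z / freq q beta (- Z.of_nat (S m))%Z ^ S k)))%C.
Proof.
  intros Hq Hper HK Hb Hk.
  rewrite (twisted_lipschitz_balanced q chi K beta k Hq Hper HK Hb Hk). f_equal.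
  destruct (freq_series_bound q beta k chi K Hq Hb Hk HK) as [B HB].
  set (a := fun j : Z => (chi j / freq q beta j ^ S k)%C) in *.
  change (CSeries (fun m => a (Z.of_nat m) + a (-1 - Z.of_nat m)%Z)%C =
    (chi 0%Z / RtoC beta ^ S k + CSeries (fun m => a (Z.of_nat (S m)) + a (- Z.of_nat (S m))%Z)%C)%C).
  assert (HB0 : 0 <= B).
  { specialize (HB 0%Z). rewrite Rabs_R0 in HB. generalize (Rle_trans _ _ _ (Cmod_ge_0 _) HB).
    rewrite Rplus_0_l, pow1, Rinv_1. lra. }
  assert (HS : forall j (m : nat), Z.abs j = Z.of_nat (S m) -> Cmod (a j) <= B * / INR (S m) ^ 2).
  { intros j m E. eapply Rle_trans; [apply HB|]. apply Rmult_le_compat_l; [exact HB0|].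
    apply Rinv_le_contravar; [apply pow_lt, INR_S_pos|]. apply pow_incr. rewrite <- abs_IZR, E, <- INR_IZR_INZ.
    generalize (INR_S_pos m). lra. }
  assert (EB := ex_series_scal B _ ex_series_inv_sq).
  assert (S1 : Cis_series (fun m => a (Z.of_nat (S m))) (CSeries (fun m => a (Z.of_nat (S m))))).
  { eapply Cis_series_dom; [|exact EB]. intros m. apply HS. lia. }
  assert (S2 : Cis_series (fun m => a (- Z.of_nat (S m))%Z) (CSeries (fun m => a (- Z.of_nat (S m))%Z))).
  { eapply Cis_series_dom; [|exact EB]. intros m. apply HS. lia. }
  rewrite (Cis_series_unique _ _ (Cis_series_plus _ _ _ _ S1 S2)).
  assert (S3 := Cis_series_decr_1 (fun m => a (Z.of_nat m)) _ S1).
  assert (S2' : Cis_series (fun m => a (-1 - Z.of_nat m)%Z) (CSeries (fun m => a (- Z.of_nat (S m))%Z))).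
  { eapply Cis_series_ext; [|exact S2]. intros m. cbv beta. f_equal. lia. }
  rewrite (Cis_series_unique _ _ (Cis_series_plus _ _ _ _ S3 S2')).
  assert (E0 : a (Z.of_nat 0) = (chi 0%Z / RtoC beta ^ S k)%C).
  { unfold a. simpl Z.of_nat. do 2 f_equal. f_equal. unfold freq, RtoC. f_equal.
    unfold Rdiv. ring. }
  cbv beta. rewrite E0. ring.
Qed.

(** * Lambert series and their transformation *)

Lemma divisor_sum_Csum n f :
  divisor_sum n f = Csum (fun d => if Nat.eqb (n mod S d) 0 then f (S d) else 0%C) n.
Proof. unfold divisor_sum. apply fold_right_Csum. Qed.

Lemma divisor_sum_ext n (f g : nat -> C) :
  (forall d, (0 < d)%nat -> (n mod d = 0)%nat -> f d = g d) -> divisor_sum n f = divisor_sum n g.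
Proof.
  intros H. rewrite !divisor_sum_Csum. apply Csum_ext. intros d _.
  destruct (Nat.eqb_spec (n mod S d) 0) as [E|E]; [apply H; [lia|exact E]|reflexivity].
Qed.

(** Both sides are sums over the pairs [(d, e)] in [[1, n]^2] with [d e = n]; in this form the
    symmetry is an exchange of two finite sums. *)
Lemma divisor_sum_involution n (f : nat -> nat -> C) : (0 < n)%nat ->
  divisor_sum n (fun d => f d (n / d)%nat) = divisor_sum n (fun d => f (n / d)%nat d).
Proof.
  intros Hn.
  assert (E : forall g : nat -> nat -> C, divisor_sum n (fun d => g d (n / d)%nat) =
    Csum (fun d => Csum (fun e => if Nat.eqb (S d * S e) n then g (S d) (S e) else 0%C) n) n).
  { intros g. rewrite divisor_sum_Csum. apply Csum_ext. intros d _.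
    assert (Hdm := Nat.div_mod_eq n (S d)).
    destruct (Nat.eqb_spec (n mod S d) 0) as [H|H].
    - rewrite H, Nat.add_0_r in Hdm. set (e := (n / S d)%nat) in *.
      destruct e as [|e]; [lia|].
      rewrite (Csum_single _ n e).
      + rewrite <- Hdm, Nat.eqb_refl. reflexivity.
      + nia.
      + intros j _ Hj. destruct (Nat.eqb_spec (S d * S j) n) as [E|E]; [nia|reflexivity].
    - symmetry. apply Csum_zero. intros e _. destruct (Nat.eqb_spec (S d * S e) n) as [E|E]; [|reflexivity].
      exfalso. apply H. rewrite <- E, Nat.mul_comm. apply Nat.Div0.mod_mul. }
  rewrite (E f), (E (fun d e => f e d)), Csum_swap.
  apply Csum_ext. intros e _. apply Csum_ext. intros d _. rewrite Nat.mul_comm. reflexivity.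
Qed.

(** The double series runs over [j] and [n = j d], with zero where [j] does not divide [n]: its rows
    give the first series and its columns the divisor sums. For [j | n], [(n / j)^k <= n^k / j^2],
    by [k >= 2], separates the variables. *)
Lemma lambert_rearrangement (F G : nat -> C) (K1 K2 beta : R) (k : nat) :
  (2 <= k)%nat -> 0 < beta -> (forall d, Cmod (F d) <= K1 * INR d ^ k) -> (forall j, Cmod (G j) <= K2) ->
  let T := CSeries (fun j => G (S j) * CSeries (fun d => F d * RtoC (exp (- (beta * INR (S j) * INR d)))))%C in
  Cis_series (fun j => G (S j) * CSeries (fun d => F d * RtoC (exp (- (beta * INR (S j) * INR d)))))%C T /\
  Cis_series (fun n => divisor_sum (S n) (fun d => F d * G (S n / d)%nat) * RtoC (exp (- (beta * INR (S n)))))%C T.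
Proof.
  intros Hk Hb HF HG T.
  (* Every [j] divides [n = 0], so column 0 is an infinite sum of the terms [G (S j) * F 0]; the
     bound at [d = 0] makes it vanish. *)
  assert (HF0 : F 0%nat = 0%C).
  { apply Cmod_eq_0. apply Rle_antisym; [|apply Cmod_ge_0]. specialize (HF 0%nat).
    rewrite pow_ne_zero in HF by lia. lra. }
  assert (K20 : 0 <= K2) by (eapply Rle_trans; [apply Cmod_ge_0|apply (HG 0%nat)]).
  assert (K10 : 0 <= K1).
  { specialize (HF 1%nat). rewrite pow1, Rmult_1_r in HF. eapply Rle_trans; [apply Cmod_ge_0|exact HF]. }
  set (v := fun j n => sparse (S j) (fun d => G (S j) * (F d * RtoC (exp (- (beta * INR (S j) * INR d)))))%C n).
  assert (Hv : forall j n, v j n = if Nat.eqb (n mod S j) 0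
     then (G (S j) * F (n / S j)%nat * RtoC (exp (- (beta * INR n))))%C else 0%C).
  { intros j n. unfold v, sparse. destruct (Nat.eqb_spec (n mod S j) 0) as [E|E]; [|reflexivity].
    assert (D := Nat.div_mod_eq n (S j)). rewrite E, Nat.add_0_r in D.
    rewrite D at 4. rewrite mult_INR, Rmult_assoc. ring. }
  destruct (poly_exp_decay k beta Hb) as [D [HD HDn]].
  assert (EB := ex_series_scal D _ ex_series_inv_sq).
  destruct (double_series_swap v (fun j => K1 * K2 * / INR (S j) ^ 2) (fun n => D * / INR (S n) ^ 2)) as [W1 W2].
  - intros j n. rewrite Hv.
    assert (A1 : 0 <= / INR (S j) ^ 2) by (left; apply Rinv_0_lt_compat, pow_lt, INR_S_pos).
    assert (A2 : 0 <= D * / INR (S n) ^ 2) by (apply Rmult_le_pos; [lra|]; left; apply Rinv_0_lt_compat, pow_lt, INR_S_pos).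
    assert (A3 : 0 <= K1 * K2 * / INR (S j) ^ 2) by (repeat apply Rmult_le_pos; assumption).
    destruct (Nat.eqb_spec (n mod S j) 0) as [E|E].
    2:{ rewrite Cmod_0. apply Rmult_le_pos; assumption. }
    rewrite !Cmod_mult, Cmod_R, (Rabs_pos_eq (exp _)) by (left; apply exp_pos).
    apply Rle_trans with (K2 * (K1 * (INR (S n) ^ k * / INR (S j) ^ 2)) * exp (- (beta * INR n))).
    + apply Rmult_le_compat_r; [left; apply exp_pos|].
      apply Rmult_le_compat; [apply Cmod_ge_0|apply Cmod_ge_0|apply HG|].
      eapply Rle_trans; [apply HF|]. apply Rmult_le_compat_l; [exact K10|].
      assert (Dn := Nat.div_mod_eq n (S j)). rewrite E, Nat.add_0_r in Dn. apply (f_equal INR) in Dn.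
      rewrite mult_INR in Dn. assert (Hj := INR_S_pos j).
      replace (INR (n / S j)) with (INR n * / INR (S j)) by (rewrite Dn; field; lra).
      rewrite Rpow_mult_distr, pow_inv. apply Rmult_le_compat.
      * apply pow_le, pos_INR.
      * left. apply Rinv_0_lt_compat, pow_lt, Hj.
      * apply pow_incr. split; [apply pos_INR|rewrite S_INR; lra].
      * apply Rinv_le_contravar; [apply pow_lt, Hj|]. apply Rle_pow; [|lia].
        change 1 with (INR 1). apply le_INR. lia.
    + replace (K2 * (K1 * (INR (S n) ^ k * / INR (S j) ^ 2)) * exp (- (beta * INR n)))
        with (K1 * K2 * / INR (S j) ^ 2 * (INR (S n) ^ k * exp (- (beta * INR n)))) by ring.
      apply Rmult_le_compat_l; [exact A3|apply HDn].
  - intros j. repeat apply Rmult_le_pos; try assumption. left. apply Rinv_0_lt_compat, pow_lt, INR_S_pos.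
  - apply (ex_series_scal (K1 * K2) _ ex_series_inv_sq).
  - exact EB.
  - assert (Hrow : forall j, CSeries (v j) = (G (S j) * CSeries (fun d => F d * RtoC (exp (- (beta * INR (S j) * INR d)))))%C).
    { intros j.
      assert (Sv : Cis_series (v j) (CSeries (v j))).
      { apply (Cis_series_dom _ (fun n => K1 * K2 * (D * / INR (S n) ^ 2))); [|apply (ex_series_scal (K1 * K2) _ EB)].
        intros n. rewrite Hv.
        assert (A2 : 0 <= D * / INR (S n) ^ 2) by (apply Rmult_le_pos; [lra|]; left; apply Rinv_0_lt_compat, pow_lt, INR_S_pos).
        destruct (Nat.eqb_spec (n mod S j) 0) as [E|E].
        2:{ rewrite Cmod_0. repeat apply Rmult_le_pos; try assumption. lra. left; apply Rinv_0_lt_compat, pow_lt, INR_S_pos. }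
        rewrite !Cmod_mult, Cmod_R, (Rabs_pos_eq (exp _)) by (left; apply exp_pos).
        apply Rle_trans with (K2 * (K1 * INR (S n) ^ k) * exp (- (beta * INR n))).
        + apply Rmult_le_compat_r; [left; apply exp_pos|].
          apply Rmult_le_compat; [apply Cmod_ge_0|apply Cmod_ge_0|apply HG|].
          eapply Rle_trans; [apply HF|]. apply Rmult_le_compat_l; [exact K10|].
          apply pow_incr. split; [apply pos_INR|]. apply le_INR.
          apply Nat.le_trans with n; [apply Nat.Div0.div_le_upper_bound; nia|lia].
        + replace (K2 * (K1 * INR (S n) ^ k) * exp (- (beta * INR n)))
            with (K1 * K2 * (INR (S n) ^ k * exp (- (beta * INR n)))) by ring.
          apply Rmult_le_compat_l; [apply Rmult_le_pos; assumption|apply HDn]. }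
      apply Cis_series_sparse in Sv; [|lia].
      (* The inner series is recovered by dividing the row by [G (S j)]; a zero value needs its own
         argument. *)
      destruct (classic (G (S j) = 0%C)) as [G0|G0].
      - rewrite G0, Cmult_0_l. rewrite <- (Cis_series_unique _ _ Sv).
        rewrite G0. apply Cis_series_unique. apply (Cis_series_ext (fun _ => 0%C)); [intros; ring|].
        apply (Cis_series_finite (fun _ => 0%C) 0). reflexivity.
      - apply (Cis_series_scal (/ G (S j))) in Sv.
        apply (Cis_series_ext _ (fun d => F d * RtoC (exp (- (beta * INR (S j) * INR d))))%C) in Sv.
        + rewrite (Cis_series_unique _ _ Sv). field. exact G0.
        + intros d. field. exact G0. }
    assert (HT : CSeries (fun j => CSeries (v j)) = T).
    { symmetry. apply Cis_series_unique. eapply Cis_series_ext; [exact Hrow|exact W1]. }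
    rewrite HT in W1, W2. split; [eapply Cis_series_ext; [exact Hrow|exact W1]|].
    assert (Hcol : forall n, CSeries (fun j => v j n) =
      (divisor_sum n (fun d => F d * G (n / d)%nat) * RtoC (exp (- (beta * INR n))))%C).
    { intros n. destruct n as [|n].
      - unfold divisor_sum; simpl fold_right. rewrite Cmult_0_l. apply Cis_series_unique.
        apply (Cis_series_ext (fun _ => 0%C)).
        + intros j. rewrite Hv. rewrite Nat.Div0.div_0_l, HF0. destruct (Nat.eqb _ _); ring.
        + apply (Cis_series_finite (fun _ => 0%C) 0). reflexivity.
      - rewrite (divisor_sum_involution (S n) (fun a b => F a * G b)%C) by lia.
        rewrite divisor_sum_Csum, Cmult_comm, <- Csum_scal.
        rewrite (Cis_series_unique (fun j => v j (S n)) (Csum (fun j => v j (S n)) (S n))).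
        + apply Csum_ext. intros j _. rewrite Hv. destruct (Nat.eqb _ _); ring.
        + apply Cis_series_finite. intros j Hj. rewrite Hv, Nat.mod_small by lia. reflexivity. }
    apply (Cis_series_shift (fun n => divisor_sum n (fun d => F d * G (n / d)%nat) * RtoC (exp (- (beta * INR n))))%C).
    + unfold divisor_sum; simpl fold_right. apply Cmult_0_l.
    + eapply Cis_series_ext; [exact Hcol|exact W2].
Qed.

(** The terms [j] and [-j] of Lipschitz's expansion at [m y], without the factor [k!]. *)
Definition pole_pair (y : R) (k m j : nat) : C :=
  (/ (y * INR m, - (2 * PI * INR j))%R ^ S k + / (y * INR m, 2 * PI * INR j)%R ^ S k)%C.

(** Lipschitz's classical formula, as the twisted one for modulus 1 and the constant function 1. *)
Lemma lipschitz_pole_pair y k m : 0 < y -> (1 <= k)%nat -> (0 < m)%nat ->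
  CSeries (fun d => RtoC (INR d ^ k) * RtoC (exp (- (y * INR m * INR d))))%C =
  (RtoC (INR (fact k)) * (/ RtoC (y * INR m) ^ S k + CSeries (fun j => pole_pair y k m (S j))))%C.
Proof.
  intros Hy Hk Hm. assert (Hm' : 0 < INR m) by (apply lt_0_INR, Hm).
  assert (T := twisted_lipschitz 1 (fun _ => 1%C) 1 (y * INR m) k Nat.lt_0_1 (fun _ => eq_refl)
    (fun _ => Req_le _ _ Cmod_1) ltac:(nra) Hk).
  replace (fun d => RtoC (INR d ^ k) * RtoC (exp (- (y * INR m * INR d))))%C
    with (fun n => RtoC (INR n ^ k) * dft 1 (fun _ => 1%C) n * RtoC (exp (- (y * INR m * INR n))))%C.
  - rewrite T. f_equal. f_equal; [unfold Cdiv; ring|]. f_equal.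
    apply functional_extensionality. intros j. unfold pole_pair, freq.
    rewrite opp_IZR, <- INR_IZR_INZ. change (INR 1) with 1.
    replace (2 * PI * INR (S j) / 1) with (2 * PI * INR (S j)) by field.
    replace (- (2 * PI * - INR (S j) / 1)) with (2 * PI * INR (S j)) by field.
    unfold Cdiv. rewrite !Cmult_1_l. reflexivity.
  - apply functional_extensionality. intros n. unfold dft. simpl Csum.
    replace (2 * PI * 0 * INR n / 1) with (2 * PI * IZR 0) by (simpl; field). rewrite Ce_2PI. ring.
Qed.

Lemma pair_neq_0 (a b : R) : 0 < a -> (a, b) <> RtoC 0.
Proof. intros H E. injection E as E _. lra. Qed.

(** The arithmetic-geometric mean inequality bounds [|m y + 2 i pi j|] below by [c sqrt m sqrt j],
    and the cube of this is available since [k + 1 >= 3]. The product form in [m] and [j] is what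
    [double_series_swap] asks for. *)
Lemma pole_pair_bound y k : 0 < y -> (2 <= k)%nat ->
  exists B, 0 <= B /\ forall m j, Cmod (pole_pair y k (S m) (S j)) <=
    B * Rpower (INR (S m)) (- (1 + / 2)) * Rpower (INR (S j)) (- (1 + / 2)).
Proof.
  intros Hy Hk. assert (HP := PI_RGT_0).
  set (c := sqrt (4 * PI * y)). assert (Hc : 0 < c) by (apply sqrt_lt_R0; nra).
  exists (2 * / c ^ S k).
  assert (Hi : 0 < / c ^ S k) by (apply Rinv_0_lt_compat, pow_lt, Hc).
  split; [lra|]. intros m j.
  assert (Hm := INR_S_pos m). assert (Hj := INR_S_pos j).
  assert (Hpow : forall x, 0 < x -> Rpower x (- (1 + / 2)) = / sqrt x ^ 3).
  { intros x Hx. rewrite Rpower_Ropp. f_equal. rewrite <- Rpower_sqrt by exact Hx.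
    rewrite <- Rpower_pow by apply exp_pos. rewrite Rpower_mult. f_equal. simpl. field. }
  rewrite !Hpow by assumption.
  assert (Hone : forall s, s ^ 2 = 1 -> Cmod (/ (y * INR (S m), s * (2 * PI * INR (S j)))%R ^ S k)%C <=
     / c ^ S k * / sqrt (INR (S m)) ^ 3 * / sqrt (INR (S j)) ^ 3).
  { intros s Hs. set (w := (y * INR (S m), s * (2 * PI * INR (S j)))%R).
    assert (Hw0 : w <> RtoC 0) by (apply pair_neq_0; nra).
    rewrite Cmod_inv by (apply Cpow_nz, Hw0). rewrite Cmod_pow, <- !Rinv_mult.
    assert (P1 : 1 <= INR (S m)) by (change 1 with (INR 1); apply le_INR; lia).
    assert (P2 : 1 <= INR (S j)) by (change 1 with (INR 1); apply le_INR; lia).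
    assert (Q1 : 1 <= sqrt (INR (S m))) by (rewrite <- sqrt_1; apply sqrt_le_1_alt, P1).
    assert (Q2 : 1 <= sqrt (INR (S j))) by (rewrite <- sqrt_1; apply sqrt_le_1_alt, P2).
    assert (Hw : c * sqrt (INR (S m)) * sqrt (INR (S j)) <= Cmod w).
    { unfold c. assert (Z1 : 0 <= 4 * PI * y) by nra.
      assert (Z2 : 0 <= 4 * PI * y * INR (S m)) by (apply Rmult_le_pos; lra).
      rewrite <- !sqrt_mult by lra. unfold Cmod. apply sqrt_le_1_alt.
      change (fst w) with (y * INR (S m)). change (snd w) with (s * (2 * PI * INR (S j))).
      replace ((s * (2 * PI * INR (S j))) ^ 2) with (s ^ 2 * (2 * PI * INR (S j)) ^ 2) by ring. rewrite Hs.
      generalize (pow2_ge_0 (y * INR (S m) - 2 * PI * INR (S j))). lra. }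
    apply Rinv_le_contravar.
    - apply Rmult_lt_0_compat; [apply Rmult_lt_0_compat|]; apply pow_lt; lra.
    - apply Rle_trans with ((c * sqrt (INR (S m)) * sqrt (INR (S j))) ^ S k).
      + rewrite !Rpow_mult_distr.
        apply Rmult_le_compat; [apply Rmult_le_pos; apply pow_le; lra|apply pow_le; lra| |apply Rle_pow; [lra|lia]].
        apply Rmult_le_compat_l; [apply pow_le; lra|apply Rle_pow; [lra|lia]].
      + apply pow_incr. split; [|exact Hw]. apply Rmult_le_pos; [apply Rmult_le_pos|]; lra. }
  unfold pole_pair. eapply Rle_trans; [apply Cmod_triangle|].
  assert (A := Hone (-1) ltac:(ring)). assert (B := Hone 1 ltac:(ring)).
  rewrite Rmult_1_l in B. replace (-1 * (2 * PI * INR (S j))) with (- (2 * PI * INR (S j))) in A by ring.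
  lra.
Qed.

Lemma Lfun_series_scaled k chi y : 0 < y ->
  Cis_series (fun n => chi (Z.of_nat (S n)) / RtoC (INR (S n)) ^ S k)%C (Lfun (RtoC (1 + INR k)) chi) ->
  Cis_series (fun n => chi (Z.of_nat (S n)) * / RtoC (y * INR (S n)) ^ S k)%C
    (Lfun (RtoC (1 + INR k)) chi / RtoC y ^ S k)%C.
Proof.
  intros Hy H. apply (Cis_series_scal (/ RtoC y ^ S k)) in H.
  unfold Cdiv at 1. rewrite Cmult_comm. eapply Cis_series_ext; [|exact H].
  intros n. cbv beta. rewrite RtoC_mult, Cpow_mult_l. field.
  assert (Hn := INR_S_pos n).
  split; apply Cpow_nz; intros E; apply RtoC_inj in E; lra.
Qed.

Lemma Rcpow_nat (r : R) (n : nat) : 0 < r -> Rcpow r (RtoC (INR n)) = RtoC (r ^ n).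
Proof.
  intros Hr. unfold Rcpow. rewrite <- RtoC_mult, Cexp_RtoC. f_equal.
  rewrite <- Rpower_pow by exact Hr. reflexivity.
Qed.

Lemma Rcpow_opp (r : R) (s : C) : Rcpow r (- s) = (/ Rcpow r s)%C.
Proof. unfold Rcpow. rewrite <- Cexp_opp. f_equal. ring. Qed.

Lemma Lfun_series k chi : (1 <= k)%nat -> (forall n, Cmod (chi n) <= 1) ->
  Cis_series (fun n => chi (Z.of_nat (S n)) / RtoC (INR (S n)) ^ S k)%C (Lfun (RtoC (1 + INR k)) chi).
Proof.
  intros Hk HK.
  assert (E : forall n, (chi (Z.of_nat (S n)) * Rcpow (INR (S n)) (- RtoC (1 + INR k)))%C =
     (chi (Z.of_nat (S n)) / RtoC (INR (S n)) ^ S k)%C).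
  { intros n. unfold Cdiv. f_equal. rewrite Rcpow_opp. f_equal.
    rewrite Rplus_comm, <- S_INR, Rcpow_nat by apply INR_S_pos. apply RtoC_pow. }
  eapply Cis_series_ext; [exact E|]. unfold Lfun.
  apply (Cis_series_dom _ (fun n => / INR (S n) ^ 2)); [|exact ex_series_inv_sq].
  intros n. rewrite E. assert (Hn := INR_S_pos n).
  assert (N : RtoC (INR (S n)) <> 0%C) by (intros X; apply RtoC_inj in X; lra).
  rewrite Cmod_div by (apply Cpow_nz, N). rewrite Cmod_pow, Cmod_R, Rabs_pos_eq by lra.
  rewrite <- (Rmult_1_l (/ INR (S n) ^ 2)). apply Rmult_le_compat; [apply Cmod_ge_0|left; apply Rinv_0_lt_compat, pow_lt, Hn|apply HK|].
  apply Rinv_le_contravar; [apply pow_lt, Hn|]. apply Rle_pow; [|lia]. change 1 with (INR 1). apply le_INR. lia.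
Qed.

Section Transformation.
Variables (k : nat) (q : Z) (chi : Z -> C) (y : R).
Hypotheses (Hk : (2 <= k)%nat) (Hev : Nat.Even k) (Hprim : primitive_char q chi) (Hodd : odd_char chi) (Hy : 0 < y).

Let Hchi : dirichlet_char q chi := proj1 Hprim.
(** Multiplication by [- 2 i pi / (q y)] carries [y m + 2 i pi j] to
    [4 pi^2 j / (q y) - 2 i pi m / q], hence the poles of the first Lipschitz formula to those of
    the twisted one at [beta = 4 pi^2 j / (q y)]. *)
Let rot : C := (- (RtoC (2 * PI) * Ci) / RtoC (IZR q * y))%C.

Lemma Cpow_opp_odd (z : C) : ((- z) ^ S k = - z ^ S k)%C.
Proof.
  destruct Hev as [j Hj]. replace (- z)%C with (RtoC (-1) * z)%C by ring.
  rewrite Cpow_mult_l, <- RtoC_pow. replace ((-1) ^ S k) with (-1); [ring|].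
  rewrite Hj. simpl. rewrite Nat.add_0_r, pow_add, <- Rpow_mult_distr.
  replace (-1 * -1) with 1 by ring. rewrite pow1. ring.
Qed.

(** The twisted formula read from right to left. [freq] at [- m] is minus [rot] times the conjugate
    of the point belonging to [m]; the signs from [chi (- m) = - chi m] and from the odd exponent
    cancel, and the [m = 0] term vanishes with [chi 0]. *)
Lemma character_pole_series j : (0 < j)%nat ->
  (RtoC (INR (fact k)) * CSeries (fun m => chi (Z.of_nat (S m)) * pole_pair y k (S m) j))%C =
  (rot ^ S k * (gauss_sum q chi * CSeries (fun n => RtoC (INR n ^ k) * conj_char chi (Z.of_nat n) *
      RtoC (exp (- (4 * PI ^ 2 / (IZR q * y) * INR j * INR n))))))%C.
Proof.
  intros Hj. assert (Hq := char_pos q chi Hchi). assert (Hq1 := odd_char_modulus q chi Hchi Hodd).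
  assert (HqR : 0 < IZR q) by (apply IZR_lt, Hq). assert (HP := PI_RGT_0).
  assert (HjR : 0 < INR j) by (apply lt_0_INR, Hj).
  set (beta := 4 * PI ^ 2 / (IZR q * y) * INR j).
  assert (Hbeta : 0 < beta).
  { unfold beta. apply Rmult_lt_0_compat; [|exact HjR]. apply Rdiv_lt_0_compat; nra. }
  assert (HqN : INR (Z.to_nat q) = IZR q) by (rewrite INR_IZR_INZ, Z2Nat.id by lia; reflexivity).
  assert (T := twisted_lipschitz (Z.to_nat q) chi 1 beta k ltac:(lia)
    ltac:(intros n; rewrite Z2Nat.id by lia; apply (char_period q chi Hchi))
    (char_Cmod_le_1 q chi Hchi) Hbeta ltac:(lia)).
  assert (C0 : chi 0%Z = 0%C).
  { apply (char_eq_0 q chi Hchi). rewrite Z.gcd_0_l. lia. }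
  rewrite C0 in T.
  assert (Hrot0 : rot <> 0%C).
  { intros E.
    assert (N : RtoC (IZR q * y) <> 0%C) by (intros X; apply RtoC_inj in X; nra).
    assert (X : (- (RtoC (2 * PI) * Ci) = rot * RtoC (IZR q * y))%C) by (unfold rot; field; exact N).
    rewrite E, Cmult_0_l in X. apply (f_equal Im) in X. simpl in X. lra. }
  assert (F1 : forall m, freq (Z.to_nat q) beta (Z.of_nat m) = (rot * (y * INR m, 2 * PI * INR j)%R)%C).
  { intros m. unfold freq, rot, beta. rewrite HqN, <- INR_IZR_INZ.
    unfold Ci, RtoC, Cdiv, Cinv, Cmult, Copp; simpl. f_equal; field; lra. }
  assert (F2 : forall m, freq (Z.to_nat q) beta (- Z.of_nat m) = (- (rot * (y * INR m, - (2 * PI * INR j))%R))%C).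
  { intros m. unfold freq, rot, beta. rewrite HqN, opp_IZR, <- INR_IZR_INZ.
    unfold Ci, RtoC, Cdiv, Cinv, Cmult, Copp; simpl. f_equal; field; lra. }
  assert (L : CSeries (fun m => chi (Z.of_nat (S m)) / freq (Z.to_nat q) beta (Z.of_nat (S m)) ^ S k
      + chi (- Z.of_nat (S m))%Z / freq (Z.to_nat q) beta (- Z.of_nat (S m)) ^ S k)%C =
      CSeries (fun m => / rot ^ S k * (chi (Z.of_nat (S m)) * pole_pair y k (S m) j))%C).
  { f_equal. apply functional_extensionality. intros m.
    rewrite F1, F2. rewrite Cpow_opp_odd, !Cpow_mult_l.
    replace (chi (- Z.of_nat (S m))%Z) with (- chi (Z.of_nat (S m)))%C.
    2:{ replace (- Z.of_nat (S m))%Z with (-1 * Z.of_nat (S m))%Z by lia. rewrite (char_mul q chi Hchi), Hodd. ring. }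
    unfold pole_pair. assert (Hm := INR_S_pos m).
    assert (N1 : (y * INR (S m), 2 * PI * INR j)%R <> RtoC 0) by (apply pair_neq_0; nra).
    assert (N2 : (y * INR (S m), - (2 * PI * INR j))%R <> RtoC 0) by (apply pair_neq_0; nra).
    field. repeat split; apply Cpow_nz; assumption. }
  rewrite L in T. clear L.
  assert (HS : Cis_series (fun m => chi (Z.of_nat (S m)) * pole_pair y k (S m) j)%C
     (CSeries (fun m => chi (Z.of_nat (S m)) * pole_pair y k (S m) j)%C)).
  { destruct (pole_pair_bound y k Hy Hk) as [B [HB HBd]]. destruct j as [|j]; [lia|].
    apply (Cis_series_dom _ (fun m => B * Rpower (INR (S j)) (- (1 + / 2)) * Rpower (INR (S m)) (- (1 + / 2)))).
    - intros m. rewrite Cmod_mult. specialize (HBd m j).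
      assert (A := char_Cmod_le_1 q chi Hchi (Z.of_nat (S m))). assert (A0 := Cmod_ge_0 (chi (Z.of_nat (S m)))).
      assert (A1 := Cmod_ge_0 (pole_pair y k (S m) (S j))). nra.
    - apply (ex_series_scal (B * Rpower (INR (S j)) (- (1 + / 2))) _ (ex_series_Rpower (/ 2) ltac:(lra))). }
  rewrite (Cis_series_unique _ _ (Cis_series_scal (/ rot ^ S k) _ _ HS)) in T.
  assert (EG : forall n, (RtoC (INR n ^ k) * dft (Z.to_nat q) chi n * RtoC (exp (- (beta * INR n))))%C =
     (gauss_sum q chi * (RtoC (INR n ^ k) * conj_char chi (Z.of_nat n) * RtoC (exp (- (beta * INR n)))))%C).
  { intros n. rewrite (gauss_separable q chi Hchi Hprim Hq1). unfold conj_char. ring. }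
  assert (HG : Cis_series (fun n => RtoC (INR n ^ k) * conj_char chi (Z.of_nat n) * RtoC (exp (- (beta * INR n))))%C
     (CSeries (fun n => RtoC (INR n ^ k) * conj_char chi (Z.of_nat n) * RtoC (exp (- (beta * INR n))))%C)).
  { destruct (poly_exp_decay k beta Hbeta) as [D [HD HDn]].
    apply (Cis_series_dom _ (fun n => D * / INR (S n) ^ 2)); [|apply (ex_series_scal D _ ex_series_inv_sq)].
    intros n. eapply Rle_trans; [|apply HDn]. rewrite !Cmod_mult, !Cmod_R. unfold conj_char. rewrite Cmod_conj.
    rewrite (Rabs_pos_eq (exp _)) by (left; apply exp_pos). apply Rmult_le_compat_r; [left; apply exp_pos|].
    rewrite Rabs_pos_eq by (apply pow_le, pos_INR).
    rewrite <- (Rmult_1_r (INR (S n) ^ k)). apply Rmult_le_compat; [apply pow_le, pos_INR|apply Cmod_ge_0| |apply (char_Cmod_le_1 q chi Hchi)].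
    apply pow_incr. split; [apply pos_INR|rewrite S_INR; lra]. }
  assert (HG' := Cis_series_ext _ _ _ (fun n => eq_sym (EG n)) (Cis_series_scal (gauss_sum q chi) _ _ HG)).
  rewrite (Cis_series_unique _ _ HG') in T.
  unfold Cdiv in T. rewrite Cmult_0_l, Cplus_0_l in T. rewrite T. field. apply Cpow_nz, Hrot0.
Qed.

Theorem lambert_transformation :
  let lhs := fun n => (sigmabar_chi k chi (S n) * RtoC (exp (- (y * INR (S n)))))%C in
  let rhs := fun n => (sigma_chi k (conj_char chi) (S n) * RtoC (exp (- (4 * PI ^ 2 / (IZR q * y) * INR (S n)))))%C in
  exists S, Cis_series rhs S /\
   Cis_series lhs (RtoC (INR (fact k)) * Lfun (RtoC (1 + INR k)) chi / RtoC y ^ Datatypes.S k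
                   + rot ^ Datatypes.S k * gauss_sum q chi * S)%C.
Proof.
  intros lhs rhs.
  assert (Hq := char_pos q chi Hchi). assert (HqR : 0 < IZR q) by (apply IZR_lt, Hq). assert (HP := PI_RGT_0).
  assert (Hchi1 := char_Cmod_le_1 q chi Hchi).
  destruct (lambert_rearrangement (fun d => RtoC (INR d ^ k)) (fun j => chi (Z.of_nat j)) 1 1 y k Hk Hy) as [A1 A2].
  { intros d. rewrite Cmod_R, Rabs_pos_eq by (apply pow_le, pos_INR). lra. }
  { intros j. apply Hchi1. }
  set (T := CSeries _) in A1, A2.
  assert (Hbeta : 0 < 4 * PI ^ 2 / (IZR q * y)) by (apply Rdiv_lt_0_compat; nra).
  destruct (lambert_rearrangement (fun d => RtoC (INR d ^ k) * conj_char chi (Z.of_nat d))%C (fun _ => 1%C) 1 1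
     (4 * PI ^ 2 / (IZR q * y)) k Hk Hbeta) as [B1 B2].
  { intros d. rewrite Cmod_mult, Cmod_R, Rabs_pos_eq by (apply pow_le, pos_INR). rewrite Rmult_comm.
    apply Rmult_le_compat_r; [apply pow_le, pos_INR|]. unfold conj_char. rewrite Cmod_conj. apply Hchi1. }
  { intros j. rewrite Cmod_1. lra. }
  set (U := CSeries _) in B1, B2.
  exists U. split.
  { eapply Cis_series_ext; [|exact B2]. intros n. unfold rhs, sigma_chi. f_equal. apply divisor_sum_ext. intros; ring. }
  replace (RtoC (INR (fact k)) * Lfun (RtoC (1 + INR k)) chi / RtoC y ^ S k + rot ^ S k * gauss_sum q chi * U)%C with T.
  { exact A2. }
  destruct (pole_pair_bound y k Hy Hk) as [B [HB HBd]].
  assert (E12 : ex_series (fun m => Rpower (INR (S m)) (- (1 + / 2)))) by (apply ex_series_Rpower; lra).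
  destruct (double_series_swap (fun m j => chi (Z.of_nat (S m)) * pole_pair y k (S m) (S j))%C
     (fun m => B * Rpower (INR (S m)) (- (1 + / 2))) (fun j => Rpower (INR (S j)) (- (1 + / 2)))) as [D1 D2].
  { intros m j. rewrite Cmod_mult. specialize (HBd m j). specialize (Hchi1 (Z.of_nat (S m))).
    assert (A0 := Cmod_ge_0 (chi (Z.of_nat (S m)))).
    assert (A3 := Cmod_ge_0 (pole_pair y k (S m) (S j))). nra. }
  { intros m. apply Rmult_le_pos; [exact HB|left; apply exp_pos]. }
  { apply (ex_series_scal B _ E12). }
  { exact E12. }
  (* [W] is the double sum over [m] and [j]. Summed by rows it completes the Lambert series [T]
     ([E1]); summed by columns it is, up to a factor, the dual series [U] ([E2]). *)
  set (W := CSeries (fun m => CSeries _)) in D1, D2.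
  assert (HL := Lfun_series_scaled k chi y Hy (Lfun_series k chi ltac:(lia) Hchi1)).
  assert (E1 : T = (RtoC (INR (fact k)) * (Lfun (RtoC (1 + INR k)) chi / RtoC y ^ S k + W))%C).
  { apply Cis_series_unique. eapply Cis_series_ext;
      [|apply (Cis_series_scal (RtoC (INR (fact k))) _ _ (Cis_series_plus _ _ _ _ HL D1))].
    intros m. cbv beta. rewrite lipschitz_pole_pair by (assumption || lia).
    replace (CSeries (fun j => chi (Z.of_nat (S m)) * pole_pair y k (S m) (S j))%C)
      with (chi (Z.of_nat (S m)) * CSeries (fun j => pole_pair y k (S m) (S j)))%C; [ring|].
    symmetry. apply Cis_series_unique, Cis_series_scal.
    eapply Cis_series_dom; [apply HBd|]. apply (ex_series_scal _ _ E12). }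
  assert (E2 : (RtoC (INR (fact k)) * W = rot ^ S k * gauss_sum q chi * U)%C).
  { rewrite <- (Cis_series_unique _ _ (Cis_series_scal (RtoC (INR (fact k))) _ _ D2)).
    apply Cis_series_unique.
    eapply Cis_series_ext; [|apply (Cis_series_scal (rot ^ S k * gauss_sum q chi) _ _ B1)].
    intros j. cbv beta. rewrite character_pole_series by lia. ring. }
  rewrite E1, Cmult_plus_distr_l, E2. unfold Cdiv. ring.
Qed.
End Transformation.

(** * Integrals over the half-line *)

Notation is_RInt_0oo f l := (is_RInt_gen f (at_right 0) (Rbar_locally p_infty) l).

Lemma norm_Cmod (z : C) : @norm R_AbsRing C_R_NormedModule z = Cmod z.
Proof.
  change (sqrt (Rabs (fst z) ^ 2 + Rabs (snd z) ^ 2) = Cmod z). rewrite !pow2_abs. reflexivity.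
Qed.

Lemma at_right_0_pos (P : R -> Prop) : at_right 0 P -> at_right 0 (fun x => 0 < x /\ P x).
Proof.
  intros [e H]. exists e. intros x Hx Hp. split; [exact Hp|apply H; assumption].
Qed.

Lemma filter_prod_0oo_pos :
  filter_prod (at_right 0) (Rbar_locally p_infty) (fun ab : R * R => 0 < fst ab /\ fst ab <= snd ab).
Proof.
  apply (Filter_prod _ _ _ (fun a => 0 < a < 1) (fun b => 1 < b)).
  - exists (mkposreal 1 Rlt_0_1). intros x Hx Hp. split; [exact Hp|].
    change (Rabs (x - 0) < 1) in Hx. apply Rabs_def2 in Hx. lra.
  - exists 1. auto.
  - intros a b Ha Hb. simpl. lra.
Qed.

Lemma is_RInt_0oo_primitive {V : CompleteNormedModule R_AbsRing} (Psi psi : R -> V) (l0 l1 : V) :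
  (forall t, 0 < t -> is_derive Psi t (psi t)) -> (forall t, 0 < t -> continuous psi t) ->
  filterlim Psi (at_right 0) (locally l0) -> filterlim Psi (Rbar_locally p_infty) (locally l1) ->
  is_RInt_0oo psi (minus l1 l0).
Proof.
  intros Hd Hc H0 H1 P HP.
  assert (HF : filterlim (fun ab : R * R => minus (Psi (snd ab)) (Psi (fst ab)))
     (filter_prod (at_right 0) (Rbar_locally p_infty)) (locally (minus l1 l0))).
  { unfold minus. eapply filterlim_comp_2; [| |apply (@filterlim_plus R_AbsRing V l1 (opp l0))].
    - eapply filterlim_comp; [apply filterlim_snd|exact H1].
    - eapply filterlim_comp; [eapply filterlim_comp; [apply filterlim_fst|exact H0]|]. apply (@filterlim_opp R_AbsRing V l0). }
  specialize (HF P HP). unfold filtermap in HF. unfold filtermapi.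
  generalize (filter_and _ _ filter_prod_0oo_pos HF). apply filter_imp.
  intros [a b] [[Ha Hab] HPab]; simpl in *. eexists. split; [|exact HPab].
  apply is_RInt_derive; rewrite Rmin_left, Rmax_right by lra; intros t Ht; [apply Hd|apply Hc]; lra.
Qed.

Lemma is_RInt_primitive_pos {V : CompleteNormedModule R_AbsRing} (f : R -> V) :
  (forall t, 0 < t -> continuous f t) ->
  forall a b, 0 < a -> 0 < b -> is_RInt f a b (RInt f a b).
Proof.
  intros Hc a b Ha Hb. apply (RInt_correct f). apply ex_RInt_continuous. intros t Ht. apply Hc.
  assert (0 < Rmin a b) by (apply Rmin_glb_lt; assumption). lra.
Qed.

Lemma is_derive_RInt_pos {V : CompleteNormedModule R_AbsRing} (f : R -> V) :
  (forall t, 0 < t -> continuous f t) ->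
  forall a t, 0 < a -> 0 < t -> is_derive (fun x => RInt f a x) t (f t).
Proof.
  intros Hc a t Ha Ht. apply (is_derive_RInt f _ a t); [|apply Hc, Ht].
  exists (mkposreal t Ht). intros x Hx. apply is_RInt_primitive_pos; auto.
  change (Rabs (x - t) < t) in Hx. apply Rabs_def2 in Hx. lra.
Qed.

Lemma minus_plus_l {G : AbelianGroup} (x y : G) : minus (plus x y) x = y.
Proof.
  unfold minus. rewrite (plus_comm x y), <- plus_assoc.
  transitivity (plus y zero); [apply f_equal, plus_opp_r|apply plus_zero_r].
Qed.

Section Dominated.
Context {V : CompleteNormedModule R_AbsRing}.
Variables (f : R -> V) (g G : R -> R) (l0 l1 : R).
Hypotheses (Hc : forall t, 0 < t -> continuous f t)
  (HG : forall t, 0 < t -> is_derive G t (g t)) (Hg : forall t, 0 < t -> continuous g t)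
  (HG0 : filterlim G (at_right 0) (locally l0)) (HG1 : filterlim G (Rbar_locally p_infty) (locally l1))
  (Hfg : forall t, 0 < t -> norm (f t) <= g t).

Lemma norm_RInt_dominated a b : 0 < a -> 0 < b -> norm (RInt f a b) <= Rabs (G b - G a).
Proof.
  assert (W : forall a b, 0 < a -> a <= b -> norm (RInt f a b) <= Rabs (G b - G a)).
  { intros a' b' Ha Hab. eapply Rle_trans; [|apply Rle_abs].
    apply (norm_RInt_le f g a' b'); [exact Hab| | |].
    - intros t Ht. apply Hfg. lra.
    - apply is_RInt_primitive_pos; auto; lra.
    - apply (is_RInt_derive G g); rewrite Rmin_left, Rmax_right by lra; intros t Ht; [apply HG|apply Hg]; lra. }
  intros Ha Hb. destruct (Rle_dec a b) as [H|H]; [apply W; assumption|].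
  rewrite <- opp_RInt_swap by (exists (RInt f b a); apply is_RInt_primitive_pos; auto).
  rewrite (norm_opp (K := R_AbsRing) (V := V)), Rabs_minus_sym. apply W; lra.
Qed.

(** By [norm_RInt_dominated] the increments of the primitive of [f] are at most those of [G], so the
    Cauchy property passes from [G] to it and completeness of [V] gives the limit. The filter is
    abstract so as to serve both ends of the half-line. *)
Lemma primitive_cauchy_lim (F : (R -> Prop) -> Prop) (FF : ProperFilter F) l :
  F (fun t => 0 < t) -> filterlim G F (locally l) ->
  exists v : V, filterlim (fun x => RInt f 1 x) F (locally v).
Proof.
  intros Hpos Hl. apply (filterlim_locally_cauchy (U := V)). intros eps.
  assert (He : 0 < eps / 2) by (destruct eps; simpl; lra).
  exists (fun t => 0 < t /\ ball l (mkposreal _ He) (G t)). split.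
  - apply filter_and; [exact Hpos|]. apply (proj1 (filterlim_locally G l) Hl).
  - intros u v [Hu Bu] [Hv Bv]. apply (@norm_compat1 R_AbsRing V).
    assert (E : minus (RInt f 1 v) (RInt f 1 u) = RInt f u v).
    { rewrite <- (RInt_Chasles f 1 u v);
        [|exists (RInt f 1 u); apply is_RInt_primitive_pos; auto; lra
         |exists (RInt f u v); apply is_RInt_primitive_pos; auto; lra].
      apply (minus_plus_l (G := CompleteNormedModule.AbelianGroup R_AbsRing V)). }
    refine (Rle_lt_trans _ _ _ (Req_le _ _ (f_equal (fun z : V => norm z) E)) _).
    eapply Rle_lt_trans; [apply norm_RInt_dominated; assumption|].
    change (Rabs (G u - l) < eps / 2) in Bu. change (Rabs (G v - l) < eps / 2) in Bv.
    replace (G v - G u) with ((G v - l) - (G u - l)) by ring.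
    eapply Rle_lt_trans; [apply Rabs_triang|]. rewrite Rabs_Ropp. lra.
Qed.

Lemma ex_RInt_0oo_dominated : exists l, is_RInt_0oo f l.
Proof.
  destruct (primitive_cauchy_lim (at_right 0) _ l0) as [v0 H0].
  { exists (mkposreal 1 Rlt_0_1). auto. }
  { exact HG0. }
  destruct (primitive_cauchy_lim (Rbar_locally p_infty) _ l1) as [v1 H1].
  { exists 0. auto. }
  { exact HG1. }
  exists (minus v1 v0). apply (is_RInt_0oo_primitive (fun x => RInt f 1 x)); auto.
  intros t Ht. apply is_derive_RInt_pos; auto. lra.
Qed.

Lemma is_RInt_0oo_majorant : is_RInt_0oo g (l1 - l0).
Proof. apply (is_RInt_0oo_primitive (V := R_CompleteNormedModule) G g l0 l1); assumption. Qed.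
End Dominated.

(* [t^(s-1) / (1+t)^(s+1)], which dominates [t^(s-1) exp (-t)] and has the explicit
   primitive [(t / (1+t))^s / s]. *)
Definition beta_kernel (s t : R) : R := Rpower t (s - 1) * Rpower (1 + t) (- (s + 1)).
Definition beta_kernel_primitive (s t : R) : R := exp (s * (ln t - ln (1 + t))) / s.

Lemma beta_kernel_derive s t : 0 < s -> 0 < t -> is_derive (beta_kernel_primitive s) t (beta_kernel s t).
Proof.
  intros Hs Ht. unfold beta_kernel_primitive, beta_kernel.
  assert (E : Rpower t (s - 1) * Rpower (1 + t) (- (s + 1)) =
     exp (s * (ln t - ln (1 + t))) * (/ t - / (1 + t))).
  { unfold Rpower. rewrite <- exp_plus.
    replace ((s - 1) * ln t + - (s + 1) * ln (1 + t)) with (s * (ln t - ln (1 + t)) + (- ln t + - ln (1 + t))) by ring.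
    rewrite exp_plus. f_equal. rewrite exp_plus, !exp_Ropp, !exp_ln by lra. field. lra. }
  rewrite E. auto_derive; [lra|]. unfold Rminus. field. lra.
Qed.

Lemma beta_kernel_continuous s t : 0 < t -> continuous (beta_kernel s) t.
Proof.
  intros Ht. unfold beta_kernel, Rpower. apply (ex_derive_continuous (V := R_NormedModule)).
  auto_derive. lra.
Qed.

Lemma beta_kernel_primitive_0 s : 0 < s -> filterlim (beta_kernel_primitive s) (at_right 0) (locally 0).
Proof.
  intros Hs. unfold beta_kernel_primitive.
  assert (H : filterlim (fun t => s * (ln t - ln (1 + t))) (at_right 0) (Rbar_locally m_infty)).
  { intros P [M HM].
    assert (L := is_lim_ln_0 (fun x => x < M / s) (ex_intro _ (M / s) (fun _ h => h))).
    apply at_right_0_pos in L. unfold filtermap in *. eapply filter_imp; [|exact L].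
    intros x [Hx Hl]. apply HM.
    assert (0 < ln (1 + x)) by (rewrite <- ln_1; apply ln_increasing; lra).
    replace M with (s * (M / s)) by (field; lra). apply Rmult_lt_compat_l; lra. }
  assert (Cs : continuous (fun x => x / s) 0).
  { apply (ex_derive_continuous (V := R_NormedModule)). auto_derive. exact I. }
  unfold continuous in Cs. replace (0 / s) with 0 in Cs by (unfold Rdiv; ring).
  apply (filterlim_comp _ _ _ (fun t => exp (s * (ln t - ln (1 + t)))) (fun x => x / s) _ (locally 0) _); [|exact Cs].
  eapply filterlim_comp; [exact H|exact is_lim_exp_m].
Qed.

Lemma beta_kernel_primitive_oo s : 0 < s -> filterlim (beta_kernel_primitive s) (Rbar_locally p_infty) (locally (/ s)).
Proof.
  intros Hs.
  assert (H : is_lim (fun t => ln t - ln (1 + t)) p_infty 0).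
  { apply (is_lim_le_le_loc (fun t => - / t) (fun _ => 0)).
    - exists 0. intros t Ht.
      assert (E : ln (1 + t) - ln t = ln (1 + / t)).
      { replace (1 + / t) with ((1 + t) * / t) by (field; lra).
        rewrite ln_mult, ln_Rinv by (try apply Rinv_0_lt_compat; lra). ring. }
      assert (I : 0 < / t) by (apply Rinv_0_lt_compat, Ht).
      assert (L0 : 0 < ln (1 + / t)) by (rewrite <- ln_1; apply ln_increasing; lra).
      assert (L1 : ln (1 + / t) <= / t).
      { rewrite <- (ln_exp (/ t)) at 2. apply ln_le; [lra|apply exp_ineq1_le]. }
      lra.
    - replace (Finite 0) with (Rbar_opp (Finite 0)) by (simpl; f_equal; ring). apply is_lim_opp.
      apply (is_lim_inv (fun t => t) p_infty p_infty); [apply is_lim_id|discriminate].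
    - apply is_lim_const. }
  replace (/ s) with (exp (s * 0) / s) by (rewrite Rmult_0_r, exp_0; field; lra).
  unfold beta_kernel_primitive.
  apply (filterlim_comp _ _ _ (fun t => ln t - ln (1 + t)) (fun u => exp (s * u) / s) _ (locally 0) _ H).
  apply (ex_derive_continuous (V := R_NormedModule) (fun u => exp (s * u) / s)). auto_derive. exact I.
Qed.

Notation is_CInt f l := (@is_RInt_gen C_R_NormedModule f (at_right 0) (Rbar_locally p_infty) l).

Lemma is_CInt_Re_Im (f : R -> C) (l : C) :
  is_CInt f l <-> is_RInt_0oo (fun t => Re (f t)) (Re l) /\ is_RInt_0oo (fun t => Im (f t)) (Im l).
Proof.
  split.
  - intros H. split; intros P [e HP].
    + specialize (H (fun z : C => P (Re z))). unfold filtermapi in *.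
      eapply filter_imp; [|apply H].
      * intros [a b] [y [Hy Py]]. exists (Re y). split; [|exact Py].
        apply (is_RInt_fct_extend_fst (U := R_NormedModule) (V := R_NormedModule) f a b y Hy).
      * exists e. intros y [B1 _]. apply HP, B1.
    + specialize (H (fun z : C => P (Im z))). unfold filtermapi in *.
      eapply filter_imp; [|apply H].
      * intros [a b] [y [Hy Py]]. exists (Im y). split; [|exact Py].
        apply (is_RInt_fct_extend_snd (U := R_NormedModule) (V := R_NormedModule) f a b y Hy).
      * exists e. intros y [_ B2]. apply HP, B2.
  - intros [H1 H2] P [e HP]. unfold filtermapi.
    specialize (H1 (ball (Re l) e) (locally_ball _ _)). specialize (H2 (ball (Im l) e) (locally_ball _ _)).
    unfold filtermapi in H1, H2. generalize (filter_and _ _ H1 H2). apply filter_imp.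
    intros [a b] [[y1 [I1 B1]] [y2 [I2 B2]]]. exists (y1, y2). split.
    + apply (is_RInt_fct_extend_pair (U := R_NormedModule) (V := R_NormedModule) f a b y1 y2); assumption.
    + apply HP. split; assumption.
Qed.

Lemma is_CInt_ext (f g : R -> C) l : (forall t, 0 < t -> f t = g t) -> is_CInt f l -> is_CInt g l.
Proof.
  intros H. apply is_RInt_gen_ext. eapply filter_imp; [|apply filter_prod_0oo_pos].
  intros [a b] [Ha Hab] t Ht; simpl in *. rewrite Rmin_left in Ht by lra. apply H. lra.
Qed.

Lemma is_CInt_minus (f g : R -> C) (lf lg : C) :
  is_CInt f lf -> is_CInt g lg -> is_CInt (fun t => f t - g t)%C (lf - lg)%C.
Proof. apply (is_RInt_gen_minus (V := C_R_NormedModule)). Qed.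

Lemma is_CInt_scal (c : C) (f : R -> C) (l : C) : is_CInt f l -> is_CInt (fun t => c * f t)%C (c * l)%C.
Proof.
  rewrite !is_CInt_Re_Im. intros [A B]. destruct c as [c1 c2]. split.
  - apply (is_RInt_gen_minus (V := R_NormedModule) (fun t => c1 * Re (f t)) (fun t => c2 * Im (f t)) (c1 * Re l) (c2 * Im l));
    apply (is_RInt_gen_scal (V := R_NormedModule)); assumption.
  - apply (is_RInt_gen_plus (V := R_NormedModule) (fun t => c1 * Im (f t)) (fun t => c2 * Re (f t)) (c1 * Im l) (c2 * Re l));
    apply (is_RInt_gen_scal (V := R_NormedModule)); assumption.
Qed.

Lemma is_CInt_norm_le (f : R -> C) (g : R -> R) (lf : C) (lg : R) :
  (forall t, 0 < t -> Cmod (f t) <= g t) -> is_CInt f lf -> is_RInt_0oo g lg -> Cmod lf <= lg.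
Proof.
  intros H Hf Hg. rewrite <- norm_Cmod.
  apply (RInt_gen_norm (V := C_R_CompleteNormedModule) (Fa := at_right 0) (Fb := Rbar_locally p_infty) f g lf lg); try assumption.
  - eapply filter_imp; [|apply filter_prod_0oo_pos]. intros ab [_ H']; exact H'.
  - eapply filter_imp; [|apply filter_prod_0oo_pos]. intros ab [H0 _] x Hx.
    rewrite norm_Cmod. apply H. lra.
Qed.

Lemma Cis_series_drop (a : nat -> C) (l : C) N :
  Cis_series a l -> Cis_series (fun n => a (N + n)%nat) (l - Csum a N)%C.
Proof.
  rewrite !Cis_series_clim. intros H.
  apply clim_ext with (fun n => Csum a (N + n) + - Csum a N)%C.
  - intros n. rewrite Csum_add. ring.
  - apply clim_plus; [|apply clim_const]. apply (clim_subseq (Csum a) (fun n => (N + n)%nat)); [|exact H].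
    intros P [M HM]. exists M. intros n Hn. apply HM. lia.
Qed.

(** What remains after [N] terms has integral [J - Csum I N] by linearity, and is bounded pointwise
    by the tail of [M] times [g]; integrating this bound gives the limit. *)
Lemma integral_series_exchange (u : nat -> R -> C) (U : R -> C) (I : nat -> C) (J : C)
  (M : nat -> R) (g : R -> R) (lg : R) :
  (forall n, is_CInt (u n) (I n)) -> is_CInt U J -> is_RInt_0oo g lg ->
  (forall n t, 0 < t -> Cmod (u n t) <= M n * g t) -> ex_series M ->
  (forall t, 0 < t -> Cis_series (fun n => u n t) (U t)) ->
  Cis_series I J.
Proof.
  intros HI HJ Hg Hdom HM Hsum. apply Cis_series_clim.
  assert (HD : forall N, is_CInt (fun t => U t - Csum (fun n => u n t) N)%C (J - Csum I N)%C).
  { induction N as [|N IH].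
    - replace (J - Csum I 0)%C with J by (simpl; ring). eapply is_CInt_ext; [|exact HJ]. intros t _. simpl. ring.
    - replace (J - Csum I (S N))%C with ((J - Csum I N) - I N)%C by (simpl; ring).
      eapply is_CInt_ext; [|apply (is_CInt_minus _ _ _ _ IH (HI N))]. intros t _. simpl. ring. }
  assert (HB : forall N, Cmod (J - Csum I N) <= Series (fun n => M (N + n)%nat) * lg).
  { intros N. apply (is_CInt_norm_le _ (fun t => Series (fun n => M (N + n)%nat) * g t) _ _) with (2 := HD N).
    - intros t Ht. rewrite <- (Cis_series_unique _ _ (Cis_series_drop _ _ N (Hsum t Ht))).
      rewrite <- Series_scal_r. apply Cmod_CSeries_le; [intros n; apply Hdom, Ht|].
      apply (ex_series_scal_r (g t)). apply (ex_series_incr_n M N), HM.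
    - apply (is_RInt_gen_scal (V := R_NormedModule)), Hg. }
  assert (Z : clim (fun N => J - Csum I N)%C 0).
  { apply (clim_0_dom _ _ HB). assert (T := Series_tail_small M HM).
    apply (is_lim_seq_scal_r _ lg) in T. simpl in T. rewrite Rmult_0_l in T. exact T. }
  apply clim_ext with (fun N => J + - (1) * (J - Csum I N))%C; [intros; ring|].
  assert (X := clim_plus _ _ _ _ (clim_const J) (clim_mult _ _ _ _ (clim_const (- (1))) Z)).
  replace (J + - (1) * 0)%C with J in X by ring. exact X.
Qed.

Lemma is_CInt_rescale (f : R -> C) (l : C) (c : R) : 0 < c -> is_CInt f l ->
  is_CInt (fun t => RtoC c * f (c * t)%R)%C l.
Proof.
  intros Hc H. apply (is_RInt_gen_ext (V := C_R_NormedModule) (fun t => scal c (f (c * t + 0)))).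
  { apply filter_forall. intros ab t _. rewrite Rplus_0_r.
    unfold scal; simpl. unfold prod_scal, scal; simpl. unfold mult; simpl.
    destruct (f (c * t)) as [f1 f2]. unfold Cmult, RtoC; simpl. f_equal; ring. }
  intros P HP. specialize (H P HP). unfold filtermapi in *. destruct H as [Q1 Q2 HQ1 HQ2 HQ].
  apply (Filter_prod _ _ _ (fun a => Q1 (c * a)) (fun b => Q2 (c * b))).
  - destruct HQ1 as [e He]. assert (He' : 0 < e / c) by (apply Rdiv_lt_0_compat; [apply e|exact Hc]).
    exists (mkposreal _ He'). intros x Hx Hx0. apply He; [|nra].
    change (Rabs (x - 0) < e / c) in Hx. change (Rabs (c * x - 0) < e).
    rewrite Rminus_0_r in *. rewrite Rabs_mult, (Rabs_pos_eq c) by lra.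
    apply (Rmult_lt_compat_l c) in Hx; [|exact Hc]. replace (c * (e / c)) with (pos e) in Hx by (field; lra). exact Hx.
  - destruct HQ2 as [M HM]. exists (M / c). intros x Hx. apply HM.
    apply (Rmult_lt_compat_l c) in Hx; [|exact Hc]. replace (c * (M / c)) with M in Hx by (field; lra). exact Hx.
  - intros a b Ha Hb. destruct (HQ _ _ Ha Hb) as [y [Hy Py]]. exists y. split; [|exact Py].
    apply (is_RInt_comp_lin (V := C_R_NormedModule) f c 0 a b y). simpl. rewrite !Rplus_0_r. exact Hy.
Qed.

(** * Complex powers and the Gamma integral *)

Lemma Rcpow_add (r : R) (s w : C) : Rcpow r (s + w) = (Rcpow r s * Rcpow r w)%C.
Proof. unfold Rcpow. rewrite <- Cexp_add. f_equal. ring. Qed.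

Lemma Rcpow_mult (r1 r2 : R) (s : C) : 0 < r1 -> 0 < r2 -> Rcpow (r1 * r2) s = (Rcpow r1 s * Rcpow r2 s)%C.
Proof.
  intros H1 H2. unfold Rcpow. rewrite <- Cexp_add, ln_mult by assumption. f_equal. rewrite RtoC_plus. ring.
Qed.

Lemma Rcpow_neq_0 r s : Rcpow r s <> 0%C.
Proof. apply Cexp_neq_0. Qed.

Lemma Rcpow_1 r : 0 < r -> Rcpow r 1 = RtoC r.
Proof. intros H. unfold Rcpow. rewrite Cmult_1_l, Cexp_RtoC, exp_ln by exact H. reflexivity. Qed.

Lemma Cmod_Rcpow r s : Cmod (Rcpow r s) = Rpower r (Re s).
Proof.
  unfold Rcpow. rewrite Cmod_Cexp. unfold Rpower. f_equal. destruct s as [s1 s2]. simpl. ring.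
Qed.

Lemma continuous_C (f : R -> C) t :
  continuous (fun x => Re (f x)) t -> continuous (fun x => Im (f x)) t ->
  @continuous R_UniformSpace C_R_CompleteNormedModule f t.
Proof.
  intros H1 H2. unfold continuous. apply (filterlim_C_iff (locally t) f (f t)). split; assumption.
Qed.

Lemma continuous_Rcpow_mul (s : C) (phi : R -> R) t : 0 < t -> continuous phi t ->
  @continuous R_UniformSpace C_R_CompleteNormedModule (fun x => Rcpow x s * RtoC (phi x))%C t.
Proof.
  intros Ht Hphi. destruct s as [s1 s2].
  assert (D1 : continuous (fun x => exp (s1 * ln x) * cos (s2 * ln x)) t).
  { apply (ex_derive_continuous (V := R_NormedModule)). auto_derive. auto. }
  assert (D2 : continuous (fun x => exp (s1 * ln x) * sin (s2 * ln x)) t).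
  { apply (ex_derive_continuous (V := R_NormedModule)). auto_derive. auto. }
  apply continuous_C.
  - eapply continuous_ext; [|apply (continuous_mult (K := R_AbsRing) _ _ _ D1 Hphi)].
    intros x. unfold Rcpow, Cexp, RtoC, Cmult, mult; simpl.
    replace (s1 * ln x - s2 * 0) with (s1 * ln x) by ring. replace (s1 * 0 + s2 * ln x) with (s2 * ln x) by ring. ring.
  - eapply continuous_ext; [|apply (continuous_mult (K := R_AbsRing) _ _ _ D2 Hphi)].
    intros x. unfold Rcpow, Cexp, RtoC, Cmult, mult; simpl.
    replace (s1 * ln x - s2 * 0) with (s1 * ln x) by ring. replace (s1 * 0 + s2 * ln x) with (s2 * ln x) by ring. ring.
Qed.

Lemma Rpower_exp_beta_kernel (s : R) : 0 < s -> exists K, 0 < K /\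
  forall t, 0 < t -> Rpower t (s - 1) * exp (- t) <= K * beta_kernel s t.
Proof.
  (* The first factor bounds [v^(s+1) exp (- v)] at [v = 1 + t]; [exp 1] undoes the shift from [t]
     to [1 + t]. *)
  intros Hs. exists (exp ((s + 1) * ln (s + 1)) * exp 1). split; [apply Rmult_lt_0_compat; apply exp_pos|].
  intros t Ht. assert (H := Rpower_exp_bound (s + 1) (1 + t) ltac:(lra) ltac:(lra)).
  unfold beta_kernel. rewrite Rpower_Ropp.
  assert (P : 0 < Rpower (1 + t) (s + 1)) by apply exp_pos.
  assert (P' : 0 < Rpower t (s - 1)) by apply exp_pos.
  replace (exp (- t)) with (exp (- (1 + t)) * exp 1) by (rewrite <- exp_plus; f_equal; ring).
  replace (exp ((s + 1) * ln (s + 1)) * exp 1 * (Rpower t (s - 1) * / Rpower (1 + t) (s + 1)))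
    with (Rpower t (s - 1) * (exp ((s + 1) * ln (s + 1)) * / Rpower (1 + t) (s + 1) * exp 1)) by ring.
  apply Rmult_le_compat_l; [lra|]. apply Rmult_le_compat_r; [left; apply exp_pos|].
  apply (Rmult_le_reg_l (Rpower (1 + t) (s + 1))); [exact P|].
  replace (Rpower (1 + t) (s + 1) * (exp ((s + 1) * ln (s + 1)) * / Rpower (1 + t) (s + 1)))
    with (exp ((s + 1) * ln (s + 1))) by (field; lra). exact H.
Qed.

Lemma is_RInt_beta_kernel s : 0 < s -> is_RInt_0oo (beta_kernel s) (/ s - 0).
Proof.
  intros Hs. apply (is_RInt_0oo_majorant (beta_kernel s) (beta_kernel_primitive s) 0 (/ s)).
  - intros t Ht. apply beta_kernel_derive; assumption.
  - intros t Ht. apply beta_kernel_continuous, Ht.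
  - apply beta_kernel_primitive_0, Hs.
  - apply beta_kernel_primitive_oo, Hs.
Qed.

Lemma ex_CInt_beta_kernel (f : R -> C) s K : 0 < s ->
  (forall t, 0 < t -> @continuous R_UniformSpace C_R_CompleteNormedModule f t) ->
  (forall t, 0 < t -> Cmod (f t) <= K * beta_kernel s t) -> exists l : C, is_CInt f l.
Proof.
  intros Hs Hc Hb.
  apply (ex_RInt_0oo_dominated (V := C_R_CompleteNormedModule) f (fun t => K * beta_kernel s t)
    (fun t => K * beta_kernel_primitive s t) (K * 0) (K * / s)); auto.
  - intros t Ht. apply (is_derive_scal (beta_kernel_primitive s)), beta_kernel_derive; assumption.
  - intros t Ht. apply (continuous_mult (K := R_AbsRing) (fun _ => K) (beta_kernel s)); [apply continuous_const|apply beta_kernel_continuous, Ht].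
  - eapply filterlim_comp; [apply beta_kernel_primitive_0, Hs|].
    apply (continuous_mult (K := R_AbsRing) (fun _ => K) (fun x => x)); [apply continuous_const|apply continuous_id].
  - eapply filterlim_comp; [apply beta_kernel_primitive_oo, Hs|].
    apply (continuous_mult (K := R_AbsRing) (fun _ => K) (fun x => x)); [apply continuous_const|apply continuous_id].
  - intros t Ht. rewrite norm_Cmod. apply Hb, Ht.
Qed.

Lemma is_CInt_unique (f : R -> C) l :
  is_CInt f l -> @RInt_gen C_R_CompleteNormedModule f (at_right 0) (Rbar_locally p_infty) = l.
Proof. intros H. apply (is_RInt_gen_unique (V := C_R_CompleteNormedModule)). exact H. Qed.

(** Convergence comes first, from the beta kernel: [CGamma] is built on a total operator and equals
    the integral only once the integral is known to exist. *)
Lemma is_CInt_Gamma (s : C) : 0 < Re s ->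
  is_CInt (fun t => Rcpow t (s - 1) * RtoC (exp (- t)))%C (CGamma s).
Proof.
  intros Hs. destruct (Rpower_exp_beta_kernel (Re s) Hs) as [K [HK HKt]].
  destruct (ex_CInt_beta_kernel (fun t => Rcpow t (s - 1) * RtoC (exp (- t)))%C (Re s) K Hs) as [l Hl].
  - intros t Ht. apply continuous_Rcpow_mul; [exact Ht|].
    apply (ex_derive_continuous (V := R_NormedModule)). auto_derive. exact I.
  - intros t Ht. rewrite Cmod_mult, Cmod_Rcpow, Cmod_R, Rabs_pos_eq by (left; apply exp_pos).
    replace (Re (s - 1)) with (Re s - 1) by (destruct s; simpl; ring). apply HKt, Ht.
  - unfold CGamma. rewrite (is_CInt_unique _ _ Hl). exact Hl.
Qed.

Lemma is_CInt_Gamma_scaled (s : C) (c : R) : 0 < Re s -> 0 < c ->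
  is_CInt (fun t => Rcpow t (s - 1) * RtoC (exp (- (c * t))))%C (CGamma s / Rcpow c s)%C.
Proof.
  intros Hs Hc. assert (H := is_CInt_scal (/ Rcpow c s) _ _ (is_CInt_rescale _ _ c Hc (is_CInt_Gamma s Hs))).
  unfold Cdiv. rewrite Cmult_comm. eapply is_CInt_ext; [|exact H].
  intros t Ht. cbv beta. rewrite Rcpow_mult by assumption.
  assert (E : Rcpow c s = (RtoC c * Rcpow c (s - 1))%C).
  { rewrite <- (Rcpow_1 c Hc), <- Rcpow_add. f_equal. ring. }
  assert (N := Rcpow_neq_0 c s). rewrite E in *. field.
  split; [apply Rcpow_neq_0|]. intros X; apply RtoC_inj in X; lra.
Qed.

(** * The Bessel function *)

Section BesselIntegral.
Variables (nu : C) (z : R).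
Hypotheses (Hnu : 0 < Re nu) (Hz : 0 < z).

Let h (t : R) : C := (Rcpow t (nu - 1) * RtoC (exp (- (t + z ^ 2 / (4 * t)))))%C.

Lemma bessel_integrand_continuous t : 0 < t -> @continuous R_UniformSpace C_R_CompleteNormedModule h t.
Proof.
  intros Ht. apply continuous_Rcpow_mul; [exact Ht|].
  apply (ex_derive_continuous (V := R_NormedModule)). auto_derive. lra.
Qed.

Lemma ex_bessel_integral : exists H : C, is_CInt h H.
Proof.
  destruct (Rpower_exp_beta_kernel (Re nu) Hnu) as [K [HK HKt]].
  apply (ex_CInt_beta_kernel h (Re nu) K Hnu).
  - exact bessel_integrand_continuous.
  - intros t Ht. unfold h. rewrite Cmod_mult, Cmod_Rcpow, Cmod_R, Rabs_pos_eq by (left; apply exp_pos).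
    replace (Re (nu - 1)) with (Re nu - 1) by (destruct nu; simpl; ring).
    eapply Rle_trans; [|apply HKt, Ht]. apply Rmult_le_compat_l; [left; apply exp_pos|].
    assert (0 < z ^ 2 / (4 * t)) by (apply Rdiv_lt_0_compat; nra).
    left. apply exp_increasing. lra.
Qed.

Let lo (u : R) : R := z / 2 * exp (- u).
Let hi (u : R) : R := z / 2 * exp u.
Let Phi (u : R) : C := @RInt C_R_CompleteNormedModule h (lo u) (hi u).
Let phi (u : R) : C := @minus C_R_CompleteNormedModule (@scal _ C_R_CompleteNormedModule (hi u) (h (hi u)))
  (@scal _ C_R_CompleteNormedModule (- lo u) (h (lo u))).

Lemma lo_pos u : 0 < lo u.
Proof. unfold lo. apply Rmult_lt_0_compat; [lra|apply exp_pos]. Qed.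
Lemma hi_pos u : 0 < hi u.
Proof. unfold hi. apply Rmult_lt_0_compat; [lra|apply exp_pos]. Qed.

(* The substitutions [t = (z/2) exp (u)] and [t = (z/2) exp (-u)] are done at once by
   differentiating the integral of [h] over [[(z/2) exp (-u), (z/2) exp u]]. *)
Lemma is_derive_Phi u : @is_derive R_AbsRing C_R_CompleteNormedModule Phi u (phi u).
Proof.
  apply (is_derive_RInt_bound_comp (V := C_R_CompleteNormedModule) h
     (fun a b => @RInt C_R_CompleteNormedModule h a b) lo hi (- lo u) (hi u) u).
  - assert (L := lo_pos u). assert (H := hi_pos u).
    assert (Hm : 0 < Rmin (lo u) (hi u)) by (apply Rmin_glb_lt; assumption).
    exists (mkposreal _ Hm). intros [a b] [Ba Bb]; simpl.
    change (Rabs (a - lo u) < Rmin (lo u) (hi u)) in Ba. change (Rabs (b - hi u) < Rmin (lo u) (hi u)) in Bb.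
    assert (M1 := Rmin_l (lo u) (hi u)). assert (M2 := Rmin_r (lo u) (hi u)).
    apply Rabs_def2 in Ba. apply Rabs_def2 in Bb.
    apply (is_RInt_primitive_pos (V := C_R_CompleteNormedModule) h); [exact bessel_integrand_continuous|lra|lra].
  - apply bessel_integrand_continuous, lo_pos.
  - apply bessel_integrand_continuous, hi_pos.
  - unfold lo. auto_derive; [exact I|ring].
  - unfold hi. auto_derive; [exact I|ring].
Qed.

Lemma continuous_phi u : @continuous R_UniformSpace C_R_CompleteNormedModule phi u.
Proof.
  assert (C1 : continuous hi u).
  { apply (ex_derive_continuous (V := R_NormedModule)). unfold hi. auto_derive. exact I. }
  assert (C2 : continuous lo u).
  { apply (ex_derive_continuous (V := R_NormedModule)). unfold lo. auto_derive. exact I. }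
  apply (continuous_minus (K := R_AbsRing) (V := C_R_CompleteNormedModule)).
  - apply (continuous_scal (K := R_AbsRing) (V := C_R_CompleteNormedModule) hi (fun u => h (hi u))); [exact C1|].
    apply (continuous_comp hi h); [exact C1|apply bessel_integrand_continuous, hi_pos].
  - apply (continuous_scal (K := R_AbsRing) (V := C_R_CompleteNormedModule) (fun u => - lo u) (fun u => h (lo u))).
    + apply (continuous_opp (V := R_NormedModule) lo), C2.
    + apply (continuous_comp lo h); [exact C2|apply bessel_integrand_continuous, lo_pos].
Qed.

Lemma Phi_lim_0 : filterlim Phi (at_right 0) (locally (T := C_R_CompleteNormedModule) zero).
Proof.
  assert (E : Phi 0 = (zero : C_R_CompleteNormedModule)).
  { unfold Phi, lo, hi. rewrite Ropp_0. apply (RInt_point (V := C_R_CompleteNormedModule)). }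
  assert (L : filterlim Phi (at_right 0) (locally (T := C_R_CompleteNormedModule) (Phi 0))).
  { apply (filterlim_filter_le_1 (F := locally 0) (G := at_right 0)).
    - intros P HP. apply filter_le_within. exact HP.
    - apply (ex_derive_continuous (V := C_R_CompleteNormedModule) Phi 0). exists (phi 0). apply is_derive_Phi. }
  rewrite E in L. exact L.
Qed.

Lemma Phi_lim_oo (H : C) : is_CInt h H -> filterlim Phi (Rbar_locally p_infty) (locally (T := C_R_CompleteNormedModule) H).
Proof.
  intros HH P HP. destruct (HH P HP) as [Q1 Q2 [e He] [M HM] HQ].
  (* As [exp u > u], these thresholds force [lo u < e] and [hi u > M], so that both ends enter the
     sets on which the integral of [h] satisfies [P]. *)
  exists (Rmax (z / (2 * e)) (2 * M / z)). intros u Hu.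
  assert (U1 := Rle_lt_trans _ _ _ (Rmax_l _ _) Hu). assert (U2 := Rle_lt_trans _ _ _ (Rmax_r _ _) Hu).
  assert (Pe := cond_pos e).
  assert (U0 : 0 < z / (2 * e)) by (apply Rdiv_lt_0_compat; lra).
  assert (X := exp_ineq1_le u).
  assert (A1 : Q1 (lo u)).
  { apply He; [|apply lo_pos]. change (Rabs (lo u - 0) < e). rewrite Rminus_0_r, Rabs_pos_eq by (left; apply lo_pos).
    unfold lo. rewrite exp_Ropp. apply (Rmult_lt_reg_r (exp u)); [apply exp_pos|].
    rewrite Rmult_assoc, Rinv_l by (apply Rgt_not_eq, exp_pos).
    apply (Rmult_lt_compat_l e) in U1; [|exact Pe]. replace (e * (z / (2 * e))) with (z / 2) in U1 by (field; lra). nra. }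
  assert (A2 : Q2 (hi u)).
  { apply HM. unfold hi. apply (Rmult_lt_compat_l (z / 2)) in U2; [|lra].
    replace (z / 2 * (2 * M / z)) with M in U2 by (field; lra). nra. }
  destruct (HQ _ _ A1 A2) as [y [Hy Py]]. unfold filtermap, Phi. simpl in Hy.
  assert (E : @RInt C_R_CompleteNormedModule h (lo u) (hi u) = y).
  { apply (is_RInt_unique (V := C_R_CompleteNormedModule)). exact Hy. }
  exact (eq_ind_r P Py E).
Qed.

(** At [t = (z / 2) exp v] one has [t + z^2 / (4 t) = z cosh v], even in [v], and
    [t^nu = (z / 2)^nu exp (nu v)]. The two ends [v = u] and [v = - u] supply the two exponentials
    of [BesselK]. *)
Lemma phi_bessel u : phi u = (2 * Rcpow (z / 2) nu * (RtoC (exp (- z * cosh u)) *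
               ((Cexp (nu * RtoC u) + Cexp (- (nu * RtoC u))) / 2)))%C.
Proof.
  assert (E : forall v, (RtoC (z / 2 * exp v) * h (z / 2 * exp v))%C =
     (Rcpow (z / 2) nu * Cexp (nu * RtoC v) * RtoC (exp (- z * cosh v)))%C).
  { intros v. unfold h. assert (Hv : 0 < z / 2 * exp v) by (apply Rmult_lt_0_compat; [lra|apply exp_pos]).
    rewrite Cmult_assoc, <- (Rcpow_1 _ Hv), <- Rcpow_add.
    replace (1 + (nu - 1))%C with nu by ring. rewrite Rcpow_mult by (try apply exp_pos; lra).
    unfold Rcpow at 2. rewrite ln_exp. f_equal. f_equal. f_equal. unfold cosh. rewrite exp_Ropp.
    assert (P := exp_pos v). field. lra. }
  assert (E1 := E u). assert (E2 := E (- u)).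
  replace (cosh (- u)) with (cosh u) in E2 by (unfold cosh; rewrite Ropp_involutive; field).
  replace (nu * RtoC (- u))%C with (- (nu * RtoC u))%C in E2 by (rewrite RtoC_opp; ring).
  transitivity (RtoC (hi u) * h (hi u) + RtoC (lo u) * h (lo u))%C.
  - unfold phi. generalize (h (hi u)) (h (lo u)). intros [a1 a2] [b1 b2].
    unfold minus, plus, opp, scal; simpl. unfold prod_plus, prod_opp, prod_scal, plus, opp, scal, mult, RtoC, Cmult, Cplus; simpl.
    unfold scal, mult; simpl. unfold mult; simpl. f_equal; ring.
  - unfold hi, lo. rewrite E1, E2. field.
Qed.

(** The integral of [phi] over the half-line is the limit of [Phi] at infinity minus that at 0,
    hence the integral of [h]. Dividing by [2 (z / 2)^nu] also shows that the integral defining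
    [BesselK] converges. *)
Theorem bessel_integral : is_CInt h (2 * Rcpow (z / 2) nu * BesselK nu z)%C.
Proof.
  destruct ex_bessel_integral as [H HH].
  assert (B := is_RInt_0oo_primitive (V := C_R_CompleteNormedModule) Phi phi zero H
    (fun t _ => is_derive_Phi t) (fun t _ => continuous_phi t) Phi_lim_0 (Phi_lim_oo H HH)).
  assert (E : @minus C_R_CompleteNormedModule H zero = H).
  { change ((H + - 0)%C = H). ring. }
  apply (fun b => eq_ind _ (fun l : C => is_CInt phi l) b _ E) in B.
  assert (N2 : RtoC 2 <> 0%C) by (intros X; apply RtoC_inj in X; lra).
  assert (N := Rcpow_neq_0 (z / 2) nu).
  apply (is_CInt_scal (/ (2 * Rcpow (z / 2) nu))) in B.
  apply (is_CInt_ext _ (fun u => RtoC (exp (- z * cosh u)) *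
               ((Cexp (nu * RtoC u) + Cexp (- (nu * RtoC u))) / 2))%C) in B.
  - unfold BesselK. rewrite (is_CInt_unique _ _ B).
    replace (2 * Rcpow (z / 2) nu * (/ (2 * Rcpow (z / 2) nu) * H))%C with H by (field; exact N).
    exact HH.
  - intros u _. rewrite phi_bessel. field. exact N.
Qed.
End BesselIntegral.

(** * Gamma at the integers and bounds for divisor sums *)

Lemma is_RInt_Gamma_nat (k : nat) : is_RInt_0oo (fun t => t ^ k * exp (- t)) (INR (fact k)).
Proof.
  assert (L : forall j, is_lim (fun t => t ^ j * exp (- t)) p_infty 0).
  { intros j. destruct (pow_exp_bound (S j)) as [K [HK HKt]].
    apply (is_lim_le_le_loc (fun _ => 0) (fun t => K * / t)).
    - exists 0. intros t Ht. assert (I : 0 < / t) by (apply Rinv_0_lt_compat, Ht). split.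
      + apply Rmult_le_pos; [apply pow_le; lra|left; apply exp_pos].
      + apply (Rmult_le_reg_l t); [exact Ht|]. specialize (HKt t Ht). simpl in HKt.
        replace (t * (K * / t)) with K by (field; lra). rewrite <- Rmult_assoc. exact HKt.
    - apply is_lim_const.
    - replace (Finite 0) with (Rbar_mult K 0) by (simpl; f_equal; ring).
      apply is_lim_scal_l. apply (is_lim_inv (fun t => t) p_infty p_infty); [apply is_lim_id|discriminate]. }
  (* Integration by parts as one exact integrand, the derivative of [- t^j exp (- t)]. The value
     [0 ^ j] is 1 for [j = 0] and 0 otherwise, so [j = 0] is already the base of the induction. *)
  assert (P : forall j, is_RInt_0oo (fun t => t ^ j * exp (- t) - INR j * t ^ pred j * exp (- t)) (0 ^ j)).
  { intros j.
    assert (H := is_RInt_0oo_primitive (V := R_CompleteNormedModule) (fun t => - (t ^ j * exp (- t)))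
      (fun t => t ^ j * exp (- t) - INR j * t ^ pred j * exp (- t)) (- 0 ^ j) (- 0)).
    replace (0 ^ j) with (minus (- 0) (- 0 ^ j)) by (unfold minus, plus, opp; simpl; ring).
    apply H.
    - intros t _. auto_derive; [exact I|]. ring.
    - intros t _. apply (ex_derive_continuous (V := R_NormedModule)). auto_derive. exact I.
    - assert (Cz : continuous (fun t => - (t ^ j * exp (- t))) 0).
      { apply (ex_derive_continuous (V := R_NormedModule)). auto_derive. exact I. }
      unfold continuous in Cz. rewrite Ropp_0, exp_0, Rmult_1_r in Cz.
      apply (filterlim_filter_le_1 (F := locally 0) (G := at_right 0)); [|exact Cz].
      intros Q HQ. apply filter_le_within. exact HQ.
    - apply (is_lim_opp _ p_infty 0), L. }
  induction k as [|k IH].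
  - eapply (is_RInt_gen_ext (V := R_NormedModule)); [|exact (P 0%nat)].
    apply filter_forall. intros ab t _. simpl. ring.
  - assert (H := is_RInt_gen_plus (V := R_NormedModule) _ _ _ _ (P (S k)) (is_RInt_gen_scal (V := R_NormedModule) _ (INR (S k)) _ IH)).
    replace (INR (fact (S k))) with (@plus R_NormedModule (0 ^ S k) (@scal _ R_NormedModule (INR (S k)) (INR (fact k)))).
    + eapply (is_RInt_gen_ext (V := R_NormedModule)); [|exact H].
      apply filter_forall. intros ab t _. unfold plus, scal; simpl. unfold mult; simpl. ring.
    + change (0 ^ S k + INR (S k) * INR (fact k) = INR (fact (S k))).
      rewrite fact_simpl, mult_INR, <- tech_pow_Rmult. ring.
Qed.

(** Lipschitz's formula yields [k!] where the result is phrased with the Gamma integral. *)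
Lemma CGamma_nat (k : nat) : CGamma (RtoC (INR k + 1)) = RtoC (INR (fact k)).
Proof.
  unfold CGamma. apply is_CInt_unique.
  apply (is_CInt_ext (fun t => RtoC (t ^ k * exp (- t)))).
  - intros t Ht. replace (RtoC (INR k + 1) - 1)%C with (RtoC (INR k)) by (rewrite RtoC_plus; ring).
    rewrite Rcpow_nat by exact Ht. apply RtoC_mult.
  - apply is_CInt_Re_Im. simpl. split; [apply is_RInt_Gamma_nat|].
    assert (H : is_RInt_0oo (fun t => 0 * (t ^ 0 * exp (- t))) (0 * INR (fact 0))).
    { apply (is_RInt_gen_scal (V := R_NormedModule)), is_RInt_Gamma_nat. }
    rewrite Rmult_0_l in H. eapply (is_RInt_gen_ext (V := R_NormedModule)); [|exact H].
    apply filter_forall. intros ab t _. apply Rmult_0_l.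
Qed.

(** At most [n] divisors, each contributing at most [n^k]; crude, but enough against the factor
    [exp (- n B / t)] of the Bessel terms. *)
Lemma sigmabar_bound k chi n : (forall m, Cmod (chi m) <= 1) ->
  Cmod (sigmabar_chi k chi (S n)) <= INR (S n) ^ S k.
Proof.
  intros H. unfold sigmabar_chi. rewrite divisor_sum_Csum.
  set (f := fun d : nat => _).
  assert (E : forall j, (j <= S n)%nat -> Cmod (Csum f j) <= INR j * INR (S n) ^ k).
  { induction j as [|j IH]; intros Hj; [simpl; rewrite Cmod_0; lra|].
    change (Csum f (S j)) with (Csum f j + f j)%C. eapply Rle_trans; [apply Cmod_triangle|].
    rewrite (S_INR j), Rmult_plus_distr_r, Rmult_1_l. apply Rplus_le_compat; [apply IH; lia|].
    unfold f. assert (P : 0 <= INR (S n) ^ k) by (apply pow_le, pos_INR).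
    destruct (Nat.eqb _ _); [|rewrite Cmod_0; exact P].
    rewrite Cmod_mult, Cmod_R, Rabs_pos_eq by (apply pow_le, pos_INR).
    rewrite <- (Rmult_1_r (INR (S n) ^ k)). apply Rmult_le_compat; [apply pow_le, pos_INR|apply Cmod_ge_0| |apply H].
    apply pow_incr. split; [apply pos_INR|apply le_INR; exact Hj]. }
  apply (E (S n)). lia.
Qed.

(** Writing [d = n / j], [(n / j)^k <= n^k / j^2], so the sum over [j] costs only a constant. The
    exponent has to be [k] and not [k + 1]: the terms [n^k / n^(Re nu + k + 1)] of the dual series
    leave only [Re nu] to spare. *)
Lemma sigma_bound k chi n : (2 <= k)%nat -> (forall m, Cmod (chi m) <= 1) ->
  Cmod (sigma_chi k chi (S n)) <= Series (fun j => / INR (S j) ^ 2) * INR (S n) ^ k.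
Proof.
  intros Hk H. unfold sigma_chi.
  rewrite (divisor_sum_involution (S n) (fun d _ => RtoC (INR d ^ k) * chi (Z.of_nat d))%C) by lia.
  rewrite divisor_sum_Csum, <- Series_scal_r.
  assert (Hn := INR_S_pos n).
  apply Cmod_Csum_le_Series; [|apply (ex_series_scal_r (INR (S n) ^ k)), ex_series_inv_sq].
  intros j. assert (Hj := INR_S_pos j).
  assert (P : 0 <= / INR (S j) ^ 2 * INR (S n) ^ k).
  { apply Rmult_le_pos; [left; apply Rinv_0_lt_compat, pow_lt, Hj|apply pow_le; lra]. }
  destruct (Nat.eqb_spec (S n mod S j) 0) as [E|E]; [|rewrite Cmod_0; exact P].
  rewrite Cmod_mult, Cmod_R, Rabs_pos_eq by (apply pow_le, pos_INR).
  rewrite <- (Rmult_1_r (/ INR (S j) ^ 2 * _)).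
  apply Rmult_le_compat; [apply pow_le, pos_INR|apply Cmod_ge_0| |apply H].
  assert (D := Nat.div_mod_eq (S n) (S j)). rewrite E, Nat.add_0_r in D. apply (f_equal INR) in D. rewrite mult_INR in D.
  replace (INR (S n / S j)) with (/ INR (S j) * INR (S n)) by (rewrite D; field; lra).
  rewrite Rpow_mult_distr, pow_inv. apply Rmult_le_compat_r; [apply pow_le; lra|].
  apply Rinv_le_contravar; [apply pow_lt, Hj|]. apply Rle_pow; [|exact Hk].
  change 1 with (INR 1). apply le_INR. lia.
Qed.

Lemma Rpower_mult_base x y z : 0 < x -> 0 < y -> Rpower (x * y) z = Rpower x z * Rpower y z.
Proof. intros Hx Hy. symmetry. apply Rpower_mult_distr; assumption. Qed.

(** * Majorants for the two integrated series *)

Section Dominations.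
Variables (nu : C).
Hypothesis Hnu : 0 < Re nu.

(** The factor [exp (- v)] with [v = n B / t] is traded for [v^(-(k+3))]. This turns [n^(k+1)] into
    [n^(-2)], and the power [t^(k+3)] that it costs is absorbed by [exp (- t)]. *)
Lemma bessel_term_dominated (B : R) (k : nat) : 0 < B -> exists K, 0 <= K /\
  forall (s : C) (n : nat) t, 0 < t -> Cmod s <= INR (S n) ^ S k ->
  Cmod (s * (Rcpow t (nu - 1) * RtoC (exp (- (t + INR (S n) * B / t)))))%C <=
  K * / INR (S n) ^ 2 * beta_kernel (Re nu + INR (k + 3)) t.
Proof.
  intros HB. destruct (pow_exp_bound (k + 3)) as [K1 [HK1 HP]].
  assert (Hp : 0 < Re nu + INR (k + 3)) by (generalize (pos_INR (k + 3)); lra).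
  destruct (Rpower_exp_beta_kernel _ Hp) as [K2 [HK2 HM]].
  assert (HBp : 0 < B ^ (k + 3)) by (apply pow_lt, HB).
  exists (K1 * / B ^ (k + 3) * K2). split.
  { left. repeat apply Rmult_lt_0_compat; try assumption. apply Rinv_0_lt_compat, HBp. }
  intros s n t Ht Hs. assert (Hn := INR_S_pos n).
  rewrite !Cmod_mult, Cmod_Rcpow, Cmod_R, Rabs_pos_eq by (left; apply exp_pos).
  replace (Re (nu - 1)) with (Re nu - 1) by (destruct nu; simpl; ring).
  set (v := INR (S n) * B / t). assert (Hv : 0 < v) by (unfold v; apply Rdiv_lt_0_compat; nra).
  specialize (HP v Hv). specialize (HM t Ht).
  replace (- (t + v)) with (- t + - v) by ring. rewrite exp_plus.
  assert (Hev : exp (- v) <= K1 * / B ^ (k + 3) * (t ^ (k + 3) * / INR (S n) ^ (k + 3))).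
  { assert (Pv : 0 < v ^ (k + 3)) by (apply pow_lt, Hv). assert (Pn : 0 < INR (S n) ^ (k + 3)) by (apply pow_lt, Hn).
    assert (Pt : 0 < t ^ (k + 3)) by (apply pow_lt, Ht).
    apply (Rmult_le_reg_l (v ^ (k + 3))); [exact Pv|]. eapply Rle_trans; [exact HP|]. right.
    unfold v, Rdiv. rewrite !Rpow_mult_distr, pow_inv. field. repeat split; lra. }
  assert (Ht1 : Rpower t (Re nu - 1) * t ^ (k + 3) = Rpower t (Re nu + INR (k + 3) - 1)).
  { rewrite <- Rpower_pow, <- Rpower_plus by exact Ht. f_equal. ring. }
  apply Rle_trans with (INR (S n) ^ S k * (Rpower t (Re nu - 1) * (exp (- t) * (K1 * / B ^ (k + 3) * (t ^ (k + 3) * / INR (S n) ^ (k + 3)))))).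
  - apply Rmult_le_compat; [apply Cmod_ge_0| |exact Hs|].
    + apply Rmult_le_pos; [left; apply exp_pos|]. apply Rmult_le_pos; left; apply exp_pos.
    + apply Rmult_le_compat_l; [left; apply exp_pos|]. apply Rmult_le_compat_l; [left; apply exp_pos|exact Hev].
  - replace (INR (S n) ^ S k * (Rpower t (Re nu - 1) * (exp (- t) * (K1 * / B ^ (k + 3) * (t ^ (k + 3) * / INR (S n) ^ (k + 3))))))
      with (K1 * / B ^ (k + 3) * / INR (S n) ^ 2 * ((Rpower t (Re nu - 1) * t ^ (k + 3)) * exp (- t))).
    + rewrite Ht1.
      replace (K1 * / B ^ (k + 3) * K2 * / INR (S n) ^ 2 * beta_kernel (Re nu + INR (k + 3)) t)
        with (K1 * / B ^ (k + 3) * / INR (S n) ^ 2 * (K2 * beta_kernel (Re nu + INR (k + 3)) t)) by ring.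
      apply Rmult_le_compat_l; [|exact HM].
      left. repeat apply Rmult_lt_0_compat; try assumption; apply Rinv_0_lt_compat; [exact HBp|apply pow_lt, Hn].
    + replace (INR (S n) ^ (k + 3)) with (INR (S n) ^ S k * INR (S n) ^ 2) by (rewrite <- pow_add; f_equal; lia).
      field. repeat split; try (apply pow_nonzero); lra.
Qed.

(** The factor [exp (- v)] with [v = n t / c] is traded for [v^(-p)]. The gain in [n] is paid for at
    [t = 0], and [p = k + 1 + Re nu / 2] shares [Re nu] equally: [n^(-1 - Re nu / 2)] is summable
    and [t^(Re nu / 2 - 1)] integrable. *)
Lemma dual_term_dominated (c D : R) (k : nat) : 0 < c -> 0 <= D -> exists K, 0 <= K /\
  forall (s : C) (n : nat) t, 0 < t -> Cmod s <= D * INR (S n) ^ k ->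
  Cmod (s * (Rcpow t (nu + RtoC (INR k + 1) - 1) * RtoC (exp (- ((1 + INR (S n) / c) * t)))))%C <=
  K * Rpower (INR (S n)) (- (1 + Re nu / 2)) * beta_kernel (Re nu / 2) t.
Proof.
  intros Hc HD. set (p := INR k + 1 + Re nu / 2).
  assert (Hk := pos_INR k). assert (Hp : 0 < p) by (unfold p; lra).
  destruct (Rpower_exp_beta_kernel (Re nu / 2)) as [K2 [HK2 HM]]; [lra|].
  set (K1 := exp (p * ln p)). assert (HK1 : 0 < K1) by apply exp_pos.
  set (K3 := Rpower (/ c) (- p)). assert (HK3 : 0 < K3) by apply exp_pos.
  exists (D * K1 * K3 * K2). split; [repeat apply Rmult_le_pos; lra|].
  intros s n t Ht Hs. assert (Hn := INR_S_pos n).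
  rewrite !Cmod_mult, Cmod_Rcpow, Cmod_R, Rabs_pos_eq by (left; apply exp_pos).
  replace (Re (nu + RtoC (INR k + 1) - 1)) with (Re nu + INR k) by (destruct nu; simpl; ring).
  assert (Hic : 0 < / c) by (apply Rinv_0_lt_compat, Hc).
  set (v := INR (S n) * / c * t). assert (Hv : 0 < v) by (unfold v; apply Rmult_lt_0_compat; [apply Rmult_lt_0_compat|]; assumption).
  replace (- ((1 + INR (S n) / c) * t)) with (- t + - v) by (unfold v; field; lra). rewrite exp_plus.
  assert (Hev : exp (- v) <= K1 * (Rpower (INR (S n)) (- p) * K3 * Rpower t (- p))).
  { assert (HB := Rpower_exp_bound p v Hp Hv). fold K1 in HB.
    assert (Pv : 0 < Rpower v p) by apply exp_pos.
    replace (Rpower (INR (S n)) (- p) * K3 * Rpower t (- p)) with (/ Rpower v p).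
    - apply (Rmult_le_reg_l (Rpower v p)); [exact Pv|]. eapply Rle_trans; [exact HB|]. right. field. lra.
    - rewrite <- Rpower_Ropp. unfold v, K3. rewrite !Rpower_mult_base by (try apply Rmult_lt_0_compat; assumption). reflexivity. }
  apply Rle_trans with (D * INR (S n) ^ k * (Rpower t (Re nu + INR k) * (exp (- t) * (K1 * (Rpower (INR (S n)) (- p) * K3 * Rpower t (- p)))))).
  - apply Rmult_le_compat; [apply Cmod_ge_0| |exact Hs|].
    + apply Rmult_le_pos; [left; apply exp_pos|]. apply Rmult_le_pos; left; apply exp_pos.
    + apply Rmult_le_compat_l; [left; apply exp_pos|]. apply Rmult_le_compat_l; [left; apply exp_pos|exact Hev].
  - replace (D * INR (S n) ^ k * (Rpower t (Re nu + INR k) * (exp (- t) * (K1 * (Rpower (INR (S n)) (- p) * K3 * Rpower t (- p))))))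
      with (D * K1 * K3 * (INR (S n) ^ k * Rpower (INR (S n)) (- p)) * ((Rpower t (Re nu + INR k) * Rpower t (- p)) * exp (- t))) by ring.
    rewrite <- Rpower_pow by exact Hn. rewrite <- !Rpower_plus.
    replace (INR k + - p) with (- (1 + Re nu / 2)) by (unfold p; ring).
    replace (Re nu + INR k + - p) with (Re nu / 2 - 1) by (unfold p; field).
    replace (D * K1 * K3 * K2 * Rpower (INR (S n)) (- (1 + Re nu / 2)) * beta_kernel (Re nu / 2) t)
      with (D * K1 * K3 * Rpower (INR (S n)) (- (1 + Re nu / 2)) * (K2 * beta_kernel (Re nu / 2) t)) by ring.
    apply Rmult_le_compat_l; [|apply HM, Ht].
    apply Rmult_le_pos; [repeat apply Rmult_le_pos; lra|left; apply exp_pos].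
Qed.
End Dominations.

(** * Further rules for complex powers *)

Lemma Rcpow_square (r : R) (s : C) : 0 < r -> Rcpow r s = Rcpow (r ^ 2) (s / 2).
Proof.
  intros Hr. unfold Rcpow. f_equal. replace (ln (r ^ 2)) with (2 * ln r).
  - rewrite RtoC_mult. field.
  - simpl. rewrite Rmult_1_r, ln_mult by exact Hr. ring.
Qed.

Lemma Rcpow_mult_exponent (r : R) (n : nat) (s : C) : Rcpow r (RtoC (INR n) * s) = (Rcpow r s ^ n)%C.
Proof. unfold Rcpow. rewrite Cexp_pow. f_equal. ring. Qed.

Lemma Rcpow_pow_base (r : R) (n : nat) (s : C) : 0 < r -> Rcpow (r ^ n) s = (Rcpow r s ^ n)%C.
Proof.
  intros Hr. rewrite <- Rcpow_mult_exponent. unfold Rcpow. f_equal.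
  replace (ln (r ^ n)) with (INR n * ln r).
  - rewrite RtoC_mult. ring.
  - rewrite <- Rpower_pow by exact Hr. unfold Rpower. rewrite ln_exp. reflexivity.
Qed.

Lemma Rcpow_inv_base (r : R) (s : C) : 0 < r -> Rcpow (/ r) s = (/ Rcpow r s)%C.
Proof.
  intros Hr. unfold Rcpow. rewrite ln_Rinv by exact Hr. rewrite <- Cexp_opp. f_equal. rewrite RtoC_opp. ring.
Qed.

Lemma Rcpow_add_nat (r : R) (s : C) (n : nat) : 0 < r -> Rcpow r (s + RtoC (INR n)) = (Rcpow r s * RtoC r ^ n)%C.
Proof. intros Hr. rewrite Rcpow_add, Rcpow_nat by exact Hr. rewrite RtoC_pow. reflexivity. Qed.

(** With [k = 2 j], [(- i)^(k+1) = (-1)^j (- i)]; this is the origin of the factor [- (-1)^(k/2) i]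
    in the second term of the result. *)
Lemma Ci_pow_odd k : Nat.Even k -> ((- Ci) ^ S k = - (RtoC ((-1) ^ (k / 2)) * Ci))%C.
Proof.
  intros [j Hj]. subst k. rewrite (Nat.mul_comm 2 j), Nat.div_mul by lia.
  rewrite Cpow_S, (Nat.mul_comm j 2), Cpow_mult_r, RtoC_pow.
  replace ((- Ci) ^ 2)%C with (RtoC (-1)); [ring|].
  unfold Ci, RtoC, Cpow, Cmult, Copp; simpl. f_equal; ring.
Qed.

(** * Termwise integration of the transformation formula *)

Section Main.
Variables (k : nat) (q : Z) (chi : Z -> C) (a x : R) (nu : C).
Hypotheses (Hk : (2 <= k)%nat) (Hev : Nat.Even k) (Hprim : primitive_char q chi) (Hodd : odd_char chi)
  (Ha : 0 < a) (Hx : 0 < x) (Hnu : 0 < Re nu).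

Let c : R := a ^ 2 * IZR q * x / (16 * PI ^ 2).
Let B : R := a ^ 2 * x / 4.
Let s : C := (nu + RtoC (INR k + 1))%C.
Let inner (n : nat) : C := (sigma_chi k (conj_char chi) (S n) / Rcpow (INR (S n) + c) s)%C.
Let tau : C := gauss_sum q chi.
(** The factor [rot] of the transformation at [y = B]. At [y = B / t] it becomes [rotB * t], whose
    [(k+1)]-st power moves the exponent of [t] from [nu - 1] to [s - 1]. *)
Let rotB : C := (- (RtoC (2 * PI) * Ci) / RtoC (IZR q * B))%C.
Let Lk : C := Lfun (RtoC (1 + INR k)) chi.

Lemma modulus_pos : 0 < IZR q.
Proof. apply IZR_lt, (char_pos q chi (proj1 Hprim)). Qed.

Lemma B_pos : 0 < B.
Proof. unfold B. assert (0 < a ^ 2) by (apply pow_lt, Ha). nra. Qed.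

(** In this form the exponent [4 pi^2 n t / (q B)] of the dual series at [y = B / t] is visibly
    [n t / c]. *)
Lemma c_eq : c = IZR q * B / (4 * PI ^ 2).
Proof. unfold c, B. field. apply PI_neq0. Qed.

Lemma c_pos : 0 < c.
Proof.
  rewrite c_eq. assert (H := modulus_pos). assert (HB := B_pos). assert (HP := PI_RGT_0).
  apply Rdiv_lt_0_compat; [nra|]. assert (0 < PI ^ 2) by (apply pow_lt, HP). lra.
Qed.

Lemma chi_le_1 m : Cmod (chi m) <= 1.
Proof. apply (char_Cmod_le_1 q chi (proj1 Hprim)). Qed.

Lemma conj_chi_le_1 m : Cmod (conj_char chi m) <= 1.
Proof. unfold conj_char. rewrite Cmod_conj. apply chi_le_1. Qed.

Lemma Re_s : Re s = Re nu + INR k + 1.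
Proof. unfold s. destruct nu; simpl. ring. Qed.

Lemma dual_series_converges : Cis_series inner (CSeries inner).
Proof.
  set (D := Series (fun j => / INR (S j) ^ 2)).
  apply (Cis_series_dom _ (fun n => D * Rpower (INR (S n)) (- (1 + Re nu)))).
  2:{ apply (ex_series_scal D _ (ex_series_Rpower (Re nu) Hnu)). }
  intros n. unfold inner. assert (Hn := INR_S_pos n). assert (Hc := c_pos).
  rewrite Cmod_div by apply Rcpow_neq_0. rewrite Cmod_Rcpow, Re_s.
  replace (- (1 + Re nu)) with (INR k + - (Re nu + INR k + 1)) by ring.
  rewrite (Rpower_plus (INR k)), Rpower_pow by exact Hn. rewrite <- Rmult_assoc.
  apply Rmult_le_compat; [apply Cmod_ge_0|left; apply Rinv_0_lt_compat, exp_pos| |].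
  - apply sigma_bound; [exact Hk|apply conj_chi_le_1].
  - rewrite Rpower_Ropp. apply Rinv_le_contravar; [apply exp_pos|].
    apply Rle_Rpower_l; [generalize (pos_INR k); lra|lra].
Qed.

Lemma bessel_term_integral n :
  is_CInt (fun t => sigmabar_chi k chi (S n) * (Rcpow t (nu - 1) * RtoC (exp (- (t + INR (S n) * B / t)))))%C
    (2 * Rcpow B (nu / 2) * (sigmabar_chi k chi (S n) * Rcpow (INR (S n)) (nu / 2) *
        BesselK nu (a * sqrt (INR (S n) * x))))%C.
Proof.
  assert (Hn := INR_S_pos n). assert (HB := B_pos).
  assert (Hnx : 0 < INR (S n) * x) by (apply Rmult_lt_0_compat; assumption).
  assert (Hz : 0 < a * sqrt (INR (S n) * x)) by (apply Rmult_lt_0_compat; [exact Ha|apply sqrt_lt_R0, Hnx]).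
  assert (Hz2 : (a * sqrt (INR (S n) * x)) ^ 2 = 4 * (INR (S n) * B)).
  { rewrite Rpow_mult_distr. replace (sqrt (INR (S n) * x) ^ 2) with (INR (S n) * x).
    - unfold B. field.
    - rewrite pow2_sqrt by lra. reflexivity. }
  assert (H := is_CInt_scal (sigmabar_chi k chi (S n)) _ _ (bessel_integral nu _ Hnu Hz)).
  (* [(z / 2)^nu] becomes [((z / 2)^2)^(nu / 2) = (n B)^(nu / 2)], which removes the square root. *)
  rewrite (Rcpow_square (a * sqrt (INR (S n) * x) / 2)) in H by lra.
  replace ((a * sqrt (INR (S n) * x) / 2) ^ 2) with (INR (S n) * B) in H.
  2:{ unfold Rdiv. rewrite Rpow_mult_distr, Hz2. field. }
  rewrite Rcpow_mult in H by assumption.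
  replace (2 * Rcpow B (nu / 2) * (sigmabar_chi k chi (S n) * Rcpow (INR (S n)) (nu / 2) *
        BesselK nu (a * sqrt (INR (S n) * x))))%C with
    (sigmabar_chi k chi (S n) * (2 * (Rcpow (INR (S n)) (nu / 2) * Rcpow B (nu / 2)) * BesselK nu (a * sqrt (INR (S n) * x))))%C by ring.
  eapply is_CInt_ext; [|exact H]. intros t Ht. cbv beta. rewrite Hz2.
  do 5 f_equal. f_equal. field. lra.
Qed.

(** Since [1 + n / c = (n + c) / c], the scaled Gamma integral gives [(n + c)^(-s)] and the common
    factor [c^s]. *)
Lemma dual_term_integral n :
  is_CInt (fun t => (rotB ^ S k * tau * sigma_chi k (conj_char chi) (S n)) *
     (Rcpow t (s - 1) * RtoC (exp (- ((1 + INR (S n) / c) * t)))))%C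
    ((rotB ^ S k * tau * CGamma s * Rcpow c s) * inner n)%C.
Proof.
  assert (Hn := INR_S_pos n). assert (Hc := c_pos).
  assert (Hs : 0 < Re s) by (rewrite Re_s; generalize (pos_INR k); lra).
  assert (H1 : 0 < 1 + INR (S n) / c).
  { assert (0 < INR (S n) / c) by (apply Rdiv_lt_0_compat; assumption). lra. }
  assert (H := is_CInt_scal (rotB ^ S k * tau * sigma_chi k (conj_char chi) (S n)) _ _ (is_CInt_Gamma_scaled s _ Hs H1)).
  assert (E : Rcpow (1 + INR (S n) / c) s = (Rcpow (INR (S n) + c) s * / Rcpow c s)%C).
  { rewrite <- Rcpow_inv_base, <- Rcpow_mult by (try apply Rinv_0_lt_compat; lra). f_equal. field. lra. }
  rewrite E in H.
  replace (rotB ^ S k * tau * CGamma s * Rcpow c s * inner n)%C with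
    (rotB ^ S k * tau * sigma_chi k (conj_char chi) (S n) * (CGamma s / (Rcpow (INR (S n) + c) s * / Rcpow c s)))%C.
  - exact H.
  - unfold inner. field. split; apply Rcpow_neq_0.
Qed.

Lemma main_term_integral :
  is_CInt (fun t => (RtoC (INR (fact k)) * Lk / RtoC B ^ S k) * (Rcpow t (s - 1) * RtoC (exp (- t))))%C
    (RtoC (INR (fact k)) * Lk / RtoC B ^ S k * CGamma s)%C.
Proof.
  apply is_CInt_scal, is_CInt_Gamma. rewrite Re_s. generalize (pos_INR k); lra.
Qed.

Lemma Rcpow_shift t : 0 < t -> Rcpow t (s - 1) = (Rcpow t (nu - 1) * RtoC t ^ S k)%C.
Proof.
  intros Ht. rewrite <- Rcpow_add_nat by exact Ht. f_equal. unfold s. rewrite S_INR, !RtoC_plus. ring.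
Qed.

(** The transformation formula at [y = B / t], multiplied by [t^(nu-1) exp (- t)], with the dual
    series brought to the left so that the sum is a single explicit integrand. *)
Lemma pointwise_identity t : 0 < t ->
  Cis_series (fun n => sigmabar_chi k chi (S n) * (Rcpow t (nu - 1) * RtoC (exp (- (t + INR (S n) * B / t))))
     - (rotB ^ S k * tau * sigma_chi k (conj_char chi) (S n)) *
     (Rcpow t (s - 1) * RtoC (exp (- ((1 + INR (S n) / c) * t)))))%C
   ((RtoC (INR (fact k)) * Lk / RtoC B ^ S k) * (Rcpow t (s - 1) * RtoC (exp (- t))))%C.
Proof.
  intros Ht. assert (HB := B_pos). assert (Hc := c_pos). assert (Hq := modulus_pos). assert (HP := PI_RGT_0).
  assert (Hy : 0 < B / t) by (apply Rdiv_lt_0_compat; assumption).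
  destruct (lambert_transformation k q chi (B / t) Hk Hev Hprim Hodd Hy) as [U [H1 H2]].
  apply (Cis_series_scal (Rcpow t (nu - 1) * RtoC (exp (- t)))) in H2.
  apply (Cis_series_scal (rotB ^ S k * tau * (Rcpow t (s - 1) * RtoC (exp (- t))))) in H1.
  assert (H := Cis_series_minus _ _ _ _ H2 H1).
  assert (NB : RtoC B <> 0%C) by (intros X; apply RtoC_inj in X; lra).
  assert (Nt : RtoC t <> 0%C) by (intros X; apply RtoC_inj in X; lra).
  assert (Nq : RtoC (IZR q) <> 0%C) by (intros X; apply RtoC_inj in X; lra).
  assert (Erot : (- (RtoC (2 * PI) * Ci) / RtoC (IZR q * (B / t)))%C = (rotB * RtoC t)%C).
  { unfold rotB. rewrite !RtoC_mult, RtoC_div by lra. field. repeat split; assumption. }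
  assert (Ey : (RtoC (B / t) ^ S k = RtoC B ^ S k / RtoC t ^ S k)%C).
  { rewrite RtoC_div by lra. unfold Cdiv. rewrite Cpow_mult_l, Cpow_inv by exact Nt. reflexivity. }
  match type of H with Cis_series _ ?v => replace v with
    ((RtoC (INR (fact k)) * Lk / RtoC B ^ S k) * (Rcpow t (s - 1) * RtoC (exp (- t))))%C in H end.
  - eapply Cis_series_ext; [|exact H]. intros n. cbv beta.
    replace (- (t + INR (S n) * B / t)) with (- t + - (B / t * INR (S n))) by (field; lra).
    replace (- ((1 + INR (S n) / c) * t)) with (- t + - (4 * PI ^ 2 / (IZR q * (B / t)) * INR (S n))).
    2:{ rewrite c_eq. field. repeat split; try lra. }
    rewrite !exp_plus, !RtoC_mult. ring.
  - fold Lk tau. rewrite Erot, Cpow_mult_l, Rcpow_shift, Ey by exact Ht. field.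
    split; apply Cpow_nz; assumption.
Qed.

(** Integrating the difference of the two series keeps every integral a known one; the dual series,
    which converges by itself, is added back afterwards. *)
Lemma bessel_series :
  Cis_series (fun n => sigmabar_chi k chi (S n) * Rcpow (INR (S n)) (nu / 2) * BesselK nu (a * sqrt (INR (S n) * x)))%C
    (/ (2 * Rcpow B (nu / 2)) * (RtoC (INR (fact k)) * Lk / RtoC B ^ S k * CGamma s
      + (rotB ^ S k * tau * CGamma s * Rcpow c s) * CSeries inner))%C.
Proof.
  assert (HB := B_pos). assert (Hc := c_pos).
  set (D := Series (fun j => / INR (S j) ^ 2)).
  assert (HD : 0 <= D).
  { apply Series_nonneg; [|exact ex_series_inv_sq]. intros j. left. apply Rinv_0_lt_compat, pow_lt, INR_S_pos. }
  set (R0 := Cmod (rotB ^ S k * tau)). assert (HR0 : 0 <= R0) by apply Cmod_ge_0.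
  destruct (bessel_term_dominated nu Hnu B k HB) as [K1 [HK1 HD1]].
  destruct (dual_term_dominated nu Hnu c (R0 * D) k Hc ltac:(apply Rmult_le_pos; assumption)) as [K2 [HK2 HD2]].
  assert (Hp : 0 < Re nu + INR (k + 3)) by (generalize (pos_INR (k + 3)); lra).
  set (M1 := fun n => K1 * / INR (S n) ^ 2). set (M2 := fun n => K2 * Rpower (INR (S n)) (- (1 + Re nu / 2))).
  assert (PM1 : forall n, 0 <= M1 n).
  { intros n. apply Rmult_le_pos; [exact HK1|]. left. apply Rinv_0_lt_compat, pow_lt, INR_S_pos. }
  assert (PM2 : forall n, 0 <= M2 n) by (intros n; apply Rmult_le_pos; [exact HK2|left; apply exp_pos]).
  assert (Pb : forall r t, 0 <= beta_kernel r t).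
  { intros r t. unfold beta_kernel. apply Rmult_le_pos; left; apply exp_pos. }
  (* The exchange lemma takes one majorant of the form [M n * g t]. The sum of the two available
     majorants is below [(M1 + M2) (g1 + g2)], the cross terms being nonnegative. *)
  assert (HX := integral_series_exchange
    (fun n t => sigmabar_chi k chi (S n) * (Rcpow t (nu - 1) * RtoC (exp (- (t + INR (S n) * B / t))))
     - (rotB ^ S k * tau * sigma_chi k (conj_char chi) (S n)) *
     (Rcpow t (s - 1) * RtoC (exp (- ((1 + INR (S n) / c) * t)))))%C
    _ _ _ (fun n => M1 n + M2 n) (fun t => beta_kernel (Re nu + INR (k + 3)) t + beta_kernel (Re nu / 2) t) _
    (fun n => is_CInt_minus _ _ _ _ (bessel_term_integral n) (dual_term_integral n)) main_term_integral
    (is_RInt_gen_plus (V := R_NormedModule) _ _ _ _ (is_RInt_beta_kernel _ Hp) (is_RInt_beta_kernel (Re nu / 2) ltac:(lra)))).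
  assert (HY : Cis_series (fun n => 2 * Rcpow B (nu / 2) * (sigmabar_chi k chi (S n) * Rcpow (INR (S n)) (nu / 2) *
        BesselK nu (a * sqrt (INR (S n) * x))) - (rotB ^ S k * tau * CGamma s * Rcpow c s) * inner n)%C
     (RtoC (INR (fact k)) * Lk / RtoC B ^ S k * CGamma s)%C).
  { apply HX.
    - intros n t Ht.
      specialize (HD1 (sigmabar_chi k chi (S n)) n t Ht (sigmabar_bound k chi n chi_le_1)).
      assert (HS2 : Cmod (rotB ^ S k * tau * sigma_chi k (conj_char chi) (S n)) <= R0 * D * INR (S n) ^ k).
      { rewrite Cmod_mult, Rmult_assoc. apply Rmult_le_compat_l; [exact HR0|].
        apply sigma_bound; [exact Hk|exact conj_chi_le_1]. }
      specialize (HD2 _ n t Ht HS2). fold s in HD2.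
      change (K1 * / INR (S n) ^ 2) with (M1 n) in HD1.
      change (K2 * Rpower (INR (S n)) (- (1 + Re nu / 2))) with (M2 n) in HD2.
      unfold Cminus. eapply Rle_trans; [apply Cmod_triangle|]. rewrite Cmod_opp.
      specialize (PM1 n). specialize (PM2 n).
      assert (Q1 := Pb (Re nu + INR (k + 3)) t). assert (Q2 := Pb (Re nu / 2) t).
      assert (0 <= M1 n * beta_kernel (Re nu / 2) t) by (apply Rmult_le_pos; assumption).
      assert (0 <= M2 n * beta_kernel (Re nu + INR (k + 3)) t) by (apply Rmult_le_pos; assumption).
      eapply Rle_trans; [apply Rplus_le_compat; [exact HD1|exact HD2]|].
      rewrite Rmult_plus_distr_r, !Rmult_plus_distr_l. lra.
    - apply (ex_series_plus M1 M2).
      + apply (ex_series_scal K1 _ ex_series_inv_sq).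
      + apply (ex_series_scal K2 _ (ex_series_Rpower (Re nu / 2) ltac:(lra))).
    - exact pointwise_identity. }
  assert (HZ := Cis_series_plus _ _ _ _ HY (Cis_series_scal (rotB ^ S k * tau * CGamma s * Rcpow c s) _ _ dual_series_converges)).
  apply (Cis_series_scal (/ (2 * Rcpow B (nu / 2)))) in HZ.
  eapply Cis_series_ext; [|exact HZ]. intros n. cbv beta. field. apply Rcpow_neq_0.
Qed.

(** All powers are reduced to [a^nu], [x^(nu/2)], [2^nu], [pi^nu], [q^nu] and to the [(k+1)]-st
    powers of [2], [a], [x], [pi]; what remains is an identity of rational functions. *)
Lemma prefactors_eq :
  (/ (2 * Rcpow B (nu / 2)) * (RtoC (INR (fact k)) * Lk / RtoC B ^ S k * CGamma s
      + (rotB ^ S k * tau * CGamma s * Rcpow c s) * CSeries inner))%C =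
  ((Rcpow 2 (nu + RtoC (2 * INR k + 1)) / Rcpow a (nu + RtoC (2 * INR k + 2))
        * CGamma (RtoC (INR k + 1)) * CGamma s * Lk * Rcpow x (- (nu / 2) - RtoC (INR k + 1)))
     - (RtoC ((-1) ^ (k / 2)) * Ci * Rcpow (a * IZR q) nu * Rcpow x (nu / 2)
        / (Rcpow 2 (3 * nu + RtoC (INR k + 2)) * Rcpow PI (2 * nu + RtoC (INR k + 1)))
        * CGamma s * tau * CSeries inner))%C.
Proof.
  assert (HB := B_pos). assert (Hc := c_pos). assert (Hq := modulus_pos). assert (HP := PI_RGT_0).
  rewrite CGamma_nat.
  set (A := Rcpow a nu). set (X := Rcpow x (nu / 2)). set (T := Rcpow 2 nu). set (P := Rcpow PI nu).
  set (Q := Rcpow (IZR q) nu).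
  assert (NA : A <> 0%C) by apply Rcpow_neq_0. assert (NX : X <> 0%C) by apply Rcpow_neq_0.
  assert (NT : T <> 0%C) by apply Rcpow_neq_0. assert (NP : P <> 0%C) by apply Rcpow_neq_0.
  assert (EB : Rcpow B (nu / 2) = (A * X / T)%C).
  { unfold B, A, T. rewrite (Rcpow_square a), (Rcpow_square 2) by lra.
    assert (0 < a ^ 2) by (apply pow_lt, Ha).
    unfold Rdiv at 1. rewrite !Rcpow_mult, Rcpow_inv_base by (try apply Rmult_lt_0_compat; try apply Rinv_0_lt_compat; lra).
    replace (2 ^ 2) with 4 by ring. reflexivity. }
  assert (Exn : Rcpow x nu = (X ^ 2)%C).
  { unfold X. rewrite <- Rcpow_mult_exponent. f_equal. simpl INR. rewrite RtoC_plus. field. }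
  assert (Ecn : Rcpow c nu = (A ^ 2 * Q * X ^ 2 / (T ^ 4 * P ^ 2))%C).
  { unfold c. assert (0 < a ^ 2) by (apply pow_lt, Ha). assert (0 < PI ^ 2) by (apply pow_lt, HP).
    replace 16 with (2 ^ 4) by ring. assert (0 < 2 ^ 4) by (apply pow_lt; lra).
    assert (0 < a ^ 2 * IZR q) by (apply Rmult_lt_0_compat; assumption).
    assert (0 < a ^ 2 * IZR q * x) by (apply Rmult_lt_0_compat; assumption).
    assert (0 < 2 ^ 4 * PI ^ 2) by (apply Rmult_lt_0_compat; assumption).
    assert (0 < / (2 ^ 4 * PI ^ 2)) by (apply Rinv_0_lt_compat; assumption).
    unfold Rdiv. rewrite (Rcpow_mult (a ^ 2 * IZR q * x)), Rcpow_inv_base, !Rcpow_mult by assumption.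
    rewrite !Rcpow_pow_base by lra. rewrite Exn. reflexivity. }
  assert (Ecs : Rcpow c s = (Rcpow c nu * RtoC c ^ S k)%C).
  { unfold s. rewrite <- Rcpow_add_nat by exact Hc. rewrite S_INR. reflexivity. }
  assert (E2a : Rcpow 2 (nu + RtoC (2 * INR k + 1)) = (T * (RtoC 2 ^ S k) ^ 2 / 2)%C).
  { replace (2 * INR k + 1) with (INR (2 * k + 1)) by (rewrite plus_INR, mult_INR; simpl; ring).
    rewrite Rcpow_add_nat by lra. fold T. rewrite <- Cpow_mult_r.
    replace (S k * 2)%nat with (S (2 * k + 1)) by lia. rewrite (Cpow_S _ (2 * k + 1)). field. }
  assert (Ea : Rcpow a (nu + RtoC (2 * INR k + 2)) = (A * (RtoC a ^ S k) ^ 2)%C).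
  { replace (2 * INR k + 2) with (INR (S k * 2)) by (rewrite mult_INR, S_INR; simpl; ring).
    rewrite Rcpow_add_nat by exact Ha. rewrite <- Cpow_mult_r. reflexivity. }
  assert (Ex : Rcpow x (- (nu / 2) - RtoC (INR k + 1)) = (/ (X * RtoC x ^ S k))%C).
  { replace (- (nu / 2) - RtoC (INR k + 1))%C with (- (nu / 2 + RtoC (INR (S k))))%C by (rewrite S_INR; ring).
    rewrite Rcpow_opp, Rcpow_add_nat by exact Hx. reflexivity. }
  assert (E2b : Rcpow 2 (3 * nu + RtoC (INR k + 2)) = (T ^ 3 * (RtoC 2 ^ S k * 2))%C).
  { replace (INR k + 2) with (INR (S (S k))) by (rewrite !S_INR; ring).
    rewrite Rcpow_add_nat by lra. replace (3 * nu)%C with (RtoC (INR 3) * nu)%C by (simpl; f_equal; f_equal; ring).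
    rewrite Rcpow_mult_exponent, (Cpow_S _ (S k)). fold T. ring. }
  assert (EP : Rcpow PI (2 * nu + RtoC (INR k + 1)) = (P ^ 2 * RtoC PI ^ S k)%C).
  { rewrite <- S_INR, Rcpow_add_nat by exact HP. replace (2 * nu)%C with (RtoC (INR 2) * nu)%C by (simpl; f_equal; f_equal; ring).
    rewrite Rcpow_mult_exponent. reflexivity. }
  assert (Eq : Rcpow (a * IZR q) nu = (A * Q)%C) by (apply Rcpow_mult; assumption).
  assert (NZ : forall r, 0 < r -> RtoC r <> 0%C) by (intros r Hr E; apply RtoC_inj in E; lra).
  assert (EBk : (RtoC B ^ S k)%C = ((RtoC a ^ S k) ^ 2 * RtoC x ^ S k / (RtoC 2 ^ S k) ^ 2)%C).
  { rewrite <- !Cpow_mult_r, (Nat.mul_comm (S k) 2), !Cpow_mult_r.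
    assert (N2 : (RtoC 2 ^ 2)%C <> 0%C) by (apply Cpow_nz, NZ; lra).
    unfold Cdiv. rewrite <- Cpow_inv, <- !Cpow_mult_l by exact N2. f_equal.
    rewrite <- !RtoC_pow, <- RtoC_inv, <- !RtoC_mult by (simpl; lra). f_equal. unfold B. field. }
  (* [rotB * c = - i / (2 pi)]: [q] and [B] cancel, and the odd power of [- i] gives the sign and
     the factor [i]. *)
  assert (Erc : (rotB ^ S k * RtoC c ^ S k)%C = (- (RtoC ((-1) ^ (k / 2)) * Ci) / (RtoC 2 ^ S k * RtoC PI ^ S k))%C).
  { rewrite <- Ci_pow_odd by exact Hev. rewrite <- !Cpow_mult_l.
    assert (N2 : (RtoC 2 * RtoC PI)%C <> 0%C) by (rewrite <- RtoC_mult; apply NZ; lra).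
    unfold Cdiv. rewrite <- Cpow_inv, <- Cpow_mult_l by exact N2. f_equal.
    unfold rotB. rewrite c_eq. rewrite RtoC_div by (assert (0 < PI ^ 2) by (apply pow_lt, HP); lra).
    rewrite !RtoC_mult, RtoC_pow. replace (RtoC 4) with (RtoC 2 * RtoC 2)%C by (rewrite <- RtoC_mult; f_equal; ring).
    field. repeat split; apply NZ; lra. }
  rewrite EB, Ecs, Ecn, E2a, Ea, Ex, E2b, EP, Eq, EBk.
  replace (rotB ^ S k * tau * CGamma s * (A ^ 2 * Q * X ^ 2 / (T ^ 4 * P ^ 2) * RtoC c ^ S k) * CSeries inner)%C
    with ((rotB ^ S k * RtoC c ^ S k) * tau * CGamma s * (A ^ 2 * Q * X ^ 2 / (T ^ 4 * P ^ 2)) * CSeries inner)%C by (unfold Cdiv; ring).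
  rewrite Erc.
  assert (N2k : (RtoC 2 ^ S k)%C <> 0%C) by (apply Cpow_nz, NZ; lra).
  assert (Nak : (RtoC a ^ S k)%C <> 0%C) by (apply Cpow_nz, NZ; lra).
  assert (Nxk : (RtoC x ^ S k)%C <> 0%C) by (apply Cpow_nz, NZ; lra).
  assert (NPk : (RtoC PI ^ S k)%C <> 0%C) by (apply Cpow_nz, NZ; lra).
  (* The four powers are generalised so that [field] treats them as variables. *)
  revert N2k Nak Nxk NPk. generalize (RtoC 2 ^ S k)%C (RtoC a ^ S k)%C (RtoC x ^ S k)%C (RtoC PI ^ S k)%C.
  intros p2 pa px pp N2k Nak Nxk NPk.
  field. repeat split; assumption.
Qed.
End Main.

(** Convergence of [inner] is a conjunct of its own because [CSeries] is total and is known to equal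
    the sum only for a convergent series. *)
Theorem theorem2p3 (k : nat) (q : Z) (chi : Z -> C) (a x : R) (nu : C) :
  (2 <= k)%nat -> Nat.Even k ->
  primitive_char q chi -> odd_char chi ->
  0 < a -> 0 < x -> 0 < Re nu ->
  let c := a ^ 2 * IZR q * x / (16 * PI ^ 2) in
  let inner := fun n : nat =>
    (sigma_chi k (conj_char chi) (S n) /
       Rcpow (INR (S n) + c) (nu + RtoC (INR k + 1)))%C in
  Cis_series inner (CSeries inner) /\
  Cis_series
    (fun n : nat =>
       (sigmabar_chi k chi (S n) * Rcpow (INR (S n)) (nu / 2) *
        BesselK nu (a * sqrt (INR (S n) * x)))%C)
    ((Rcpow 2 (nu + RtoC (2 * INR k + 1)) / Rcpow a (nu + RtoC (2 * INR k + 2))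
        * CGamma (RtoC (INR k + 1)) * CGamma (nu + RtoC (INR k + 1))
        * Lfun (RtoC (1 + INR k)) chi
        * Rcpow x (- (nu / 2) - RtoC (INR k + 1)))
     - (RtoC ((-1) ^ (k / 2)) * Ci * Rcpow (a * IZR q) nu * Rcpow x (nu / 2)
        / (Rcpow 2 (3 * nu + RtoC (INR k + 2)) * Rcpow PI (2 * nu + RtoC (INR k + 1)))
        * CGamma (nu + RtoC (INR k + 1)) * gauss_sum q chi * CSeries inner))%C.
Proof.
  intros Hk Hev Hprim Hodd Ha Hx Hnu c inner. split.
  - apply (dual_series_converges k q chi a x nu); assumption.
  - unfold c, inner. rewrite <- prefactors_eq by assumption. apply bessel_series; assumption.
Qed.
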